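(* Let $\varrho\in(0,1]$, $r\ge2$, $q\in(r,+\infty)$, $s\ge0$, $L\ge0$, $T>0$. Then the $n$th minimal error satisfies $$e^{(r)}_n(F^{\varrho,r,q}_L,\mathcal{W}_s,\delta_1,0)=\Theta(n^{-\varrho}+\delta_1)$$ and $$e^{(r)}_n(F^{\varrho,r,q}_L,\mathcal{W}_s,\delta_1,\delta_1)=\Theta(n^{-\varrho}+\delta_1),$$ as $n\to+\infty$ and $\delta_1\to0+$. An optimal algorithm is the Riemann-Maruyama quadrature $$\mathcal{A}^{RM}_n(\tilde X,\tilde W)=\sum_{i=0}^{n-1}\tilde X(t_i)\,(\tilde W(t_{i+1})-\tilde W(t_i))$$ based on the equidistant discretization $t_i=iT/n$, $i=0,1,\dots,n$; that is, its worst-case errors $e^{(r)}(\mathcal{A}^{RM}_n,F^{\varrho,r,q}_L,\mathcal{W}_s,\delta_1,0)$ and $e^{(r)}(\mathcal{A}^{RM}_n,F^{\varrho,r,q}_L,\mathcal{W}_s,\delta_1,\delta_1)$ are also of order $\Theta(n^{-\varrho}+\delta_1)$ as $n\to+\infty$ and $\delta_1\to0+$.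
   Context: $W=\{W(t)\}_{t\ge0}$ is a standard one-dimensional Wiener process on a complete probability space $(\Omega,\Sigma,\mathbb{P})$ with respect to a filtration $\{\Sigma_t\}_{t\ge0}$ satisfying the usual conditions. For a real random variable $Y$, $\|Y\|_q=(\mathbb{E}|Y|^q)^{1/q}$. $\mathcal{I}(X,W)=\int_0^T X(t)\,dW(t)$ is the It\^o integral. Integrands: for $L\ge0$, $F^{\varrho,r,q}_L$ is the class of all $\{\Sigma_t\}$-progressively measurable processes $X:[0,T]\times\Omega\to\mathbb{R}$ such that $\bigl\|\sup_{t\in[0,T]}|X(t)|\bigr\|_q\le L$ and $\|X(t)-X(z)\|_r\le L|t-z|^{\varrho}$ for all $t,z\in[0,T]$. Disturbing functions $p:[0,T]\times\mathbb{R}\to\mathbb{R}$ (with the convention $|y|^s:=0$ for all $y$ if $s=0$): $\mathcal{K}^1$ is the set of Borel measurable $p$ with $|p(t,y)|\le 1+|y|$ for all $t,y$; $\mathcal{K}^2_s$ is the set of $p\in C^{1,2}([0,T]\times\mathbb{R})$ with $\max\{|\partial_t p(t,y)|,|\partial_y p(t,y)|,|\partial_y^2 p(t,y)|\}\le 1+|y|^s$ for all $t,y$. Noisy versions, for $\delta_1,\delta_2\ge0$: $V_X(\delta_1)$ is the set of processes $\tilde X(t,\omega)=X(t,\omega)+\delta_1 p_X(t,X(t,\omega))$ with $p_X\in\mathcal{K}^1$; $\mathcal{W}_s(\delta_2)$ is the set of processes $\tilde W(t,\omega)=W(t,\omega)+\delta_2 p_W(t,W(t,\omega))$ with $p_W\in\mathcal{K}^2_s$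 (identities for all $(t,\omega)\in[0,T]\times\Omega$). Algorithms: an algorithm $\mathcal{A}$ is given by $\mathcal{A}(\tilde X,\tilde W,\delta_1,\delta_2)=\varphi(\tilde X(t_0),\dots,\tilde X(t_{i_1-1}),\tilde W(z_0),\dots,\tilde W(z_{i_2-1}))$, where $i_1,i_2\in\mathbb{N}=\{1,2,\dots\}$, the $t_j\in[0,T]$ are fixed pairwise distinct points, the $z_j\in[0,T]$ are fixed pairwise distinct points (nonadaptive information), and $\varphi:\mathbb{R}^{i_1+i_2}\to\mathbb{R}$ is Borel measurable. $\Phi_n$ is the class of all such algorithms with total number of evaluations $i_1+i_2\le n$. (The quadrature $\mathcal{A}^{RM}_n$ is regarded as having information cost $2n$; optimality is understood up to constants in this cost and in the error.) Errors: $$e^{(r)}(\mathcal{A},F^{\varrho,r,q}_L,\mathcal{W}_s,\delta_1,\delta_2)=\sup_{X\in F^{\varrho,r,q}_L}\ \sup_{(\tilde X,\tilde W)\in V_X(\delta_1)\times\mathcal{W}_s(\delta_2)}\|\mathcal{I}(X,W)-\mathcal{A}(\tilde X,\tilde W,\delta_1,\delta_2)\|_r,$$ and the $n$th minimal error is $e^{(r)}_n(F^{\varrho,r,q}_L,\mathcal{W}_s,\delta_1,\delta_2)=\inf_{\mathcal{A}\in\Phi_n}e^{(r)}(\mathcal{A},F^{\varrho,r,q}_L,\mathcal{W}_s,\delta_1,\delta_2)$. Asymptotic notation: $\Theta$ ''as $n\to+\infty$ and $\delta_1\to0+$'' means that there are constants $c,C,n_0,\delta_0>0$, depending only on $r,q,L,\varrho,T,s$,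 such that the lower bound with constant $c$ and the upper bound with constant $C$ hold for all $n\ge n_0$ and all $\delta_1\in[0,\delta_0]$.
   Formalization: For L=0 the lower bounds fail (then X=0 a.s., so the zero algorithm, and the quadrature at δ1=0, have error 0); the formal theorem asserts the four Θ statements for L>0 and only the four upper bounds for L=0. *)

(* Defs.v *)
From HB Require Import structures.
From mathcomp Require Import all_boot all_order all_algebra.
From mathcomp Require Import all_classical all_reals all_analysis measurable_realfun.
Import Order.TTheory GRing.Theory Num.Theory.
Import numFieldNormedType.Exports.

Set Implicit Arguments.
Unset Strict Implicit.
Unset Printing Implicit Defensive.

Local Open Scope classical_set_scope.
Local Open Scope ring_scope.

(* Processes, disturbing functions and filtrations are total in the time
   variable; only their values at times in [0, T] (in [0, +oo[ for filtrations
   and Wiener processes) are ever constrained or used. *)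

Definition usual_filtration (R : realType) (d : measure_display)
    (Omega : measurableType d) (P : probability Omega R)
    (F : R -> set (set Omega)) : Prop :=
  [/\ forall t : R, 0 <= t -> sigma_algebra setT (F t) /\ F t `<=` measurable,
      forall u t : R, 0 <= u -> u <= t -> F u `<=` F t,
      P.-negligible `<=` F 0 &
      forall t : R, 0 <= t -> F t = \bigcap_(u in `]t, +oo[) F u].

(* The second argument of [normal_prob] is the standard deviation. *)
Definition wiener_process (R : realType) (d : measure_display)
    (Omega : measurableType d) (P : probability Omega R)
    (F : R -> set (set Omega)) (W : R -> Omega -> R) : Prop :=
  [/\ forall t : R, 0 <= t ->
        measurable_fun setT (W t : g_sigma_algebraType (F t) -> R),
      {ae P, forall w, W 0 w = 0},
      {ae P, forall w, {within `[0, +oo[, continuous (fun t => W t w)}},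
      forall (u t : R) (A : set Omega) (B : set R), 0 <= u -> u <= t ->
        F u A -> measurable B ->
        let E : set Omega := [set w | B (W t w - W u w)] in
        P (A `&` E) = (P A * P E)%E &
      forall (u t : R) (B : set R), 0 <= u -> u < t -> measurable B ->
        P [set w | B (W t w - W u w)] = normal_prob 0 (Num.sqrt (t - u)) B].

Record setting (R : realType) := Setting {
  disp : measure_display ;
  Omega : measurableType disp ;
  Pr : probability Omega R ;
  filt : R -> set (set Omega) ;
  wiener : R -> Omega -> R ;
  Pr_complete : measure_is_complete Pr ;
  filt_usual : usual_filtration Pr filt ;
  wienerP : wiener_process Pr filt wiener
}.

Arguments filt {R} s.
Arguments wiener {R} s.

Definition rnorm (R : realType) (S : setting R) (r : R) (Y : Omega S -> R) :
    \bar R :=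
  'N[Pr S]_(r%:E)[EFin \o Y]%E.

Arguments rnorm {R S} r%_ring_scope Y%_ring_scope.

Definition progressive (R : realType) (S : setting R) (T : R)
    (X : R -> Omega S -> R) : Prop :=
  forall t : R, 0 <= t <= T ->
    measurable_fun (`[0, t] `*` setT)
      (fun z : R * g_sigma_algebraType (filt S t) => X z.1 z.2).

Record simple_process (R : realType) (S : setting R) (T : R) := SimpleProcess {
  sp_size : nat ;
  sp_time : nat -> R ;
  sp_val : nat -> Omega S -> R ;
  sp_time0 : sp_time 0 = 0 ;
  sp_timeT : sp_time sp_size = T ;
  sp_time_incr : forall i, (i < sp_size)%N -> sp_time i < sp_time i.+1 ;
  sp_val_meas : forall i, (i < sp_size)%N ->
    measurable_fun setT
      (sp_val i : g_sigma_algebraType (filt S (sp_time i)) -> R) ;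
  sp_val_bounded : forall i, (i < sp_size)%N ->
    exists M : R, forall w, `|sp_val i w| <= M
}.

Arguments sp_val {R S T} s.

Definition sp_process (R : realType) (S : setting R) (T : R)
    (H : simple_process S T) (t : R) (w : Omega S) : R :=
  \sum_(i < sp_size H)
     sp_val H i w * \1_(`]sp_time H i, sp_time H i.+1]) t.

Definition sp_integral (R : realType) (S : setting R) (T : R)
    (H : simple_process S T) (w : Omega S) : R :=
  \sum_(i < sp_size H)
     sp_val H i w * (wiener S (sp_time H i.+1) w - wiener S (sp_time H i) w).

(* The L^2 closure of the elementary integral; it determines I up to almost
   sure equality. *)
Definition is_ito_integral (R : realType) (S : setting R) (T : R)
    (X : R -> Omega S -> R) (I : Omega S -> R) : Prop :=
  measurable_fun setT I /\
  exists H : nat -> simple_process S T,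
    (fun k => \int[Pr S]_w \int[lebesgue_measure]_(t in `[0%R, T])
        ((X t w - sp_process (H k) t w) ^+ 2)%R%:E)%E @ \oo --> 0%E
    /\ (fun k => rnorm 2 (I \- sp_integral (H k))) @ \oo --> 0%E.

(* A version of the Ito integral; the default value [cst 0] is irrelevant, since
   a progressively measurable X with E (\int_0^T X^2) < oo has an integral. *)
Definition ito_integral (R : realType) (S : setting R) (T : R)
    (X : R -> Omega S -> R) : Omega S -> R :=
  xget (cst 0) [set I | is_ito_integral T X I].

Definition sup_abs (R : realType) (Om : Type) (T : R) (X : R -> Om -> R)
    (w : Om) : \bar R :=
  ereal_sup [set `|X t w|%:E | t in `[0, T]].

Definition integrands (R : realType) (S : setting R) (rho r q L T : R) :
    set (R -> Omega S -> R) :=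
  [set X | [/\ progressive T X,
    ('N[Pr S]_(q%:E)[sup_abs T X] <= L%:E)%E &
    forall t z : R, 0 <= t <= T -> 0 <= z <= T ->
      (rnorm r (X t \- X z) <= (L * `|t - z| `^ rho)%:E)%E]].

Definition K1 (R : realType) (T : R) : set (R -> R -> R) :=
  [set p : R -> R -> R | measurable_fun (`[0, T] `*` setT) (fun z : R * R => p z.1 z.2) /\
    forall t y : R, 0 <= t <= T -> `|p t y| <= 1 + `|y|].

(* |y|^s, with the convention |y|^0 := 0. *)
Definition abspow (R : realType) (s y : R) : R :=
  if s == 0 then 0 else `|y| `^ s.

(* p is C^{1,2} on [0, T] x R with partial derivatives pt, py, pyy; the time
   derivative is one-sided at the end points 0 and T. *)
Definition C12_with (R : realType) (T : R) (p pt py pyy : R -> R -> R) : Prop :=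
  [/\ forall t y : R, 0 <= t <= T ->
        (fun u => (p u y - p t y) / (u - t)) @ within `[0, T] t^' --> (pt t y : R),
      forall t y : R, 0 <= t <= T -> is_derive y 1 (p t) (py t y),
      forall t y : R, 0 <= t <= T -> is_derive y 1 (py t) (pyy t y) &
      forall f, [\/ f = p, f = pt, f = py | f = pyy] ->
        {within `[0, T] `*` setT, continuous (fun z : R * R => f z.1 z.2)}].

Definition K2 (R : realType) (s T : R) : set (R -> R -> R) :=
  [set p : R -> R -> R | exists pt py pyy : R -> R -> R, C12_with T p pt py pyy /\
    forall t y : R, 0 <= t <= T ->
      [/\ `|pt t y| <= 1 + abspow s y,
          `|py t y| <= 1 + abspow s y &
          `|pyy t y| <= 1 + abspow s y]].

Definition perturbed (R : realType) (Om : Type) (T : R) (K : set (R -> R -> R))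
    (Y : R -> Om -> R) (delta : R) : set (R -> Om -> R) :=
  [set Y' | exists2 p, K p &
    forall t w, 0 <= t <= T -> Y' t w = Y t w + delta * p t (Y t w)].

Definition noisy_integrands (R : realType) (S : setting R) (T : R)
    (X : R -> Omega S -> R) (delta1 : R) : set (R -> Omega S -> R) :=
  perturbed T (K1 T) X delta1.

Definition noisy_wieners (R : realType) (S : setting R) (s T : R)
    (delta2 : R) : set (R -> Omega S -> R) :=
  perturbed T (K2 s T) (wiener S) delta2.

(* R^{i1 + i2} is the type of (i1 + i2)-tuples with its product (Borel)
   sigma-algebra. *)
Record algorithm (R : realType) (T : R) := Algorithm {
  i1 : nat ;
  i2 : nat ;
  i1_gt0 : (0 < i1)%N ;
  i2_gt0 : (0 < i2)%N ;
  xpt : 'I_i1 -> R ;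
  wpt : 'I_i2 -> R ;
  xpt_in : forall j, 0 <= xpt j <= T ;
  wpt_in : forall j, 0 <= wpt j <= T ;
  xpt_inj : injective xpt ;
  wpt_inj : injective wpt ;
  phi : (i1 + i2).-tuple R -> R ;
  phi_meas : measurable_fun setT phi
}.

Arguments xpt {R T} a j.
Arguments wpt {R T} a j.
Arguments phi {R T} a v.

(* Output on the (noisy) trajectories x of the integrand and y of the Wiener
   process. *)
Definition run (R : realType) (T : R) (a : algorithm T) (x y : R -> R) : R :=
  phi a [tuple of [tuple x (xpt a j) | j < i1 a] ++
                  [tuple y (wpt a j) | j < i2 a]].

Definition Phi (R : realType) (T : R) (n : nat) :
    set ((R -> R) -> (R -> R) -> R) :=
  [set A | exists2 a : algorithm T, (i1 a + i2 a <= n)%N & A = run a].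

Definition riemann_maruyama (R : realType) (T : R) (n : nat) (x y : R -> R) :
    R :=
  \sum_(i < n) x (i%:R * T / n%:R) *
    (y (i.+1%:R * T / n%:R) - y (i%:R * T / n%:R)).

Definition error (R : realType) (rho r q s L T : R) (S : setting R)
    (A : (R -> R) -> (R -> R) -> R) (delta1 delta2 : R) : \bar R :=
  ereal_sup [set e | exists X X' W' : R -> Omega S -> R,
    [/\ integrands rho r q L T X,
        noisy_integrands T X delta1 X',
        noisy_wieners s T delta2 W' &
        e = rnorm r
              (fun w => ito_integral T X w - A (X' ^~ w) (W' ^~ w))]].

Definition minimal_error (R : realType) (rho r q s L T : R) (S : setting R)
    (n : nat) (delta1 delta2 : R) : \bar R :=
  ereal_inf [set error rho r q s L T S A delta1 delta2 | A in Phi T n].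

(* As n -> oo and delta -> 0+; the constants are chosen before the setting
   (probability space, filtration, Wiener process). *)
Definition bigO_unif (R : realType) (e : setting R -> nat -> R -> \bar R)
    (g : nat -> R -> R) : Prop :=
  exists (C delta0 : R) (n0 : nat), [/\ 0 < C, 0 < delta0, (0 < n0)%N &
    forall S n delta, (n0 <= n)%N -> 0 <= delta <= delta0 ->
      (e S n delta <= (C * g n delta)%:E)%E].

Definition bigOmega_unif (R : realType) (e : setting R -> nat -> R -> \bar R)
    (g : nat -> R -> R) : Prop :=
  exists (c delta0 : R) (n0 : nat), [/\ 0 < c, 0 < delta0, (0 < n0)%N &
    forall S n delta, (n0 <= n)%N -> 0 <= delta <= delta0 ->
      ((c * g n delta)%:E <= e S n delta)%E].

Definition Theta_unif (R : realType) (e : setting R -> nat -> R -> \bar R)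
    (g : nat -> R -> R) : Prop :=
  bigO_unif e g /\ bigOmega_unif e g.

Section riemann_maruyama_algorithm.
Variables (R : realType) (T : R) (n : nat).
Hypotheses (T_gt0 : 0 < T) (n_gt0 : (0 < n)%N).

Let grid (m : nat) (j : 'I_m) : R := j%:R * T / n%:R.

Let n0R : (n%:R : R) != 0. Proof. by rewrite pnatr_eq0 -lt0n. Qed.

Let grid_inj m : injective (@grid m).
Proof.
move=> i j /(mulIf (invr_neq0 n0R)) /(mulIf (lt0r_neq0 T_gt0)) /eqP.
by rewrite eqr_nat => /eqP /val_inj.
Qed.

Let grid_in m (j : 'I_m) : (m <= n.+1)%N -> 0 <= grid j <= T.
Proof.
move=> mn; apply/andP; split.
  by rewrite /grid divr_ge0 ?mulr_ge0 ?ler0n// ltW.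
rewrite /grid ler_pdivrMr ?ltr0n// mulrC ler_pM2l// ler_nat -ltnS.
exact: leq_trans (ltn_ord j) mn.
Qed.

Let xidx (i : 'I_n) : 'I_(n + n.+1) := lshift n.+1 i.
Let widx (i : 'I_n.+1) : 'I_(n + n.+1) := rshift n i.

Let rm_phi (v : (n + n.+1).-tuple R) : R :=
  \sum_(i < n) tnth v (xidx i) *
    (tnth v (widx (lift ord0 i)) - tnth v (widx (widen_ord (leqnSn n) i))).

Let rm_phi_meas : measurable_fun setT rm_phi.
Proof.
apply: measurable_sum => i; apply: measurable_funM.
  exact: measurable_tnth.
by apply: measurable_funB; exact: measurable_tnth.
Qed.

(* The quadrature uses n values of the integrand and n + 1 of the Wiener
   process. *)
Lemma riemann_maruyama_Phi : Phi T (n + n.+1) (@riemann_maruyama R T n).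
Proof.
exists (@Algorithm R T n n.+1 n_gt0 isT (@grid n) (@grid n.+1)
  (fun j => grid_in j (leqnSn n)) (fun j => grid_in j (leqnn _))
  (@grid_inj n) (@grid_inj n.+1) rm_phi rm_phi_meas) => //.
apply/funext => x; apply/funext => y.
rewrite /run/= /rm_phi /riemann_maruyama; apply: eq_bigr => i _.
by rewrite /xidx /widx tnth_lshift !tnth_rshift !tnth_mktuple.
Qed.

End riemann_maruyama_algorithm.

(* Main.v *)
(* The quadrature M = sum X(t_i) (W(t_(i+1)) - W(t_i)) is a martingale transform, and the
   elementary inequality E|a + b Z|^r <= (1 + C h) |a|^r + C h |b|^r for Z ~ N(0, h), iterated
   over the grid, bounds its L^r norm by a constant times sup_i ||X(t_i)||_r.  Applied to the
   difference of the quadratures on two nested grids, this shows that the quadratures along the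
   grids with n 2^j steps are Cauchy in L^r; their limit is the Ito integral, so that it exists
   and the quadrature error is O(n^-rho).  The noise in X enters through a martingale transform
   again.  The noise in W enters through p(t, W(t)), whose increments are p_y(t_i, W(t_i)) dW_i
   up to a remainder of size h + dW_i^2; the first part is a martingale transform, the remainder
   is summed by the triangle inequality, and Hoelder's inequality (q > r) separates X from W.

   For the lower bounds, an algorithm that cannot distinguish X1 from X2 errs on one of them by
   at least ||I(X1) - I(X2)||_2 / 2, which the Ito isometry expresses through X1 - X2.  The
   constants delta and -delta, both of which the noise may shift to 0, give the term delta;
   c dist(t, nodes)^rho and its opposite, which agree at the nodes of X, give n^-rho. *)

Require Import Defs.
From HB Require Import structures.
From mathcomp Require Import all_boot all_order all_algebra.
From mathcomp Require Import all_classical all_reals all_analysis measurable_realfun.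
From mathcomp Require Import lra ring zify.
Import Order.TTheory GRing.Theory Num.Theory.
Import numFieldNormedType.Exports.
Set Implicit Arguments.
Unset Strict Implicit.
Unset Printing Implicit Defensive.
Local Open Scope classical_set_scope.
Local Open Scope ring_scope.

(** * Real inequalities *)

(** All constants must be the same for every setting, so each estimate is reduced to an integral
    against a centred normal law. The one-step inequality takes the place of the
    Burkholder-Davis-Gundy inequality: the symmetry of the law removes the term of order sqrt h, and
    an excess of order h survives T/h iterations. Consequently the difference between a grid and any
    refinement of it is bounded independently of the refinement factor, and the rate for n steps is
    read off at the first term of the Cauchy sequence, without summing a series.

    [ito_integral] is a choice with a default value, so existence has to be shown for each integrand
    and uniqueness links the chosen version to the limit that was constructed. Simple processes are
    bounded while integrands are not; the truncation that bridges this uses q > 2.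

    The noise in W is split because its n increments have size sqrt h each: the triangle inequality
    alone would lose a factor sqrt n. Only the remainder, of size h per step, can be summed that
    way; the first-order part is adapted with the derivative at the left end point and is treated as
    a martingale transform. *)

Section real_inequalities.
Context {R : realType}.
Implicit Types a b c r s t x y : R.

(** With u = exp(s/2) and v = exp(-s/2) we have uv = 1, so the left-hand side is 2 + (u - v)^2, and
    1 - exp(-s) <= s gives u - v <= u s for s >= 0. *)
Lemma expR_sym_le s : expR s + expR (- s) <= 2 + s ^+ 2 * expR `|s|.
Proof.
wlog s0 : s / 0 <= s.
  move=> h; have [/h//|s0] := leP 0 s.
  have := h (- s); rewrite oppr_ge0 ltW// sqrrN normrN opprK addrC; exact.
rewrite ger0_norm//.
set u := expR (s / 2); set v := expR (- (s / 2)).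
have uv : u * v = 1 by rewrite -expRD subrr expR0.
have u2 : expR s = u ^+ 2 by rewrite /u expr2 -expRD -splitr.
have v2 : expR (- s) = v ^+ 2.
  by rewrite /v expr2 -expRD -opprD -splitr.
have u0 : 0 < u := expR_gt0 _.
have v0 : 0 < v := expR_gt0 _.
have v2s : 1 - s <= v ^+ 2 by rewrite -v2 expR_ge1Dx.
have vu : v <= u by rewrite ler_expR; lra.
have uvs : u - v <= u * s.
  have -> : u - v = u * (1 - v ^+ 2) by rewrite mulrBr mulr1 expr2 mulrA uv mul1r.
  by rewrite ler_pM2l//; lra.
have : (u - v) ^+ 2 <= (u * s) ^+ 2 by rewrite lerXn2r ?nnegrE//; nra.
rewrite u2 v2; nra.
Qed.

Lemma powR1D_le_expR r t : 0 <= r -> -1 <= t -> (1 + t) `^ r <= expR (r * t).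
Proof.
move=> r0 t1; have [<-|/eqP] := eqVneq (-1) t.
  rewrite subrr; have [->|rn0] := eqVneq r 0; first by rewrite powRr0 mul0r expR0.
  by rewrite powR0// expR_ge0.
move=> /eqP t1'; have t1'' : 0 < 1 + t.
  by rewrite -ltrBlDl sub0r lt_neqAle t1' t1.
rewrite /powR gt_eqF// ler_expR ler_wpM2l//.
by rewrite -ler_expR lnK ?posrE// expR_ge1Dx.
Qed.

(** The left-hand side is |a|^(r-2) b^2, which is at most the r-th power of the larger of |a| and
    |b|. *)
Lemma powR_ratio_le r a b : 2 <= r -> a != 0 ->
  `|a| `^ r * (b / a) ^+ 2 <= `|a| `^ r + `|b| `^ r.
Proof.
move=> r2 a0; have na0 : 0 < `|a| by rewrite normr_gt0.
have -> : (b / a) ^+ 2 = (`|b| / `|a|) ^+ 2.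
  by rewrite -normf_div real_normK ?num_real.
have split_pow x : 0 < x -> x `^ r = x `^ (r - 2) * x ^+ 2.
  move=> x0; rewrite -powR_mulrn ?ltW// -powRD ?subrK//.
  by rewrite (gt_eqF x0) implybT.
have [ba|ab] := leP `|b| `|a|.
  rewrite (@le_trans _ _ (`|a| `^ r))// ?lerDl ?powR_ge0//.
  rewrite ler_piMr ?powR_ge0// exprn_ile1// ?divr_ge0//.
  by rewrite ler_pdivrMr// mul1r.
have b0 : 0 < `|b| := lt_trans na0 ab.
rewrite (@le_trans _ _ (`|b| `^ r))// ?lerDr ?powR_ge0//.
rewrite split_pow// [leRHS]split_pow// exprMn exprVn.
rewrite -mulrA [X in _ * X](_ : _ = `|b| ^+ 2); last first.
  by rewrite mulrCA divff ?mulr1// expf_neq0// gt_eqF.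
by rewrite ler_wpM2r ?sqr_ge0// ge0_ler_powR ?nnegrE ?(ltW ab)// subr_ge0.
Qed.

(* The symmetrization cancels the first-order term of the Taylor expansion of
   |.|^r at a; the second-order one is bounded through 1 + t <= exp t. *)
Lemma powR_sym_le r a b x : 2 <= r ->
  2^-1 * (`|a + b * x| `^ r + `|a - b * x| `^ r) <=
  `|a| `^ r + r ^+ 2 * expR r * (`|a| `^ r + `|b| `^ r) * x ^+ 2
  + 2 `^ r * `|b| `^ r * `|x| `^ r.
Proof.
move=> r2; have r0 : 0 <= r by lra.
have Ar := powR_ge0 `|a| r; have Br := powR_ge0 `|b| r.
have Xr := powR_ge0 `|x| r; have Tr := powR_ge0 (2 : R) r.
have K0 : 0 <= r ^+ 2 * expR r by rewrite mulr_ge0 ?sqr_ge0 ?expR_ge0.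
have M0 : 0 <= r ^+ 2 * expR r * (`|a| `^ r + `|b| `^ r) * x ^+ 2.
  by apply: mulr_ge0; [apply: mulr_ge0 => //; exact: addr_ge0|exact: sqr_ge0].
have L0 : 0 <= 2 `^ r * `|b| `^ r * `|x| `^ r by rewrite !mulr_ge0.
(* If |a| <= |bx|, both terms are at most (2|bx|)^r, the last summand of the bound. Otherwise t =
   bx/a lies in [-1, 1] and a factors out, leaving the non-negative bases 1 + t and 1 - t. *)
have [ab|ba] := leP `|a| `|b * x|.
  have h c : `|c| <= `|a| + `|b * x| -> `|c| `^ r <= 2 `^ r * `|b| `^ r * `|x| `^ r.
    move=> hc; rewrite -mulrA -powRM// -normrM -powRM//.
    rewrite ge0_ler_powR ?nnegrE ?mulr_ge0//.
    by rewrite (le_trans hc)// mulr2n mulrDl mul1r lerD2r.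
  have := h _ (ler_normD a (b * x)).
  have := h _ (ler_normB a (b * x)); lra.
have a0 : a != 0.
  by apply/eqP => a0; move: ba; rewrite a0 normr0 normr_lt0.
set t := b * x / a.
have t1 : `|t| <= 1 by rewrite normf_div ler_pdivrMr ?normr_gt0// mul1r ltW.
have -> : a + b * x = a * (1 + t) by rewrite /t; field.
have -> : a - b * x = a * (1 - t) by rewrite /t; field.
move: (t1); rewrite ler_norml => /andP[t1l t1r].
rewrite !normrM (ger0_norm (_ : 0 <= 1 + t)); last lra.
rewrite (ger0_norm (_ : 0 <= 1 - t)); last lra.
rewrite !powRM//; [|lra..].
rewrite -mulrDr mulrCA.
have e1 : (1 + t) `^ r + (1 - t) `^ r <= 2 + (r * t) ^+ 2 * expR r.
  apply: (@le_trans _ _ (expR (r * t) + expR (- (r * t)))).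
    rewrite lerD//; first exact: powR1D_le_expR.
    by rewrite -(mulrN r t); apply: powR1D_le_expR => //; lra.
  rewrite (le_trans (expR_sym_le _))// lerD2l ler_wpM2l ?sqr_ge0// ler_expR.
  by rewrite normrM ger0_norm// ler_piMr.
have e2 := @powR_ratio_le r a b r2 a0.
have t2 : t ^+ 2 = (b / a) ^+ 2 * x ^+ 2 by rewrite /t mulrAC exprMn.
apply: (@le_trans _ _ (`|a| `^ r + r ^+ 2 * expR r * (`|a| `^ r * (b / a) ^+ 2) * x ^+ 2)).
  apply: (@le_trans _ _ (`|a| `^ r * (2^-1 * (2 + (r * t) ^+ 2 * expR r)))).
    by rewrite ler_wpM2l// ler_wpM2l.
  rewrite exprMn t2; set u := `|a| `^ r * (b / a) ^+ 2.
  have u0 : 0 <= u by rewrite mulr_ge0// sqr_ge0.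
  have -> : `|a| `^ r * (2^-1 * (2 + r ^+ 2 * ((b / a) ^+ 2 * x ^+ 2) * expR r)) =
    `|a| `^ r + 2^-1 * (r ^+ 2 * expR r * u * x ^+ 2) by rewrite /u; field.
  rewrite lerD2l; apply: ler_piMl; last by rewrite invf_le1// ler1n.
  by apply: mulr_ge0; [exact: mulr_ge0|exact: sqr_ge0].
rewrite -addrA lerD2l; apply: (le_trans _ (ler_wpDr L0 (lexx _))).
by rewrite ler_wpM2r ?sqr_ge0// ler_wpM2l.
Qed.

End real_inequalities.

(** * L^p norms *)

Section lnorm_toolbox.
Context d (T : measurableType d) {R : realType}.
Variable mu : {measure set T -> \bar R}.
Implicit Types (p q r c : R) (Y Z : T -> R) (f g : T -> \bar R).
Local Open Scope ereal_scope.

(** The integral of a non-negative function is a supremum over the simple functions below it, so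
    monotonicity also covers non-measurable functions, such as the supremum of a path over
    uncountably many times. *)
Lemma ge0_le_integralT f g : (forall x, 0 <= f x) -> (forall x, f x <= g x) ->
  \int[mu]_x f x <= \int[mu]_x g x.
Proof.
move=> f0 fg; have g0 x : 0 <= g x by exact: le_trans (fg x).
rewrite !ge0_integralTE//; apply: le_ereal_sup => _ [h /= hf <-].
by exists h => // x; exact: le_trans (fg x).
Qed.

Lemma le_Lnorm p f g : (0 < p)%R -> (forall x, `|f x| <= `|g x|) ->
  'N[mu]_(p%:E)[f] <= 'N[mu]_(p%:E)[g].
Proof.
move=> p0 fg; rewrite unlock gt0_ler_poweR ?invr_ge0 ?(ltW p0)//.
- by rewrite in_itv/= leey andbT integral_ge0// => x _; exact: poweR_ge0.
- by rewrite in_itv/= leey andbT integral_ge0// => x _; exact: poweR_ge0.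
apply: ge0_le_integralT => x; first exact: poweR_ge0.
by rewrite gt0_ler_poweR ?(ltW p0)// in_itv/= leey abse_ge0.
Qed.

Lemma le_LnormEFin p Y Z : (0 < p)%R -> (forall x, `|Y x| <= `|Z x|)%R ->
  'N[mu]_(p%:E)[EFin \o Y] <= 'N[mu]_(p%:E)[EFin \o Z].
Proof. by move=> p0 YZ; apply: le_Lnorm => // x; rewrite /= lee_fin. Qed.

Lemma Lnorm_moment p Y c : (0 < p)%R -> (0 <= c)%R ->
  ('N[mu]_(p%:E)[EFin \o Y] <= c%:E) =
  (\int[mu]_x (`|Y x| `^ p)%:E <= (c `^ p)%:E).
Proof.
move=> p0 c0.
have -> : \int[mu]_x (`|Y x| `^ p)%:E = 'N[mu]_(p%:E)[EFin \o Y] `^ p.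
  by rewrite powR_Lnorm// gt_eqF.
have := Lnorm_ge0 mu p%:E (EFin \o Y).
move: ('N[mu]_(p%:E)[EFin \o Y]) => [x|_|]//.
  rewrite !lee_fin => x0; apply/idP/idP => h.
    by rewrite ge0_ler_powR ?nnegrE// ltW.
  rewrite leNgt; apply/negP => cx; move: h; apply/negP; rewrite -ltNge.
  by rewrite gt0_ltr_powR// nnegrE.
by rewrite poweRyr// gt_eqF.
Qed.

Lemma Lnorm_cst_mul p (k : R) Y : (0 < p)%R -> measurable_fun setT Y ->
  'N[mu]_(p%:E)[EFin \o (fun x => k * Y x)%R] = `|k|%:E * 'N[mu]_(p%:E)[EFin \o Y].
Proof.
move=> p0 mY; rewrite unlock.
under eq_integral do rewrite /= normrM powRM// EFinM.
rewrite ge0_integralZl//; last first.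
  apply/measurable_EFinP; apply: (measurableT_comp (measurable_powR _)).
  exact: measurableT_comp.
rewrite poweRM ?lee_fin ?powR_ge0//; last by apply: integral_ge0.
by rewrite poweR_EFin -powRrM mulfV ?gt_eqF// powRr1.
Qed.

Lemma LnormN p Y : 'N[mu]_(p%:E)[EFin \o (fun x => - Y x)%R] = 'N[mu]_(p%:E)[EFin \o Y].
Proof. by rewrite -(oppe_Lnorm mu (EFin \o Y)). Qed.

Lemma LnormD p Y Z : (1 <= p)%R -> measurable_fun setT Y -> measurable_fun setT Z ->
  'N[mu]_(p%:E)[EFin \o (fun x => Y x + Z x)%R] <=
  'N[mu]_(p%:E)[EFin \o Y] + 'N[mu]_(p%:E)[EFin \o Z].
Proof. by move=> p1 mY mZ; exact: minkowski_EFin. Qed.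

Lemma LnormB p Y Z : (1 <= p)%R -> measurable_fun setT Y -> measurable_fun setT Z ->
  'N[mu]_(p%:E)[EFin \o (fun x => Y x - Z x)%R] <=
  'N[mu]_(p%:E)[EFin \o Y] + 'N[mu]_(p%:E)[EFin \o Z].
Proof.
move=> p1 mY mZ; rewrite -(LnormN p Z).
by apply: LnormD => //; exact: measurableT_comp.
Qed.

Lemma Lnorm_sum p n (Y : nat -> T -> R) : (1 <= p)%R ->
  (forall i, (i < n)%N -> measurable_fun setT (Y i)) ->
  'N[mu]_(p%:E)[EFin \o (fun x => \sum_(i < n) Y i x)%R] <=
  \sum_(i < n) 'N[mu]_(p%:E)[EFin \o Y i].
Proof.
move=> p1; elim: n => [|n IH] mY.
  rewrite big_ord0 (_ : (fun _ => _) = cst 0%R); last first.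
    by apply/funext => x; rewrite big_ord0.
  by rewrite (_ : _ \o _ = cst 0)// Lnorm0// eqe gt_eqF// (lt_le_trans ltr01).
rewrite big_ord_recr/= (_ : (fun _ => _) =
  (fun x => \sum_(i < n) Y i x + Y n x)%R); last first.
  by apply/funext => x; rewrite big_ord_recr.
apply: (le_trans (LnormD p1 _ _)); last 2 first.
- exact: mY.
- by rewrite leeD2r// IH// => i ni; apply: mY; rewrite ltnS ltnW.
apply: measurable_sum => i; apply: mY; rewrite ltnS ltnW//.
Qed.

Lemma Lnorm_sum_le p n (Y : nat -> T -> R) c : (1 <= p)%R ->
  (forall i, (i < n)%N -> measurable_fun setT (Y i)) ->
  (forall i, (i < n)%N -> 'N[mu]_(p%:E)[EFin \o Y i] <= c%:E) ->
  'N[mu]_(p%:E)[EFin \o (fun x => \sum_(i < n) Y i x)%R] <= (n%:R * c)%:E.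
Proof.
move=> p1 mY Yc; apply: (le_trans (Lnorm_sum p1 mY)).
apply: (@le_trans _ _ (\sum_(i < n) c%:E)); first by apply: lee_sum => i _; exact: Yc.
by rewrite sumEFin sumr_const card_ord mulr_natl.
Qed.

Lemma Lnorm_pow p r Y : (0 < p)%R -> (0 < r)%R ->
  'N[mu]_(p%:E)[EFin \o (fun x => `|Y x| `^ r)%R] =
  'N[mu]_((p * r)%:E)[EFin \o Y] `^ r.
Proof.
move=> p0 r0; rewrite unlock.
under eq_integral do rewrite /= ger0_norm ?powR_ge0// -powRrM mulrC.
rewrite -poweRrM invfM -mulrA mulVf ?gt_eqF// mulr1.
by congr (_ `^ _); apply: eq_integral => x _; rewrite /= mulrC.
Qed.

(* Hoelder's inequality with three exponents: 1/r = 1/p + 1/q. *)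
Lemma Lnorm_mul r p q Y Z : (0 < r)%R -> (0 < p)%R -> (0 < q)%R ->
  (p^-1 + q^-1 = r^-1)%R -> measurable_fun setT Y -> measurable_fun setT Z ->
  'N[mu]_(r%:E)[EFin \o (fun x => Y x * Z x)%R] <=
  'N[mu]_(p%:E)[EFin \o Y] * 'N[mu]_(q%:E)[EFin \o Z].
Proof.
move=> r0 p0 q0 pqr mY mZ.
have mpow (X : T -> R) : measurable_fun setT X -> measurable_fun setT (fun x => `|X x| `^ r)%R.
  by move=> mX; apply: (measurableT_comp (measurable_powR _)); exact: measurableT_comp.
have := @hoelder _ _ _ mu _ _ (p / r) (q / r) (mpow _ mY) (mpow _ mZ).
rewrite !divr_gt0// !invf_div -mulrDr.
have -> : (r * (p^-1 + q^-1) = 1)%R by rewrite pqr mulfV// gt_eqF.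
move=> /(_ isT isT erefl).
rewrite !Lnorm_pow ?divr_gt0// !divfK ?gt_eqF//.
rewrite [X in 'N[mu]_ _[X]](_ : _ = EFin \o (fun x => `|Y x * Z x| `^ r)%R); last first.
  by apply/funext => x /=; rewrite normrM powRM.
rewrite Lnorm_pow// mul1r -poweRM ?Lnorm_ge0//.
move=> /(@gt0_ler_poweR _ r^-1); rewrite -!poweRrM mulfV ?gt_eqF//.
rewrite !poweRe1 ?mule_ge0 ?Lnorm_ge0//; apply.
- by rewrite invr_ge0 ltW.
- by rewrite in_itv/= leey poweR_ge0.
- by rewrite in_itv/= leey poweR_ge0.
Qed.

End lnorm_toolbox.

Section lnorm_probability.
Context d (T : measurableType d) {R : realType} (P : probability T R).
Implicit Types (p q r c : R) (Y Z : T -> R).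
Local Open Scope ereal_scope.

Lemma Lnorm_cstP p c : (0 < p)%R -> 'N[P]_(p%:E)[EFin \o cst c] = `|c|%:E.
Proof.
move=> p0; rewrite unlock.
have -> : \int[P]_x `|(EFin \o cst c) x| `^ p = `|c|%:E `^ p.
  rewrite -[RHS]mule1 -(probability_setT P).
  exact: (integral_cst P measurableT (`|c|%:E `^ p)).
by rewrite poweR_EFin -powRrM mulfV ?gt_eqF// powRr1.
Qed.

(** Hoelder's inequality against the constant 1, which has norm 1 under a probability. *)
Lemma Lnorm_exponent_le p q Y : (0 < p)%R -> (p <= q)%R -> measurable_fun setT Y ->
  'N[P]_(p%:E)[EFin \o Y] <= 'N[P]_(q%:E)[EFin \o Y].
Proof.
move=> p0; rewrite le_eqVlt => /predU1P[->//|pq] mY.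
have q0 := lt_trans p0 pq.
have d0 : (0 < p^-1 - q^-1)%R by rewrite subr_gt0 ltf_pV2.
have := @Lnorm_mul _ _ _ P p q (p^-1 - q^-1)^-1 Y (cst 1%R) p0 q0.
rewrite invr_gt0 d0 invrK addrC subrK => /(_ isT erefl mY (measurable_cst _)).
rewrite Lnorm_cstP ?invr_gt0// normr1 mule1.
by congr (_ <= _); congr Lnorm; apply/funext => x /=; rewrite mulr1.
Qed.

Lemma Lnorm_ae_eq p Y Z : measurable_fun setT Y -> measurable_fun setT Z ->
  {ae P, forall x, Y x = Z x} -> 'N[P]_(p%:E)[EFin \o Y] = 'N[P]_(p%:E)[EFin \o Z].
Proof.
move=> mY mZ YZ; rewrite unlock; apply: (congr1 (fun x => x `^ p^-1)).
have mp (X : T -> R) : measurable_fun setT X -> measurable_fun setT (fun x => (`|(EFin \o X) x| `^ p)).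
  move=> mX; apply/measurable_EFinP; apply: (measurableT_comp (measurable_powR _)).
  exact: measurableT_comp.
apply: ae_eq_integral => //; [exact: mp|exact: mp|].
by apply: filterS YZ => x /= -> _.
Qed.

End lnorm_probability.

(** * Gaussian moments *)

Section gaussian.
Context {R : realType}.
Notation mu := (@lebesgue_measure R).
Notation N s := (@normal_prob R 0 s).
Implicit Types (s p x : R) (f g : R -> \bar R).
Local Open Scope ereal_scope.

(** The change of variables produces the Radon-Nikodym derivative of the normal law; it agrees
    almost everywhere with the density because both have the same integral over every measurable
    set. *)
Lemma integral_normal_prob s f : measurable_fun setT f -> (forall x, 0 <= f x) ->
  \int[N s]_x f x = \int[mu]_x (f x * (normal_pdf 0 s x)%:E).
Proof.
move=> mf f0.
have dom := @normal_prob_dominates R 0 s.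
rewrite -(@Radon_Nikodym_SigmaFinite.change_of_variables _ _ R (N s) mu dom)//.
have mpdf : measurable_fun setT (fun x => (normal_pdf 0 s x)%:E : \bar R).
  by apply/measurable_EFinP; exact: measurable_normal_pdf.
have iRN := Radon_Nikodym_SigmaFinite.f_integrable dom.
apply: ae_eq_integral => //.
- by apply: emeasurable_funM => //; exact: (measurable_int mu).
- exact: emeasurable_funM.
- apply: ae_eqe_mul2l; apply: integral_ae_eq => // A _ mA.
  by rewrite -Radon_Nikodym_SigmaFinite.f_integral.
Qed.

(** The image of Lebesgue measure under x -> s x, multiplied by s, gives half-open intervals their
    length, hence is Lebesgue measure. *)
Lemma lebesgue_integral_scale s g : (0 < s)%R -> measurable_fun setT g ->
  (forall x, 0 <= g x) -> \int[mu]_x g x = s%:E * \int[mu]_x g (s * x)%R.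
Proof.
move=> s0 mg g0.
pose phi (x : measurableTypeR R) : measurableTypeR R := (s * x)%R.
have ms : measurable_fun setT phi by exact: mulrl_measurable.
pose s' : {nonneg R} := NngNum (ltW s0).
have e : \int[pushforward mu phi]_x g x = \int[mu]_x g (s * x)%R.
  by rewrite ge0_integral_pushforward// preimage_setT.
rewrite -e.
have := ge0_integral_mscale (pushforward mu phi) measurableT s' mg.
move=> /(_ ms (fun x _ => g0 x)) /= <-.
apply: eq_measure_integral => A mA _.
apply: lebesgue_measure_unique => //= _ [[a b]] _ <-.
rewrite /mscale/= /pushforward.
have -> : phi @^-1` `]a, b]%classic = `](a / s)%R, (b / s)%R]%classic.
  apply/seteqP; split => x /=; rewrite /phi !in_itv/=.
    by rewrite ltr_pdivrMr// ler_pdivlMr// mulrC.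
  by rewrite ltr_pdivrMr// ler_pdivlMr// mulrC.
rewrite !lebesgue_measure_itv/= !lte_fin ltr_pM2r ?invr_gt0//.
case: ifPn => ab; last by rewrite mule0.
by rewrite -!EFinB -EFinM; congr EFin; field; rewrite gt_eqF.
Qed.

Lemma lebesgue_integral_opp g : measurable_fun setT g ->
  (forall x, 0 <= g x) -> \int[mu]_x g x = \int[mu]_x g (- x)%R.
Proof.
move=> mg g0.
pose phi (x : measurableTypeR R) : measurableTypeR R := (- x)%R.
have ms : measurable_fun setT phi by exact: oppr_measurable.
have <- : \int[pushforward mu phi]_x g x = \int[mu]_x g (- x)%R.
  by rewrite ge0_integral_pushforward// preimage_setT.
by apply: eq_measure_integral => //= A mA AS; exact/esym/lebesgue_measureN.
Qed.

Lemma normal_prob_sym s f : s != 0%R -> measurable_fun setT f -> (forall x, 0 <= f x) ->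
  \int[N s]_x f x = \int[N s]_x f (- x)%R.
Proof.
move=> s0 mf f0; rewrite !integral_normal_prob//; last first.
  by apply: measurableT_comp => //; exact: oppr_measurable.
rewrite lebesgue_integral_opp.
- apply: eq_integral => x _; congr (_ * EFin _).
  by rewrite normal_pdfE// /normal_fun !subr0 sqrrN.
- apply: emeasurable_funM => //; apply/measurable_EFinP.
  exact: measurable_normal_pdf.
- by move=> x; rewrite mule_ge0// lee_fin normal_pdf_ge0.
Qed.

Definition gauss_moment p : \bar R := \int[N 1]_x (`|x| `^ p)%:E.

Lemma measurable_abspow p : measurable_fun setT (fun x : R => `|x| `^ p)%R.
Proof. by apply: (measurableT_comp (measurable_powR _)); apply: normr_measurable. Qed.

Lemma normal_prob_moment s p : (0 < s)%R ->
  \int[N s]_x (`|x| `^ p)%:E = (s `^ p)%:E * gauss_moment p.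
Proof.
move=> s0; have mp : measurable_fun setT (fun x : R => (`|x| `^ p)%:E : \bar R).
  by apply/measurable_EFinP; exact: measurable_abspow.
have mpdf t : measurable_fun setT (fun x => (normal_pdf 0 t x)%:E : \bar R).
  by apply/measurable_EFinP; exact: measurable_normal_pdf.
have p0 (x : R) : 0 <= (`|x| `^ p)%:E by rewrite lee_fin powR_ge0.
have d0 t (x : R) : 0 <= (normal_pdf 0 t x)%:E by rewrite lee_fin normal_pdf_ge0.
rewrite /gauss_moment !integral_normal_prob//.
rewrite (lebesgue_integral_scale s0); [|exact: emeasurable_funM|].
  have mg : measurable_fun setT
      (fun x : R => (`|s * x| `^ p)%:E * (normal_pdf 0 s (s * x))%:E : \bar R).
    move/measurable_EFinP : mp => mp; move: (mpdf s) => /measurable_EFinP mpdfs.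
    apply/measurable_EFinP; apply: measurable_funM.
      by apply: measurableT_comp mp _; exact: mulrl_measurable.
    by apply: measurableT_comp mpdfs _; exact: mulrl_measurable.
  rewrite -(ge0_integralZl mu measurableT mg); [|by move=> x _; exact: mule_ge0|by rewrite lee_fin ltW].
  have mg1 := emeasurable_funM mp (mpdf 1%R).
  rewrite -(ge0_integralZl mu measurableT mg1); [|by move=> x _; exact: mule_ge0|by rewrite lee_fin powR_ge0].
  apply: eq_integral => x _; rewrite -!EFinM; congr EFin.
  rewrite !normal_pdfE ?oner_eq0 ?gt_eqF// /normal_fun !subr0.
  rewrite normrM gtr0_norm// powRM ?(ltW s0)//.
  have -> : (- (s * x) ^+ 2 / (s ^+ 2 *+ 2) = - x ^+ 2 / (1 ^+ 2 *+ 2))%R.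
    by field; rewrite gt_eqF.
  have -> : (normal_peak s = s^-1 * normal_peak 1)%R.
    rewrite /normal_peak expr1n mul1r -mulrnAr sqrtrM ?sqr_ge0// invfM.
    by rewrite sqrtr_sqr gtr0_norm.
  by field; rewrite gt_eqF.
by move=> x; rewrite mule_ge0.
Qed.

Lemma gauss_moment_ge0 p : 0 <= gauss_moment p.
Proof. by apply: integral_ge0 => x _; rewrite lee_fin powR_ge0. Qed.

(** Half of the Gaussian exponent dominates every power; the other half keeps the moments finite in
    [gauss_moment_lty]. *)
Lemma powR_le_expR_sqr p : (0 <= p)%R -> exists2 C : R, (0 <= C)%R & forall x, (`|x| `^ p <= C * expR (x ^+ 2 / 4))%R.
Proof.
(* With y = x^2 / 4, an even exponent makes |x|^(2(n+1)) = (4y)^(n+1), which one term of the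
   exponential series bounds by 4^(n+1) (n+1)! exp y. *)
move=> p0; have [n pn] : exists n : nat, (p <= (2 * n.+1)%:R)%R.
  exists (Num.truncn `|p|).
  have := truncnS_gt `|p|; have := ler_norm p.
  rewrite mul2n -addnn natrD => h1 h2.
  by rewrite (le_trans h1)// (le_trans (ltW h2))// lerDl.
have C0 : (0 <= 4 ^+ n.+1 * (n.+1)`!%:R :> R)%R by rewrite mulr_ge0// exprn_ge0.
exists (1 + 4 ^+ n.+1 * (n.+1)`!%:R)%R; first by rewrite addr_ge0.
move=> x; set y := (x ^+ 2 / 4)%R.
have y0 : (0 <= y)%R by rewrite divr_ge0// sqr_ge0.
have e1 : (1 <= expR y)%R by rewrite -expR0 ler_expR.
rewrite mulrDl mul1r.
have [x1|x1] := leP `|x|%R 1%R.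
  rewrite (@le_trans _ _ (expR y))//; last by rewrite lerDl mulr_ge0// expR_ge0.
  rewrite (le_trans _ e1)// (@le_trans _ _ (1 `^ p)%R)//; last by rewrite powR1.
  by rewrite ge0_ler_powR// nnegrE.
rewrite (@le_trans _ _ (`|x| `^ (2 * n.+1)%:R)%R)//.
  by rewrite ler_powR// ltW.
rewrite powR_mulrn// exprM real_normK ?num_real//.
have -> : (x ^+ 2 = 4 * y)%R by rewrite /y mulrC divfK// pnatr_eq0.
rewrite exprMn (@le_trans _ _ (4 ^+ n.+1 * (n.+1)`!%:R * expR y)%R)//.
  rewrite -mulrA ler_wpM2l ?exprn_ge0// -ler_pdivrMl ?ltr0n ?fact_gt0//.
  by rewrite mulrC (le_trans _ (expR_ge1Dxn n y0))// lerDr.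
by rewrite lerDr expR_ge0.
Qed.

Lemma gauss_moment_lty p : (0 <= p)%R -> gauss_moment p < +oo.
Proof.
move=> p0; have [C C0 hC] := powR_le_expR_sqr p0.
have mp : measurable_fun setT (fun x : R => (`|x| `^ p)%:E : \bar R).
  by apply/measurable_EFinP; exact: measurable_abspow.
have mpdf t : measurable_fun setT (fun x => (normal_pdf 0 t x)%:E : \bar R).
  by apply/measurable_EFinP; exact: measurable_normal_pdf.
have d0 t (x : R) : 0 <= (normal_pdf 0 t x)%:E by rewrite lee_fin normal_pdf_ge0.
rewrite /gauss_moment integral_normal_prob//.
(* Multiplying exp(-x^2/2) by exp(x^2/4) leaves exp(-x^2/4), the shape of the normal density of
   variance 2; [K] corrects the normalising factor. *)
set s2 : R := Num.sqrt 2.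
have s20 : s2 != 0%R by rewrite gt_eqF// sqrtr_gt0.
set K := (C * (normal_peak 1 / normal_peak s2))%R.
have K0 : (0 <= K)%R by rewrite mulr_ge0// divr_ge0// normal_peak_ge0.
apply: (@le_lt_trans _ _ (\int[mu]_x (K%:E * (normal_pdf 0 s2 x)%:E))).
  apply: ge0_le_integralT => x; first by rewrite mule_ge0// lee_fin powR_ge0.
  rewrite -!EFinM lee_fin.
  rewrite !normal_pdfE ?oner_eq0// /normal_fun !subr0 sqr_sqrtr//.
  rewrite (@le_trans _ _ (C * expR (x ^+ 2 / 4) * (normal_peak 1 * expR (- x ^+ 2 / (1 ^+ 2 *+ 2))))%R)//.
    by rewrite ler_wpM2r// mulr_ge0 ?expR_ge0 ?normal_peak_ge0.
  have -> : (- x ^+ 2 / (1 ^+ 2 *+ 2) = - x ^+ 2 / (2 *+ 2) - x ^+ 2 / 4)%R by field.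
  rewrite expRD expRN /K le_eqVlt; apply/orP; left; apply/eqP.
  by field; rewrite !lt0r_neq0 ?expR_gt0 ?normal_peak_gt0.
rewrite (ge0_integralZl mu measurableT (mpdf s2))//.
by rewrite integral_normal_pdf mule1 ltry.
Qed.

Lemma gauss_moment_fin p : (0 <= p)%R -> gauss_moment p \is a fin_num.
Proof. by move=> p0; rewrite ge0_fin_numE ?gauss_moment_ge0// gauss_moment_lty. Qed.

(** If the moment vanished, x^2 would be zero almost everywhere and the law would be carried by {0},
    a Lebesgue null set. Positivity is what gives content to the lower bounds, which carry the
    factor sqrt kappa. *)
Lemma gauss_moment2_gt0 : (0 < fine (gauss_moment 2))%R.
Proof.
rewrite fine_gt0// gauss_moment_lty// andbT lt0e gauss_moment_ge0 andbT.
apply/eqP => m0.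
have mp : measurable_fun setT (fun x : R => (`|x| `^ 2)%:E : \bar R).
  by apply/measurable_EFinP; exact: measurable_abspow.
have /ae_eq_integral_abs : \int[N 1]_x `|(`|x| `^ 2)%:E| = 0.
  by rewrite -[RHS]m0; apply: eq_integral => x _; rewrite gee0_abs// lee_fin powR_ge0.
move=> /(_ measurableT mp) [A [mA A0 hA]].
have : N 1 setT <= N 1 (A `|` [set 0%R]).
  apply: le_measure; rewrite ?inE//; first exact: measurableU.
  move=> x _; have [->|x0] := eqVneq x 0%R; [by right|left].
  apply: hA => /= /(_ Logic.I) [] /eqP; rewrite powR_eq0 normr_eq0 (negbTE x0)//.
rewrite (probability_setT (N 1)) => h.
have : N 1 (A `|` [set 0%R]) <= 0.
  have N0 : N 1 [set 0%R] = 0.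
    have /null_content_dominatesP := @normal_prob_dominates R 0 1.
    by apply => //; exact: lebesgue_measure_set1.
  have h2 : N 1 (A `|` [set 0%R]) <= N 1 A + N 1 [set 0%R] by exact: measureU2.
  by apply: (le_trans h2); rewrite [X in _ + X]N0 [X in X + _]A0 adde0.
by move=> /(le_trans h); rewrite lee_fin ler10.
Qed.

End gaussian.

(** * One Gaussian step *)

Section gaussian_step.
Context {R : realType}.
Notation N s := (@normal_prob R 0 s).
Implicit Types (a b h r s x T : R).

(* The second moment of the standard normal law; its value 1 is never needed. *)
Definition kappa : R := fine (gauss_moment (2 : R)).

(** The first summand comes from the term in x^2 of [powR_sym_le], whose mean is kappa h. The second
    comes from its term in |x|^r, whose mean is of order h^(r/2) <= T^(r/2 - 1) h for h <= T. *)
Definition bdg_const r T : R :=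
  r ^+ 2 * expR r * kappa + 2 `^ r * fine (gauss_moment r) * T `^ (r / 2 - 1).

Let sqr_expR_ge0 r : 0 <= r ^+ 2 * expR r.
Proof. by rewrite mulr_ge0// ?sqr_ge0 ?expR_ge0. Qed.

Lemma kappa_gt0 : 0 < kappa. Proof. exact: gauss_moment2_gt0. Qed.

Lemma bdg_const_ge0 r T : 0 <= bdg_const r T.
Proof.
apply: addr_ge0; first by rewrite mulr_ge0// ltW// kappa_gt0.
by rewrite !mulr_ge0 ?powR_ge0// fine_ge0// gauss_moment_ge0.
Qed.

Local Open Scope ereal_scope.

Lemma normal_moment_sqr h : (0 < h)%R ->
  \int[N (Num.sqrt h)]_x (x ^+ 2)%:E = (kappa * h)%:E.
Proof.
move=> h0; have s0 : (0 < Num.sqrt h)%R by rewrite sqrtr_gt0.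
transitivity (\int[N (Num.sqrt h)]_x (`|x| `^ 2)%:E).
  by apply: eq_integral => x _; rewrite powR_mulrn// real_normK ?num_real.
rewrite normal_prob_moment// powR_mulrn ?sqrtr_ge0// sqr_sqrtr ?ltW//.
by rewrite -[gauss_moment 2]fineK ?gauss_moment_fin// -EFinM mulrC.
Qed.

Lemma normal_moment_le T h r : (2 <= r)%R -> (0 < h)%R -> (h <= T)%R ->
  \int[N (Num.sqrt h)]_x (`|x| `^ r)%:E <=
  (fine (gauss_moment r) * T `^ (r / 2 - 1) * h)%:E.
Proof.
move=> r2 h0 hT; have s0 : (0 < Num.sqrt h)%R by rewrite sqrtr_gt0.
have r0 : (0 <= r)%R by lra.
rewrite normal_prob_moment// -[gauss_moment r]fineK ?gauss_moment_fin// -EFinM lee_fin.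
rewrite mulrC -mulrA ler_wpM2l ?fine_ge0 ?gauss_moment_ge0//.
rewrite -powR12_sqrt ?(ltW h0)// -powRrM.
have -> : (2^-1 * r = (r / 2 - 1) + 1)%R by field.
rewrite powRD ?(gt_eqF h0) ?implybT// powRr1 ?(ltW h0)// ler_wpM2r ?(ltW h0)//.
rewrite ge0_ler_powR ?nnegrE ?(ltW h0)//; first lra.
by rewrite (le_trans _ hT)// ltW.
Qed.

Lemma measurable_affine_pow r a b :
  measurable_fun setT (fun x : R => (`|a + b * x| `^ r)%:E : \bar R).
Proof.
apply/measurable_EFinP; apply: (measurableT_comp (measurable_powR _)).
apply: measurableT_comp; first exact: normr_measurable.
by apply: measurable_funD => //; exact: mulrl_measurable.
Qed.

(** Replacing the integrand by its average over x and -x leaves the integral unchanged and cancels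
    the first-order term, so that the excess over |a|^r is of order h and not sqrt h. *)
Lemma normal_step T r a b h : (2 <= r)%R -> (0 < h)%R -> (h <= T)%R ->
  \int[N (Num.sqrt h)]_x (`|a + b * x| `^ r)%:E <=
  ((1 + bdg_const r T * h) * `|a| `^ r + bdg_const r T * h * `|b| `^ r)%:E.
Proof.
move=> r2 h0 hT; have s0 : Num.sqrt h != 0%R by rewrite gt_eqF// sqrtr_gt0.
have p0 (x y : R) : 0 <= (`|x| `^ y)%:E by rewrite lee_fin powR_ge0.
have mm := measurable_affine_pow r a; have mmb := mm b.
have mx2 : measurable_fun setT (fun x : R => (x ^+ 2)%:E : \bar R).
  by apply/measurable_EFinP; exact: exprn_measurable.
have mxr : measurable_fun setT (fun x : R => (`|x| `^ r)%:E : \bar R).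
  by apply/measurable_EFinP; exact: measurable_abspow.
set c1 := (r ^+ 2 * expR r * (`|a| `^ r + `|b| `^ r))%R.
set c2 := (2 `^ r * `|b| `^ r)%R.
have c10 : (0 <= c1)%R by rewrite mulr_ge0// addr_ge0// powR_ge0.
have c20 : (0 <= c2)%R by rewrite !mulr_ge0 ?powR_ge0.
have -> : \int[N (Num.sqrt h)]_x (`|a + b * x| `^ r)%:E =
    \int[N (Num.sqrt h)]_x (2^-1 * (`|a + b * x| `^ r + `|a - b * x| `^ r))%:E.
  transitivity (2^-1%:E * (\int[N (Num.sqrt h)]_x (`|a + b * x| `^ r)%:E +
      \int[N (Num.sqrt h)]_x (`|a - b * x| `^ r)%:E)).
    have -> : \int[N (Num.sqrt h)]_x (`|a - b * x| `^ r)%:E =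
        \int[N (Num.sqrt h)]_x (`|a + b * x| `^ r)%:E.
      rewrite [RHS](normal_prob_sym s0 mmb (fun x => p0 (a + b * x)%R r)).
      by apply: eq_integral => x _; rewrite mulrN.
    move: (\int[_]_x _) => I.
    rewrite -[X in X + _]mul1e -[X in _ + X]mul1e -ge0_muleDl//.
    rewrite muleA -EFinD -EFinM.
    have -> : (2^-1 * (1 + 1) = 1 :> R)%R by field.
    by rewrite mul1e.
  have mm' : measurable_fun setT (fun x : R => (`|a - b * x| `^ r)%:E : \bar R).
    by apply: eq_measurable_fun (mm (- b)%R) => x _; rewrite mulNr.
  rewrite -(@ge0_integralD _ _ R (N (Num.sqrt h)))//.
  rewrite -(@ge0_integralZl _ _ R (N (Num.sqrt h)) _ measurableT _ (emeasurable_funD (mm b) mm'))//.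
  by move=> x _; rewrite adde_ge0.
apply: (@le_trans _ _ (\int[N (Num.sqrt h)]_x ((`|a| `^ r)%:E + c1%:E * (x ^+ 2)%:E +
   c2%:E * (`|x| `^ r)%:E)%E)%E).
  apply: ge0_le_integralT => x.
    by rewrite lee_fin mulr_ge0 ?invr_ge0// addr_ge0 ?powR_ge0.
  by rewrite -!EFinM -!EFinD lee_fin powR_sym_le.
have m1 : measurable_fun setT (fun x : R => c1%:E * (x ^+ 2)%:E : \bar R).
  by apply: emeasurable_funM.
have m2 : measurable_fun setT (fun x : R => c2%:E * (`|x| `^ r)%:E : \bar R).
  by apply: emeasurable_funM.
have q1 (x : R) : 0 <= c1%:E * (x ^+ 2)%:E by rewrite mule_ge0 ?lee_fin ?sqr_ge0.
have q2 (x : R) : 0 <= c2%:E * (`|x| `^ r)%:E by rewrite mule_ge0 ?lee_fin.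
have q3 (x : R) : 0 <= (`|a| `^ r)%:E + c1%:E * (x ^+ 2)%:E by rewrite adde_ge0.
have q4 (x : R) : 0 <= (x ^+ 2)%:E by rewrite lee_fin sqr_ge0.
have m3 : measurable_fun setT (fun x : R => (`|a| `^ r)%:E + c1%:E * (x ^+ 2)%:E : \bar R).
  by apply: emeasurable_funD.
rewrite ge0_integralD// ge0_integralD// ge0_integralZl// ge0_integralZl// normal_moment_sqr//.
rewrite (integral_cst (N (Num.sqrt h)) measurableT ((`|a| `^ r)%R%:E)).
rewrite [X in _ * X + _ + _](probability_setT (N (Num.sqrt h))) mule1.
apply: (@le_trans _ _ ((`|a| `^ r)%R%:E + c1%:E * (kappa * h)%:E +
   c2%:E * (fine (gauss_moment r) * T `^ (r / 2 - 1) * h)%:E)).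
  by rewrite leeD2l// lee_wpmul2l ?lee_fin// normal_moment_le.
rewrite -!EFinM -!EFinD lee_fin /c1 /c2 /bdg_const.
set A := (`|a| `^ r)%R; set B := (`|b| `^ r)%R; set G := fine _; set H := (T `^ _)%R.
rewrite -subr_ge0.
have -> : ((1 + (r ^+ 2 * expR r * kappa + 2 `^ r * G * H) * h) * A +
   (r ^+ 2 * expR r * kappa + 2 `^ r * G * H) * h * B -
   (A + r ^+ 2 * expR r * (A + B) * (kappa * h) + 2 `^ r * B * (G * H * h)) =
   2 `^ r * G * H * h * A)%R by ring.
by rewrite !mulr_ge0 ?powR_ge0 ?fine_ge0 ?gauss_moment_ge0 ?ltW.
Qed.

(** Adding the reflected integrand cancels the cross term 2abx pointwise, so that only integrals of
    non-negative functions occur; by symmetry the two halves are equal. *)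
Lemma normal_step_sqr a b h : (0 < h)%R ->
  \int[N (Num.sqrt h)]_x ((a + b * x) ^+ 2)%:E = (a ^+ 2 + kappa * h * b ^+ 2)%:E.
Proof.
move=> h0; have s0 : Num.sqrt h != 0%R by rewrite gt_eqF// sqrtr_gt0.
have mx2 : measurable_fun setT (fun x : R => (x ^+ 2)%:E : \bar R).
  by apply/measurable_EFinP; exact: exprn_measurable.
have mm c : measurable_fun setT (fun x : R => ((a + c * x) ^+ 2)%:E : \bar R).
  apply/measurable_EFinP; apply: measurable_funX.
  by apply: measurable_funD => //; exact: mulrl_measurable.
have s2 (x : R) : 0 <= (x ^+ 2)%:E by rewrite lee_fin sqr_ge0.
have mmb := mm b.
have sym : \int[N (Num.sqrt h)]_x ((a - b * x) ^+ 2)%:E =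
    \int[N (Num.sqrt h)]_x ((a + b * x) ^+ 2)%:E.
  rewrite [RHS]normal_prob_sym//.
  by apply: eq_integral => x _; rewrite mulrN.
have : \int[N (Num.sqrt h)]_x ((a + b * x) ^+ 2)%:E +
    \int[N (Num.sqrt h)]_x ((a - b * x) ^+ 2)%:E =
    (2 * (a ^+ 2 + kappa * h * b ^+ 2))%:E.
  rewrite -ge0_integralD//; last first.
    by apply: eq_measurable_fun (mm (- b)%R) => x _; rewrite mulNr.
  transitivity (\int[N (Num.sqrt h)]_x ((2 * a ^+ 2)%:E + (2 * b ^+ 2)%:E * (x ^+ 2)%:E)).
    apply: eq_integral => x _; rewrite -EFinM -!EFinD; congr EFin; ring.
  have b0 : (0 <= 2 * b ^+ 2)%R by rewrite mulr_ge0 ?sqr_ge0.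
  have q1 (x : R) : 0 <= (2 * a ^+ 2)%:E by rewrite lee_fin mulr_ge0 ?sqr_ge0.
  have q2 (x : R) : 0 <= (2 * b ^+ 2)%:E * (x ^+ 2)%:E by rewrite mule_ge0.
  have m2 : measurable_fun setT (fun x : R => (2 * b ^+ 2)%:E * (x ^+ 2)%:E : \bar R).
    exact: emeasurable_funM.
  rewrite ge0_integralD//; last by move=> x _; exact: q1.
  rewrite [X in _ + X]ge0_integralZl// normal_moment_sqr//.
  rewrite (integral_cst (N (Num.sqrt h)) measurableT ((2 * a ^+ 2)%R%:E)).
  rewrite [X in _ * X + _](probability_setT (N (Num.sqrt h))) mule1.
  by rewrite -EFinM -EFinD; congr EFin; ring.
rewrite sym; have : 0 <= \int[N (Num.sqrt h)]_x ((a + b * x) ^+ 2)%:E.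
  by apply: integral_ge0.
move: (\int[_]_x _) => [x|//|//] _; rewrite -EFinD => -[e]; congr EFin.
lra.
Qed.

End gaussian_step.

(** * Martingale transforms of the Wiener process *)

Section filtration.
Context {R : realType} (S : setting R).
Notation P := (Pr S).
Notation F := (filt S).
Notation W := (wiener S).
Notation FT t := (g_sigma_algebraType (F t)).
Implicit Types (t u : R) (Y Z : Omega S -> R).

Definition adapted_at t Y := measurable_fun setT (Y : FT t -> R).

Lemma filt_measurableE t (A : set (Omega S)) : 0 <= t ->
  measurable (A : set (FT t)) = F t A.
Proof.
move=> t0; have [/(_ _ t0)[sF _] _ _ _] := filt_usual S.
by rewrite /measurable/= sigma_algebra_id.
Qed.

Lemma filt_sub t (A : set (Omega S)) : 0 <= t -> F t A -> measurable A.
Proof.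
by move=> t0; have [/(_ _ t0)[_ sF] _ _ _] := filt_usual S; exact: sF.
Qed.

Lemma measurable_filt_id t : 0 <= t ->
  measurable_fun setT (fun w : Omega S => w : FT t).
Proof.
move=> t0 _ A mA; rewrite setTI preimage_id; apply: (filt_sub t0).
by rewrite -filt_measurableE.
Qed.

Lemma adapted_le u t Y : 0 <= u -> u <= t -> adapted_at u Y -> adapted_at t Y.
Proof.
move=> u0 ut mY mT B mB; have t0 := le_trans u0 ut.
have := mY measurableT B mB.
rewrite filt_measurableE// filt_measurableE//.
have [_ + _ _] := filt_usual S; exact.
Qed.

Lemma adapted_measurable t Y : 0 <= t -> adapted_at t Y -> measurable_fun setT Y.
Proof. by move=> t0 mY; exact: (measurableT_comp mY (measurable_filt_id t0)). Qed.

Lemma wiener_adapted t : 0 <= t -> adapted_at t (W t).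
Proof. by have [+ _ _ _ _] := wienerP S; exact. Qed.

Lemma measurable_wiener t : 0 <= t -> measurable_fun setT (W t).
Proof. by move=> t0; apply: (adapted_measurable t0); exact: wiener_adapted. Qed.

Lemma measurable_wiener_incr u t : 0 <= u -> 0 <= t ->
  measurable_fun setT (fun w => W t w - W u w).
Proof. by move=> u0 t0; apply: measurable_funB; exact: measurable_wiener. Qed.

Local Open Scope ereal_scope.

(** The identity is viewed as a random variable with values in Omega equipped with F u.
    Independence, which speaks of events A in F u and Borel sets B, then says that the pair (w,
    increment) has a product law, and Tonelli integrates the increment out with w frozen. *)
Lemma increment_law u t (h : FT u * R -> \bar R) : (0 <= u)%R -> (u < t)%R ->
  measurable_fun setT h -> (forall z, 0 <= h z) ->
  \int[P]_w h (w, W t w - W u w)%R =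
  \int[P]_w \int[normal_prob 0 (Num.sqrt (t - u))]_x h (w, x).
Proof.
move=> u0 ut mh h0.
have t0 : (0 <= t)%R by rewrite (le_trans u0)// ltW.
have mid := measurable_filt_id u0.
pose idu : {RV P >-> FT u} := HB.pack (fun w : Omega S => w : FT u)
  (isMeasurableFun.Build _ _ _ _ _ mid).
pose N : probability (measurableTypeR R) R := normal_prob 0 (Num.sqrt (t - u)).
pose j (w : Omega S) : FT u * measurableTypeR R := (w : FT u, W t w - W u w)%R.
have mj : measurable_fun setT j.
  apply: measurable_fun_pair => //; exact: (measurable_wiener_incr u0 t0).
pose jm : {RV P >-> (FT u * measurableTypeR R)%type} := HB.pack j (isMeasurableFun.Build _ _ _ _ _ mj).
have uniq : forall X : set (FT u * measurableTypeR R), measurable X -> (distribution P idu \x N)%E X = distribution P jm X.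
  apply: product_measure_unique => A B mA mB.
  have [_ _ _ ind law] := wienerP S.
  have FA : F u A by rewrite -filt_measurableE.
  have lawB := law u t B u0 ut mB.
  have /= := ind u t A B u0 (ltW ut) FA mB.
  rewrite [X in _ = _ * X -> _]lawB => e; exact: e.
transitivity (\int[distribution P jm]_z h z).
  by rewrite ge0_integral_distribution.
transitivity (\int[distribution P idu \x N]_z h z).
  by apply: eq_measure_integral => X mX _; exact/esym/uniq.
rewrite fubini_tonelli1//= ge0_integral_distribution//.
  exact: measurable_fun_fubini_tonelli_F.
by move=> y; apply: integral_ge0.
Qed.

Lemma measurable_increment_affine u (M xi : Omega S -> R) :
  adapted_at u M -> adapted_at u xi ->
  measurable_fun setT (fun z : FT u * R => M z.1 + xi z.1 * z.2)%R.
Proof.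
move=> mM mxi; apply: measurable_funD.
  by apply: (measurableT_comp mM); exact: measurable_fst.
apply: measurable_funM; last exact: measurable_snd.
by apply: (measurableT_comp mxi); exact: measurable_fst.
Qed.

Lemma measurable_momentP (Y : Omega S -> R) r : measurable_fun setT Y ->
  measurable_fun setT (fun w => (`|Y w| `^ r)%:E).
Proof.
move=> mY; apply/measurable_EFinP; apply: (measurableT_comp (measurable_powR _)).
exact: measurableT_comp.
Qed.

Lemma increment_moment u t T r (M xi : Omega S -> R) :
  (0 <= u)%R -> (u < t)%R -> (t - u <= T)%R -> (2 <= r)%R ->
  adapted_at u M -> adapted_at u xi ->
  \int[P]_w (`|M w + xi w * (W t w - W u w)| `^ r)%:E <=
  (1 + bdg_const r T * (t - u))%:E * \int[P]_w (`|M w| `^ r)%:E +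
  (bdg_const r T * (t - u))%:E * \int[P]_w (`|xi w| `^ r)%:E.
Proof.
move=> u0 ut tuT r2 mM mxi; have h0 : (0 < t - u)%R by rewrite subr_gt0.
have K0 : (0 <= bdg_const r T * (t - u))%R by rewrite mulr_ge0 ?bdg_const_ge0// ltW.
have K1 : (0 <= 1 + bdg_const r T * (t - u))%R by rewrite addr_ge0.
have mY := measurable_increment_affine mM mxi.
have mY' : measurable_fun setT (fun z : FT u * R => (`|M z.1 + xi z.1 * z.2| `^ r)%:E).
  apply/measurable_EFinP; apply: (measurableT_comp (measurable_powR _)).
  exact: measurableT_comp.
rewrite (@increment_law u t (fun z => (`|M z.1 + xi z.1 * z.2| `^ r)%:E))//.
have mM' := measurable_momentP r (adapted_measurable u0 mM).
have mxi' := measurable_momentP r (adapted_measurable u0 mxi).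
rewrite -(ge0_integralZl P measurableT mM'); [|by move=> w _; rewrite lee_fin powR_ge0|by rewrite lee_fin].
rewrite -(ge0_integralZl P measurableT mxi'); [|by move=> w _; rewrite lee_fin powR_ge0|by rewrite lee_fin].
have m1 : measurable_fun setT (fun w => (1 + bdg_const r T * (t - u))%:E * (`|M w| `^ r)%:E).
  by apply: emeasurable_funM => //; exact: measurable_cst.
have m2 : measurable_fun setT (fun w => (bdg_const r T * (t - u))%:E * (`|xi w| `^ r)%:E).
  by apply: emeasurable_funM => //; exact: measurable_cst.
rewrite -ge0_integralD//; last 2 first.
- by move=> w _; rewrite mule_ge0// lee_fin powR_ge0.
- by move=> w _; rewrite mule_ge0// lee_fin powR_ge0.
apply: ge0_le_integralT => w.
  by apply: integral_ge0 => x _; rewrite lee_fin powR_ge0.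
exact: (le_trans (normal_step (M w) (xi w) r2 h0 tuT)).
Qed.

Lemma increment_sqr u t (M xi : Omega S -> R) : (0 <= u)%R -> (u < t)%R ->
  adapted_at u M -> adapted_at u xi ->
  \int[P]_w ((M w + xi w * (W t w - W u w)) ^+ 2)%:E =
  \int[P]_w (M w ^+ 2)%:E + (kappa * (t - u))%:E * \int[P]_w (xi w ^+ 2)%:E.
Proof.
move=> u0 ut mM mxi; have h0 : (0 < t - u)%R by rewrite subr_gt0.
have K0 : (0 <= kappa * (t - u) :> R)%R by rewrite mulr_ge0 ?ltW// kappa_gt0.
have mY := measurable_increment_affine mM mxi.
have mY' : measurable_fun setT (fun z : FT u * R => ((M z.1 + xi z.1 * z.2) ^+ 2)%:E).
  by apply/measurable_EFinP; exact: measurable_funX.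
have sq (Y : Omega S -> R) : measurable_fun setT Y -> measurable_fun setT (fun w => (Y w ^+ 2)%:E).
  by move=> mYY; apply/measurable_EFinP; exact: measurable_funX.
rewrite (@increment_law u t (fun z => ((M z.1 + xi z.1 * z.2) ^+ 2)%:E) u0 ut mY'); last first.
  by move=> z; rewrite lee_fin sqr_ge0.
have mM' := sq _ (adapted_measurable u0 mM).
have mxi' := sq _ (adapted_measurable u0 mxi).
rewrite -(ge0_integralZl P measurableT mxi'); [|by move=> w _; rewrite lee_fin sqr_ge0|by rewrite lee_fin].
have m2 : measurable_fun setT (fun w => (kappa * (t - u))%:E * (xi w ^+ 2)%:E).
  by apply: emeasurable_funM => //; exact: measurable_cst.
rewrite -ge0_integralD//; last 2 first.
- by move=> w _; rewrite lee_fin sqr_ge0.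
- by move=> w _; rewrite mule_ge0// lee_fin sqr_ge0.
by apply: eq_integral => w _; exact: (normal_step_sqr (M w) (xi w) h0).
Qed.

Section martingale_transform.
Variables (T : R) (t : nat -> R) (n : nat) (eta : nat -> Omega S -> R).
Hypothesis t_ge0 : (0 <= t 0)%R.
Hypothesis t_incr : forall i, (i < n)%N -> (t i < t i.+1)%R.
Hypothesis t_le : (t n <= T)%R.
Hypothesis eta_adapted : forall i, (i < n)%N -> adapted_at (t i) (eta i).

Definition mart (k : nat) (w : Omega S) : R :=
  (\sum_(i < k) eta i w * (W (t i.+1) w - W (t i) w))%R.

Lemma martS k : mart k.+1 = (fun w => mart k w + eta k w * (W (t k.+1) w - W (t k) w))%R.
Proof. by apply/funext => w; rewrite /mart big_ord_recr. Qed.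

Lemma partition_le i j : (i <= j)%N -> (j <= n)%N -> (t i <= t j)%R.
Proof.
move=> ij; elim: j ij => [|j IH]; first by rewrite leqn0 => /eqP ->.
rewrite leq_eqVlt => /predU1P[->//|ij] jn.
by rewrite (le_trans (IH ij (ltnW jn)))// ltW// t_incr.
Qed.

Lemma partition_ge0 i : (i <= n)%N -> (0 <= t i)%R.
Proof. by move=> ni; rewrite (le_trans t_ge0)// partition_le. Qed.

Lemma partition_leT i : (i <= n)%N -> (t i <= T)%R.
Proof. by move=> ni; rewrite (le_trans _ t_le)// partition_le. Qed.

Lemma mart_adapted k : (k <= n)%N -> adapted_at (t k) (mart k).
Proof.
elim: k => [_|k IH kn].
  rewrite (_ : mart 0 = cst 0%R); first exact: measurable_cst.
  by apply/funext => w; rewrite /mart big_ord0.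
have kn' := ltnW kn; have tk0 := partition_ge0 kn'; have tk1 := partition_ge0 kn.
have ttk := ltW (t_incr kn).
have a1 : adapted_at (t k.+1) (mart k) := adapted_le tk0 ttk (IH kn').
have a2 : adapted_at (t k.+1) (eta k) := adapted_le tk0 ttk (eta_adapted kn).
have a3 : adapted_at (t k.+1) (W (t k)) := adapted_le tk0 ttk (wiener_adapted tk0).
have a4 : adapted_at (t k.+1) (W (t k.+1)) := wiener_adapted tk1.
rewrite martS; apply: measurable_funD; first exact: a1.
by apply: measurable_funM; [exact: a2|apply: measurable_funB; [exact: a4|exact: a3]].
Qed.

Lemma measurable_mart k : (k <= n)%N -> measurable_fun setT (mart k).
Proof. by move=> kn; exact: adapted_measurable (partition_ge0 kn) (mart_adapted kn). Qed.

(** Discrete Gronwall argument: each step multiplies the moment by 1 + K h <= exp(K h), and the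
    exponents add up to K times the elapsed time. *)
Lemma mart_moment r k : (2 <= r)%R -> (k <= n)%N ->
  \int[P]_w (`|mart k w| `^ r)%:E <=
  (expR (bdg_const r T * (t k - t 0)))%:E *
  \sum_(i < k) ((bdg_const r T * (t i.+1 - t i))%:E * \int[P]_w (`|eta i w| `^ r)%:E).
Proof.
move=> r2; elim: k => [_|k IH kn].
  rewrite big_ord0 mule0 (eq_integral (cst 0)) ?integral0// => w _.
  by rewrite /mart big_ord0 normr0 powR0// gt_eqF// (lt_le_trans _ r2).
have kn' := ltnW kn; have tk := t_incr kn.
have tk0 := partition_ge0 kn'; have tk1 := partition_leT kn.
have K0 := bdg_const_ge0 r T.
rewrite big_ord_recr/= martS.
have hT : (t k.+1 - t k <= T)%R by lra.
apply: (le_trans (increment_moment tk0 tk hT r2 (mart_adapted kn') (eta_adapted kn))).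
set K := bdg_const r T in K0 *.
set s := \sum_(i < k) _.
have s0 : 0 <= s.
  apply: sume_ge0 => i _; apply: mule_ge0; last by apply: integral_ge0 => w _; rewrite lee_fin powR_ge0.
  rewrite lee_fin mulr_ge0// subr_ge0 ltW// t_incr//.
  exact: ltn_trans (ltn_ord i) kn.
set I := \int[P]_w (`|eta k w| `^ r)%:E.
have I0 : 0 <= I by apply: integral_ge0 => w _; rewrite lee_fin powR_ge0.
have h0 : (0 < t k.+1 - t k)%R by rewrite subr_gt0.
have Kh0 : (0 <= K * (t k.+1 - t k))%R by rewrite mulr_ge0// ltW.
have t0k : (0 <= t k - t 0)%R by rewrite subr_ge0 partition_le.
rewrite [leRHS]ge0_muleDr ?mule_ge0// ?lee_fin//; apply: leeD.
  apply: (@le_trans _ _ ((1 + K * (t k.+1 - t k))%:E * ((expR (K * (t k - t 0)))%:E * s))).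
    by rewrite lee_wpmul2l ?lee_fin ?addr_ge0// IH.
  rewrite muleA -EFinM lee_wpmul2r// lee_fin.
  have -> : (K * (t k.+1 - t 0) = K * (t k.+1 - t k) + K * (t k - t 0))%R by ring.
  by rewrite expRD ler_wpM2r ?expR_ge0// expR_ge1Dx.
rewrite -[leLHS]mul1e lee_wpmul2r ?mule_ge0 ?lee_fin//.
rewrite -[leLHS]expR0 ler_expR mulr_ge0//; lra.
Qed.

Lemma mart_sqr k : (k <= n)%N ->
  \int[P]_w (mart k w ^+ 2)%:E =
  \sum_(i < k) ((kappa * (t i.+1 - t i))%:E * \int[P]_w (eta i w ^+ 2)%:E).
Proof.
elim: k => [_|k IH kn].
  rewrite big_ord0 (eq_integral (cst 0)) ?integral0// => w _.
  by rewrite /mart big_ord0 expr0n.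
have kn' := ltnW kn; have tk := t_incr kn; have tk0 := partition_ge0 kn'.
rewrite martS big_ord_recr/= -IH//.
exact: (increment_sqr tk0 tk (mart_adapted kn') (eta_adapted kn)).
Qed.

(** The step lengths telescope to at most T, so the bound depends neither on the number of steps nor
    on their position. Both the convergence of the quadratures and the noise estimate rest on this
    uniformity. *)
Lemma mart_norm r B : (2 <= r)%R -> (0 <= B)%R ->
  (forall i, (i < n)%N -> 'N[P]_(r%:E)[EFin \o eta i] <= B%:E) ->
  'N[P]_(r%:E)[EFin \o mart n] <=
  ((expR (bdg_const r T * T) * (bdg_const r T * T)) `^ r^-1 * B)%:E.
Proof.
move=> r2 B0 etaB; have r0 : (0 < r)%R by rewrite (lt_le_trans _ r2).
have K0 := bdg_const_ge0 r T; set K := bdg_const r T in K0 *.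
have T0 : (0 <= T)%R by rewrite (le_trans (partition_ge0 (leqnn n))).
have E0 : (0 <= expR (K * T) * (K * T))%R by rewrite mulr_ge0 ?expR_ge0// mulr_ge0.
rewrite Lnorm_moment//; last by rewrite mulr_ge0// powR_ge0.
apply: (le_trans (mart_moment r2 (leqnn n))); rewrite -/K.
rewrite powRM ?powR_ge0// -powRrM mulVf ?gt_eqF// powRr1//.
have t0n : (t n - t 0 <= T)%R by rewrite lerBlDr (le_trans t_le)// lerDl.
rewrite -mulrA EFinM; apply: lee_pmul => //; rewrite ?lee_fin ?expR_ge0//.
- apply: sume_ge0 => i _; apply: mule_ge0; last by apply: integral_ge0 => w _; rewrite lee_fin powR_ge0.
  by rewrite lee_fin mulr_ge0// subr_ge0 ltW// t_incr.
- by rewrite ler_expR ler_wpM2l.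
apply: (@le_trans _ _ (\sum_(i < n) (K * (t i.+1 - t i) * B `^ r)%:E)).
  apply: lee_sum => i _; rewrite [leRHS]EFinM lee_wpmul2l//.
    by rewrite lee_fin mulr_ge0// subr_ge0 ltW// t_incr.
  by rewrite -Lnorm_moment// etaB.
rewrite sumEFin lee_fin -mulr_suml -mulr_sumr ler_wpM2r ?powR_ge0// ler_wpM2l//.
by rewrite -(big_mkord xpredT (fun i => t i.+1 - t i)%R) telescope_sumr.
Qed.

End martingale_transform.

End filtration.

(** * Completeness of L^r *)

Section Lnorm_complete.
Context d (T : measurableType d) {R : realType} (P : probability T R).

Lemma cvg_norm_powR (u : nat -> R) (l r : R) : 0 < r ->
  u @ \oo --> l -> (fun n => `|u n| `^ r) @ \oo --> `|l| `^ r.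
Proof.
move=> r0 ul; have [l0|l0] := eqVneq l 0.
  rewrite l0 normr0 powR0 ?gt_eqF//; apply/cvgrPdist_lt => e e0.
  move: ul; rewrite l0 => /cvgrPdist_lt /(_ (e `^ r^-1)).
  rewrite powR_gt0// => /(_ isT); apply: filterS => n.
  rewrite !sub0r !normrN => h; rewrite ger0_norm ?powR_ge0//.
  have -> : e = (e `^ r^-1) `^ r by rewrite -powRrM mulVf ?gt_eqF// powRr1// ltW.
  by rewrite gt0_ltr_powR// nnegrE powR_ge0.
have ln0 : 0 < `|l| by rewrite normr_gt0.
have c : {for `|l|, continuous (fun x : R => x `^ r)}.
  apply: differentiable_continuous; apply/derivable1_diffP.
  by apply: derivable_powR; rewrite in_itv/= andbT.
apply: (@cvg_comp _ _ _ (fun n => `|u n|) (fun x : R => x `^ r) _ (nbhs `|l|)) => //.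
exact: cvg_norm.
Qed.

Variables (r c th : R) (Y : nat -> T -> R).
Hypotheses (r1 : 1 <= r) (c0 : 0 <= c) (th0 : 0 <= th) (th1 : th < 1).
Hypothesis mY : forall j, measurable_fun setT (Y j).
Hypothesis cauchyY : forall j k, (j <= k)%N ->
  ('N[P]_(r%:E)[EFin \o (Y k \- Y j)%R] <= (c * th ^+ j)%:E)%E.

Let r0 : 0 < r. Proof. exact: lt_le_trans r1. Qed.
Let D j w : R := `|Y j.+1 w - Y j w|.
Let G w : \bar R := (\sum_(j <oo) (D j w)%:E)%E.

Let mD j : measurable_fun setT (D j).
Proof. by apply: measurableT_comp; [exact: normr_measurable|exact: measurable_funB]. Qed.

Let D0 j w : 0 <= D j w. Proof. exact: normr_ge0. Qed.

Let mG : measurable_fun setT G.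
Proof.
apply: ge0_emeasurable_sum => [k x _ _|k _]; first by rewrite lee_fin.
exact/measurable_EFinP.
Qed.

Let G0 w : (0 <= G w)%E.
Proof. by apply: nneseries_ge0 => n _ _; rewrite lee_fin. Qed.

Let intG : (\int[P]_w G w < +oo)%E.
Proof.
rewrite integral_nneseries//; last 2 first.
- by move=> n; exact/measurable_EFinP.
- by move=> n w _; rewrite lee_fin.
apply: (@le_lt_trans _ _ (\sum_(j <oo) (c * th ^+ j)%:E)%E).
  apply: lee_nneseries => [n _ _|n _]; first by apply: integral_ge0 => w _; rewrite lee_fin.
  apply: (le_trans _ (cauchyY (leqnSn n))).
  apply: (le_trans _ (@Lnorm_exponent_le _ _ _ P 1 r _ ltr01 r1 _)); last exact: measurable_funB.
  rewrite Lnorm1; apply: ge0_le_integralT => w; rewrite ?lee_fin//.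
apply: (@le_lt_trans _ _ (c / (1 - th))%:E); last exact: ltry.
apply: lime_le.
  by apply: is_cvg_nneseries => n _ _; rewrite lee_fin mulr_ge0// exprn_ge0.
apply: nearW => n; rewrite sumEFin lee_fin.
rewrite -mulr_sumr ler_wpM2l// -[leRHS]mul1r.
have := @geometric_seriesE R 1 th (negbT (lt_eqF th1)).
rewrite seriesEnat/= => /(congr1 (fun f => f n)) /=.
under eq_bigr do rewrite mul1r.
move=> ->; rewrite mul1r ler_wpM2r// ?invr_ge0 ?subr_ge0 ?(ltW th1)//.
by rewrite lerBlDr lerDl exprn_ge0.
Qed.

Let A := [set w | G w < +oo]%E.

Let mA : measurable A.
Proof. by rewrite -[A]setTI; exact: emeasurable_fun_infty_o. Qed.

Let aeA : {ae P, forall w, A w}.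
Proof.
have iG : P.-integrable setT G.
  apply/integrableP; split => //.
  by under eq_integral do rewrite gee0_abs//.
apply: filterS (integrable_ae measurableT iG) => w /(_ Logic.I).
by rewrite /A/= ge0_fin_numE.
Qed.

(** Resetting the sequence to 0 where the series [G] of increments diverges makes it converge at
    every point, so that its limit is measurable; almost surely nothing changes. *)
Let Y' j w : R := if (G w < +oo)%E then Y j w else 0.

Let mY' j : measurable_fun setT (Y' j).
Proof.
have -> : Y' j = (fun w => Y j w * \1_A w).
  apply/funext => w; rewrite /Y' indicE; case: ifPn => h.
    by rewrite mem_set// mulr1.
  by rewrite memNset ?mulr0//; exact/negP.
by apply: measurable_funM => //; exact: measurable_indic.
Qed.

Let cvgY' w : cvgn (Y' ^~ w).
Proof.
rewrite /Y'; have [Gw|Gw] := boolP (G w < +oo)%E; last exact: is_cvg_cst.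
have sD : cvgn [normed series (fun j => Y j.+1 w - Y j w)].
  apply: nondecreasing_is_cvgn.
    move=> n m nm; rewrite /= !seriesEnat/=.
    rewrite [leRHS](@big_cat_nat _ _ _ n 0 m)//= lerDl.
    by apply: sumr_ge0 => i _; exact: D0.
  exists (fine (G w)) => _ [n _ <-].
  rewrite -lee_fin fineK ?ge0_fin_numE//= seriesEnat/= -sumEFin.
  by apply: nneseries_lim_ge => i _ _; rewrite lee_fin.
have := normed_cvg sD.
rewrite (_ : series _ = (fun n => Y n w - Y 0 w)); last first.
  by apply/funext => n; rewrite seriesEnat/= telescope_sumr.
move=> h; have -> : Y ^~ w = (fun n => Y n w - Y 0 w) \+ cst (Y 0 w).
  by apply/funext => n /=; rewrite subrK.
by apply: is_cvgD => //; exact: is_cvg_cst.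
Qed.

(** The increments have summable L^1 norms, hence are almost surely absolutely summable, and Fatou's
    lemma carries the Cauchy bound over to the limit with the same constant. The estimate at j = 0
    will be the quadrature error itself. *)
Lemma Lnorm_complete : exists2 Z : T -> R, measurable_fun setT Z &
  forall j, ('N[P]_(r%:E)[EFin \o (Z \- Y j)%R] <= (c * th ^+ j)%:E)%E.
Proof.
pose Z w := limn (Y' ^~ w).
have cZ w : Y' ^~ w @ \oo --> Z w by exact: cvgY'.
have mZ : measurable_fun setT Z by apply: (measurable_fun_cvg mY') => w _; exact: cZ.
exists Z => // j.
have mpow (X : T -> R) : measurable_fun setT X -> measurable_fun setT (fun w => (`|X w| `^ r)%:E).
  move=> mX; apply/measurable_EFinP; apply: (measurableT_comp (measurable_powR _)).
  exact: measurableT_comp.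
rewrite (@Lnorm_ae_eq _ _ _ P r _ (Z \- Y' j)); last 3 first.
- exact: measurable_funB.
- exact: measurable_funB.
- by apply: filterS aeA => w Aw; rewrite /= /Y' ifT.
have cth : 0 <= c * th ^+ j by rewrite mulr_ge0// exprn_ge0.
rewrite Lnorm_moment//.
pose f k w : \bar R := (`|Y' k w - Y' j w| `^ r)%:E.
have -> : (\int[P]_w (`|(Z \- Y' j) w| `^ r)%:E = \int[P]_w limn_einf (f ^~ w))%E.
  apply: eq_integral => w _.
  rewrite (@cvg_limn_einf_sup _ (f ^~ w) (`|(Z \- Y' j) w| `^ r)%:E)//.
  apply: cvg_EFin; first exact: nearW.
  apply: cvg_norm_powR => //; apply: cvgB => //; exact: cvg_cst.
apply: (le_trans (fatou P measurableT _ _)).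
- by move=> n; apply: mpow; exact: measurable_funB.
- by move=> n w _; rewrite lee_fin powR_ge0.
rewrite limn_einf_lim; apply: lime_le; first exact: is_cvg_einfs.
apply: nearW => n.
(* The index must be at least n to enter the infimum over the tail, and at least j for the Cauchy
   bound to apply. *)
apply: (@le_trans _ _ (\int[P]_w f (maxn n j) w)%E).
  by apply: ereal_inf_lbound; exists (maxn n j) => //=; exact: leq_maxl.
rewrite -Lnorm_moment//.
apply: le_trans (cauchyY (leq_maxr n j)).
apply: le_LnormEFin => // w; rewrite /= /Y'; case: ifPn => // _.
by rewrite subrr normr0.
Qed.

End Lnorm_complete.

(** * The Ito isometry *)

Section refinement.
Context {R : realType} (S : setting R) (T : R).
Notation P := (Pr S).
Notation mu := (@lebesgue_measure R).
Implicit Types (H : simple_process S T) (t : nat -> R) (n : nat).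

Definition refines t n H :=
  forall i, (i <= sp_size H)%N -> exists2 k, (k <= n)%N & sp_time H i = t k.

Lemma incr_lt t n i j : (forall k, (k < n)%N -> t k < t k.+1) ->
  (i <= n)%N -> (j <= n)%N -> (t i < t j) = (i < j)%N.
Proof.
move=> t_incr.
have h a b : (a < b)%N -> (b <= n)%N -> t a < t b.
  elim: b => // b IH; rewrite ltnS leq_eqVlt => /predU1P[->|ab] bn; first exact: t_incr.
  by rewrite (lt_trans (IH ab (ltnW bn)))// t_incr.
move=> ni nj; have [ij|ji|->] := ltngtP i j; last by rewrite ltxx.
  by rewrite h.
by apply/negP => /(lt_trans (h _ _ ji ni)); rewrite ltxx.
Qed.

(** Cells are open on the left and closed on the right, so cell k lies in ]t i, t j] exactly when
    its right end point t k.+1 does. This is why processes are sampled at right end points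
    throughout the section. *)
Lemma telescope_refine t n i j (g : R -> R) : (forall k, (k < n)%N -> t k < t k.+1) ->
  (i <= j)%N -> (j <= n)%N ->
  g (t j) - g (t i) =
  \sum_(k < n) \1_(`]t i, t j]) (t k.+1) * (g (t k.+1) - g (t k)).
Proof.
move=> t_incr ij jn; have ni := leq_trans ij jn.
rewrite -(telescope_sumr (fun k => g (t k)) ij).
rewrite -(big_mkord xpredT (fun k => \1_(`]t i, t j]) (t k.+1) * (g (t k.+1) - g (t k)))).
rewrite (@big_cat_nat _ _ _ i 0 n)//= (@big_cat_nat _ _ _ j i n)//=.
rewrite [X in _ = X + _]big_nat_cond [X in _ = X + _]big1 ?add0r; last first.
  move=> k; rewrite andbT => /andP[_ ki] /=; rewrite indicE memNset ?mul0r//=.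
  rewrite in_itv/= (incr_lt t_incr)//; last exact: leq_trans ki ni.
  by rewrite ltnS leqNgt ki.
rewrite [X in _ = _ + X]big_nat_cond [X in _ = _ + X]big1 ?addr0; last first.
  move=> k; rewrite andbT => /andP[jk kn] /=; rewrite indicE memNset ?mul0r//=.
  by rewrite in_itv/= => /andP[_]; rewrite leNgt (incr_lt t_incr)// ltnS jk.
apply: eq_big_nat => k /andP[ik kj]; rewrite indicE mem_set ?mul1r//=.
have kn : (k < n)%N := leq_trans kj jn.
by rewrite in_itv/= (incr_lt t_incr)// ltnS ik/= leNgt (incr_lt t_incr)// -leqNgt.
Qed.

Lemma sp_time_le H i j : (i <= j)%N -> (j <= sp_size H)%N -> sp_time H i <= sp_time H j.
Proof.
move=> ij; elim: j ij => [|j IH]; first by rewrite leqn0 => /eqP ->.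
rewrite leq_eqVlt => /predU1P[->//|ij] jn.
by rewrite (le_trans (IH ij (ltnW jn)))// ltW// sp_time_incr.
Qed.

(** The integrator [g] is arbitrary to serve twice: a Wiener path gives the integral of H on the
    finer grid, and the indicator of x <= s, as a function of s, gives H itself. *)
Lemma sp_refine t n H (g : R -> R) w : (forall k, (k < n)%N -> t k < t k.+1) ->
  refines t n H ->
  \sum_(i < sp_size H) sp_val H i w * (g (sp_time H i.+1) - g (sp_time H i)) =
  \sum_(k < n) sp_process H (t k.+1) w * (g (t k.+1) - g (t k)).
Proof.
move=> t_incr tH; rewrite /sp_process.
under [RHS]eq_bigr do rewrite mulr_suml.
rewrite exchange_big/=; apply: eq_bigr => i _.
have [a an ea] := tH i (ltnW (ltn_ord i)).
have [b bn eb] := tH i.+1 (ltn_ord i).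
have ab : (a <= b)%N.
  by apply: ltnW; rewrite -(incr_lt t_incr an bn) -ea -eb sp_time_incr.
rewrite ea eb (telescope_refine g t_incr ab bn) mulr_sumr.
by apply: eq_bigr => k _; rewrite mulrA.
Qed.

Lemma indic_itvoc (a b x : R) : a <= b ->
  \1_(`]a, b]) x = (x <= b)%R%:R - (x <= a)%R%:R :> R.
Proof.
move=> ab; rewrite indicE; have [xa|xa] := leP x a.
  by rewrite memNset/= ?in_itv/= ?ltNge ?xa// (le_trans xa ab) subrr.
have [xb|xb] := leP x b.
  by rewrite mem_set/= ?in_itv/= ?xa ?xb// subr0.
by rewrite memNset ?subr0//= in_itv/= xa/= leNgt xb.
Qed.

Lemma sp_process_refine t n H x w : (forall k, (k < n)%N -> t k < t k.+1) ->
  refines t n H ->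
  sp_process H x w = \sum_(k < n) sp_process H (t k.+1) w * \1_(`]t k, t k.+1]) x.
Proof.
move=> t_incr tH; transitivity (\sum_(k < n) sp_process H (t k.+1) w *
    ((x <= t k.+1)%R%:R - (x <= t k)%R%:R)); last first.
  by apply: eq_bigr => k _; rewrite indic_itvoc// ltW// t_incr.
rewrite -(sp_refine (fun s => (x <= s)%R%:R) w t_incr tH) {1}/sp_process.
by apply: eq_bigr => k _; rewrite indic_itvoc// ltW// sp_time_incr.
Qed.

(** Sampling at the right end point does not look ahead: the cell of H containing t k.+1 begins at a
    node before t k.+1, hence at t k or earlier, and the value is known there. *)
Lemma sp_process_adapted t n H k : (forall k, (k < n)%N -> t k < t k.+1) ->
  0 <= t 0%N -> refines t n H -> (k < n)%N -> adapted_at (t k) (sp_process H (t k.+1)).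
Proof.
move=> t_incr t0 tH kn; apply: measurable_sum => i.
have [a an ea] := tH i (ltnW (ltn_ord i)).
rewrite /= indicE; have [h|h] := boolP (t k.+1 \in _); last first.
  by under eq_fun do rewrite mulr0; exact: measurable_cst.
under eq_fun do rewrite mulr1.
move: h; rewrite inE/= in_itv/= => /andP[+ _]; rewrite ea (incr_lt t_incr)// ltnS => ak.
have le_t i' j' : (i' <= j')%N -> (j' <= n)%N -> t i' <= t j'.
  by move=> ij jn; rewrite leNgt (incr_lt t_incr)// -?leqNgt// (leq_trans ij).
apply: (@adapted_le _ _ (t a)); first by rewrite (le_trans t0)// le_t.
  by rewrite le_t// ltnW.
by rewrite -ea; exact: sp_val_meas.
Qed.

Lemma sum_cells_sqr t n (e : nat -> R) x : (forall k, (k < n)%N -> t k < t k.+1) ->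
  (\sum_(k < n) e k * \1_(`]t k, t k.+1]) x) ^+ 2 =
  \sum_(k < n) e k ^+ 2 * \1_(`]t k, t k.+1]) x.
Proof.
move=> t_incr; elim: n t_incr => [|n IH] t_incr; first by rewrite !big_ord0 expr0n.
have t_incr' k : (k < n)%N -> t k < t k.+1 by move=> kn; apply: t_incr; rewrite ltnW.
rewrite !big_ord_recr/= sqrrD IH// indicE.
have [h|h] := boolP (x \in _); last by rewrite !mulr0 mul0rn expr0n/= !addr0.
have out (k : 'I_n) : \1_(`]t k, t k.+1]) x = 0 :> R.
  rewrite indicE memNset//= in_itv/= => /andP[_ xk].
  move: h; rewrite inE/= in_itv/= => /andP[nx _].
  have : t n < t k.+1 by rewrite (lt_le_trans nx).
  by rewrite (incr_lt t_incr (leqnSn n) (leqW (ltn_ord k))) ltnNge ltn_ord.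
rewrite (big1 _ _ (fun i : 'I_n => e i ^+ 2 * _)) => [|k _]; last by rewrite out mulr0.
rewrite (big1 _ _ (fun i : 'I_n => e i * _)) => [|k _]; last by rewrite out mulr0.
by rewrite mul0r mul0rn !mulr1 !add0r.
Qed.

Local Open Scope ereal_scope.

Lemma integral_cells t n (e : nat -> R) : (forall k, (k < n)%N -> t k < t k.+1)%R ->
  (0 <= t 0%N)%R -> (t n <= T)%R -> (forall k, 0 <= e k)%R ->
  \int[mu]_(x in `[0%R, T]) (\sum_(k < n) e k * \1_(`]t k, t k.+1]) x)%:E =
  \sum_(k < n) ((t k.+1 - t k)%:E * (e k)%:E).
Proof.
move=> t_incr t0 tT e0.
under eq_integral do rewrite -sumEFin.
rewrite ge0_integral_sum//; last 2 first.
- move=> k; apply/measurable_EFinP; apply: measurable_funM; first exact: measurable_cst.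
  exact: measurable_indic.
- by move=> k x _; rewrite lee_fin mulr_ge0.
apply: eq_bigr => k _; rewrite muleC.
under eq_integral do rewrite EFinM.
rewrite ge0_integralZl//; last 2 first.
- by apply/measurable_EFinP; exact: measurable_indic.
- by rewrite lee_fin.
congr (_ * _); rewrite integral_indic//= setIidl; last first.
  move=> x /=; rewrite !in_itv/= => /andP[kx xk].
  have le_t i' j' : (i' <= j')%N -> (j' <= n)%N -> (t i' <= t j')%R.
    by move=> ij jn; rewrite leNgt (incr_lt t_incr)// -?leqNgt// (leq_trans ij).
  rewrite (le_trans t0)/= ?(le_trans xk)// ?(le_trans _ tT)//; first exact: le_t.
  by rewrite (le_trans _ (ltW kx))// le_t// ltnW.
by rewrite lebesgue_measure_itv/= lte_fin t_incr// EFinB.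
Qed.

Lemma sp_isometry_refine t n H1 H2 : (forall k, (k < n)%N -> t k < t k.+1)%R ->
  (0 <= t 0%N)%R -> (t n <= T)%R -> refines t n H1 -> refines t n H2 ->
  \int[P]_w ((sp_integral H1 w - sp_integral H2 w) ^+ 2)%:E =
  kappa%:E * \int[P]_w \int[mu]_(x in `[0%R, T])
    ((sp_process H1 x w - sp_process H2 x w) ^+ 2)%:E.
Proof.
move=> t_incr t0 tT tH1 tH2.
pose e k w := (sp_process H1 (t k.+1) w - sp_process H2 (t k.+1) w)%R.
have ae k : (k < n)%N -> adapted_at (t k) (e k).
  move=> kn; have a1 := sp_process_adapted t_incr t0 tH1 kn.
  have a2 := sp_process_adapted t_incr t0 tH2 kn.
  exact: (measurable_funB a1 a2).
have t_ge0 k : (k <= n)%N -> (0 <= t k)%R by exact: partition_ge0.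
have me k : (k < n)%N -> measurable_fun setT (e k).
  by move=> kn; apply: (adapted_measurable _ (ae k kn)); rewrite t_ge0// ltnW.
have -> : \int[P]_w ((sp_integral H1 w - sp_integral H2 w) ^+ 2)%:E =
    \int[P]_w (mart t e n w ^+ 2)%:E.
  apply: eq_integral => w _; congr (_ ^+ 2)%:E.
  rewrite /sp_integral (sp_refine (wiener S ^~ w) w t_incr tH1).
  rewrite (sp_refine (wiener S ^~ w) w t_incr tH2) -sumrB /mart.
  by apply: eq_bigr => k _; rewrite -mulrBl.
rewrite (mart_sqr t0 t_incr ae (leqnn n)).
have -> : \int[P]_w \int[mu]_(x in `[0%R, T])
      ((sp_process H1 x w - sp_process H2 x w) ^+ 2)%:E =
    \int[P]_w \sum_(k < n) ((t k.+1 - t k)%:E * (e k w ^+ 2)%:E).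
  apply: eq_integral => w _; rewrite -(@integral_cells t n (fun k => e k w ^+ 2)%R t_incr t0 tT); last first.
    by move=> k; exact: sqr_ge0.
  apply: eq_integral => x _; congr EFin.
  rewrite -(@sum_cells_sqr t n (fun k => e k w) x t_incr); congr (_ ^+ 2)%R.
  rewrite (sp_process_refine x w t_incr tH1) (sp_process_refine x w t_incr tH2) -sumrB.
  by apply: eq_bigr => k _; rewrite -mulrBl.
have me2 (k : 'I_n) : measurable_fun setT (fun w => (e k w ^+ 2)%:E).
  by apply/measurable_EFinP; apply: measurable_funX; exact: me.
have h0 (k : 'I_n) : 0 <= (t k.+1 - t k)%:E.
  by rewrite lee_fin subr_ge0 ltW// t_incr.
rewrite ge0_integral_sum//; last 2 first.
- by move=> k; apply: emeasurable_funM => //; exact: measurable_cst.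
- by move=> k w _; rewrite mule_ge0// lee_fin sqr_ge0.
rewrite ge0_sume_distrr; last first.
  move=> k _; apply: integral_ge0 => w _.
  by rewrite mule_ge0// lee_fin sqr_ge0.
apply: eq_bigr => k _; rewrite ge0_integralZl//; last first.
  by move=> w _; rewrite lee_fin sqr_ge0.
by rewrite muleA -EFinM.
Qed.

Lemma common_refinement H1 H2 : exists t n, [/\ forall k, (k < n)%N -> (t k < t k.+1)%R,
  (0 <= t 0%N)%R, (t n <= T)%R, refines t n H1 & refines t n H2].
Proof.
pose times H := [seq sp_time H i | i <- iota 0 (sp_size H).+1].
pose s := sort <=%R (undup (times H1 ++ times H2)).
have tin H x : x \in times H -> (0 <= x <= T)%R.
  move=> /mapP[i]; rewrite mem_iota add0n ltnS => /andP[_ iH] ->.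
  apply/andP; split; first by rewrite -(sp_time0 H) sp_time_le.
  by rewrite -[leRHS](sp_timeT H) sp_time_le.
have s_bd x : x \in s -> (0 <= x <= T)%R.
  by rewrite mem_sort mem_undup mem_cat => /orP[|]; exact: tin.
have su : sorted <%R s by rewrite sort_lt_sorted undup_uniq.
have s_in H i : (i <= sp_size H)%N -> sp_time H i \in times H.
  by move=> iH; apply/mapP; exists i => //; rewrite mem_iota add0n ltnS.
have s0 : (0 < size s)%N.
  rewrite size_sort; have : sp_time H1 0 \in undup (times H1 ++ times H2).
    by rewrite mem_undup mem_cat s_in.
  by case: (undup _).
exists (fun k => nth 0%R s k), (size s).-1; split.
- move=> k kn; have kn' : (k.+1 < size s)%N by rewrite -(ltn_predK s0) ltnS.
  have := @sorted_ltn_nth _ <%R lt_trans 0%R s su k k.+1.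
  by rewrite !inE/= => -> //; exact: ltn_trans kn'.
- by have /andP[] := s_bd _ (mem_nth 0%R s0).
- have ls : ((size s).-1 < size s)%N by rewrite ltn_predL.
  by have /andP[] := s_bd _ (mem_nth 0%R ls).
- move=> i iH; exists (index (sp_time H1 i) s).
    by rewrite -ltnS (ltn_predK s0) index_mem mem_sort mem_undup mem_cat s_in.
  by rewrite nth_index// mem_sort mem_undup mem_cat s_in.
- move=> i iH; exists (index (sp_time H2 i) s).
    by rewrite -ltnS (ltn_predK s0) index_mem mem_sort mem_undup mem_cat s_in// orbT.
  by rewrite nth_index// mem_sort mem_undup mem_cat s_in// orbT.
Qed.

Lemma sp_isometry H1 H2 :
  \int[P]_w ((sp_integral H1 w - sp_integral H2 w) ^+ 2)%:E =
  kappa%:E * \int[P]_w \int[mu]_(x in `[0%R, T])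
    ((sp_process H1 x w - sp_process H2 x w) ^+ 2)%:E.
Proof.
have [t [n [t_incr t0 tT tH1 tH2]]] := common_refinement H1 H2.
exact: (sp_isometry_refine t_incr).
Qed.

End refinement.

(** * The Ito isometry for limits of simple processes *)

Section ito_distance.
Context {R : realType} (S : setting R) (T : R).
Notation P := (Pr S).
Notation mu := (@lebesgue_measure R).
Implicit Types (f g X : R -> Omega S -> R) (H : simple_process S T).

(** The indicator turns the integral over [0, T] into one over the whole line, since processes are
    constrained on [0, T] only. The order (w, t) is that of the iterated integral in
    [is_ito_integral]. *)
Definition jmeas f := measurable_fun setT
  (fun z : Omega S * measurableTypeR R => f z.2 z.1 * \1_(`[0, T]) z.2).

Local Open Scope ereal_scope.

Definition dist2 f := \int[P]_w \int[mu]_(t in `[0%R, T]) ((f t w) ^+ 2)%:E.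

(** The square root of [dist2], written as a norm in L^2 of the product measure so that Minkowski's
    inequality supplies the triangle inequality. *)
Definition norm2 f := 'N[P \x mu]_(2%:E)[EFin \o
  (fun z : Omega S * measurableTypeR R => f z.2 z.1 * \1_(`[0, T]) z.2)%R].

Let sqE (x : R) : (`|x| `^ 2 = x ^+ 2)%R.
Proof. by rewrite powR_mulrn// real_normK ?num_real. Qed.

Let msq f : jmeas f -> measurable_fun setT (fun z : Omega S * measurableTypeR R =>
  ((f z.2 z.1 * \1_(`[0%R, T]) z.2) ^+ 2)%:E).
Proof. by move=> mf; apply/measurable_EFinP; exact: measurable_funX. Qed.

Let patchE f w t : ((fun t => ((f t w) ^+ 2)%:E) \_ `[0%R, T]) t =
  ((f t w * \1_(`[0%R, T]) t) ^+ 2)%:E.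
Proof.
rewrite patchE indicE; case: ifPn => h; first by rewrite mulr1.
by rewrite mulr0 expr0n.
Qed.

Lemma dist2E f : jmeas f -> dist2 f = norm2 f `^ 2.
Proof.
move=> mf; rewrite /norm2 powR_Lnorm//.
under [RHS]eq_integral do rewrite /= sqE.
rewrite (fubini_tonelli1 _ (msq mf)); last by move=> z; rewrite lee_fin sqr_ge0.
apply: eq_integral => w _; rewrite integral_mkcond.
by apply: eq_integral => t _; rewrite patchE.
Qed.

(** The Hoelder condition on integrands bounds moments at fixed times; [trunc_process_dist]
    therefore needs the expectation as the inner integral. *)
Lemma dist2_swap f : jmeas f ->
  dist2 f = \int[mu]_(t in `[0%R, T]) \int[P]_w ((f t w) ^+ 2)%:E.
Proof.
move=> mf; rewrite /dist2.
under eq_integral => w _.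
  rewrite integral_mkcond.
  under eq_integral do rewrite patchE.
  over.
rewrite (fubini_tonelli _ (msq mf))/=; last by move=> z; rewrite lee_fin sqr_ge0.
rewrite [RHS]integral_mkcond; apply: eq_integral => t _.
rewrite /patch indicE; case: ifPn => h.
  by apply: eq_integral => w _; rewrite mulr1.
by rewrite (eq_integral (cst 0)) ?integral0// => w _; rewrite mulr0 expr0n.
Qed.

Lemma norm2_le f (c : R) : jmeas f -> (0 <= c)%R ->
  (norm2 f <= c%:E) = (dist2 f <= (c ^+ 2)%:E).
Proof.
move=> mf c0; rewrite /norm2 Lnorm_moment// dist2E// /norm2 powR_Lnorm//.
by rewrite -sqE ger0_norm.
Qed.

Lemma norm2_ge0 f : 0 <= norm2 f. Proof. exact: Lnorm_ge0. Qed.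

Lemma jmeasB f g : jmeas f -> jmeas g -> jmeas (fun t w => f t w - g t w)%R.
Proof.
move=> mf mg; have := measurable_funB mf mg.
by apply: eq_measurable_fun => z _; rewrite /= mulrBl.
Qed.

Lemma norm2D f g : jmeas f -> jmeas g ->
  norm2 (fun t w => f t w + g t w)%R <= norm2 f + norm2 g.
Proof.
move=> mf mg; apply: le_trans (LnormD _ _ mf mg) => //; last by rewrite ler1n.
rewrite le_eqVlt; apply/orP; left; apply/eqP; apply: eq_Lnorm => z.
by rewrite /= mulrDl.
Qed.

Lemma norm2B_sym f g : norm2 (fun t w => f t w - g t w)%R = norm2 (fun t w => g t w - f t w)%R.
Proof.
rewrite /norm2 -[LHS]LnormN; apply: eq_Lnorm => z.
by rewrite /= -mulNr opprB.
Qed.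

Lemma norm2B_tri f g h : jmeas f -> jmeas g -> jmeas h ->
  norm2 (fun t w => f t w - h t w)%R <=
  norm2 (fun t w => f t w - g t w)%R + norm2 (fun t w => g t w - h t w)%R.
Proof.
move=> mf mg mh; apply: le_trans (norm2D (jmeasB mf mg) (jmeasB mg mh)).
rewrite le_eqVlt; apply/orP; left; apply/eqP; apply: eq_Lnorm => z.
by rewrite /= addrA subrK.
Qed.

Lemma sp_val_measurable H i : (i < sp_size H)%N -> measurable_fun setT (sp_val H i).
Proof.
move=> iH; apply: (@adapted_measurable _ _ (sp_time H i)); last exact: sp_val_meas.
by rewrite -(sp_time0 H) sp_time_le// ltnW.
Qed.

Let mindic_snd (i : interval R) : measurable_fun setT
  (fun z : Omega S * measurableTypeR R => \1_[set` i] z.2 : R).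
Proof.
have m1 : measurable_fun setT (\1_[set` i] : measurableTypeR R -> R).
  by apply: measurable_indic; exact: measurable_itv.
exact: (measurableT_comp m1 measurable_snd).
Qed.

Lemma jmeas_sp H : jmeas (sp_process H).
Proof.
apply: measurable_funM; last exact: mindic_snd.
rewrite /sp_process; apply: measurable_sum => i; apply: measurable_funM.
  exact: (measurableT_comp (sp_val_measurable (ltn_ord i)) measurable_fst).
exact: mindic_snd.
Qed.

Lemma measurable_sp_integral H : measurable_fun setT (sp_integral H).
Proof.
rewrite /sp_integral; apply: measurable_sum => i; apply: measurable_funM.
  exact: sp_val_measurable.
have t0 j : (j <= sp_size H)%N -> (0 <= sp_time H j)%R.
  by move=> jH; rewrite -(sp_time0 H) sp_time_le.
by apply: measurable_wiener_incr; apply: t0 => //; exact: ltnW.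
Qed.

Lemma jmeas_progressive X : (0 <= T)%R -> progressive T X -> jmeas X.
Proof.
move=> T0 /(_ T); rewrite T0 lexx => /(_ isT) mX.
have mD : measurable (`[0%R, T] `*` setT : set (R * g_sigma_algebraType (filt S T))).
  by apply: measurableX => //.
have /(measurable_restrictT _ mD) mX' := mX.
pose sw (z : Omega S * measurableTypeR R) : R * g_sigma_algebraType (filt S T) := (z.2, z.1).
have msw : measurable_fun setT sw.
  apply: measurable_fun_pair; first exact: measurable_snd.
  by apply: (measurableT_comp (measurable_filt_id T0)); exact: measurable_fst.
have := measurableT_comp mX' msw; apply: eq_measurable_fun => -[w t] _ /=.
rewrite /patch indicE /sw/=; have [h|h] := boolP (t \in `[0%R, T]%classic).
  by rewrite mem_set ?mulr1//; split => //; rewrite inE in h.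
by rewrite memNset ?mulr0// => -[/= h' _]; move/negP : h; apply; rewrite inE.
Qed.

Lemma sp_isometry_norm H1 H2 :
  'N[P]_(2%:E)[EFin \o (sp_integral H1 \- sp_integral H2)%R] =
  (Num.sqrt kappa)%:E * norm2 (fun t w => sp_process H1 t w - sp_process H2 t w)%R.
Proof.
have e : 'N[P]_(2%:E)[EFin \o (sp_integral H1 \- sp_integral H2)%R] `^ 2 =
    kappa%:E * norm2 (fun t w => sp_process H1 t w - sp_process H2 t w)%R `^ 2.
  rewrite powR_Lnorm// -dist2E; last exact: jmeasB (jmeas_sp _) (jmeas_sp _).
  rewrite /dist2 -sp_isometry; apply: eq_integral => w _.
  by rewrite /= sqE.
have k0 : (0 <= kappa :> R)%R by rewrite ltW// kappa_gt0.
move: e => /(congr1 (fun x => x `^ 2^-1)).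
rewrite poweRM ?poweR_ge0// -!poweRrM mulfV// !poweRe1 ?Lnorm_ge0 ?norm2_ge0//.
by rewrite poweR_EFin powR12_sqrt.
Qed.

Lemma is_ito_approx X I e : is_ito_integral T X I -> jmeas X -> (0 < e)%R ->
  exists H, norm2 (fun t w => X t w - sp_process H t w)%R <= e%:E /\
    'N[P]_(2%:E)[EFin \o (I \- sp_integral H)%R] <= e%:E.
Proof.
move=> [mI [H [cH cI]]] mX e0.
have e20 : (0 < e ^+ 2)%R by rewrite exprn_gt0.
have near_le (u : nat -> \bar R) (a : R) : (0 < a)%R -> u @ \oo --> 0 -> (forall k, 0 <= u k) ->
    \forall k \near \oo, u k <= a%:E.
  move=> a0 /fine_cvgP[fu cu] u0.
  have /cvgrPdist_le /(_ a a0) := cu; move: fu; apply: filterS2 => k fk /=.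
  by rewrite sub0r normrN ger0_norm ?fine_ge0// -lee_fin fineK.
have [k [h1 h2]] : exists k, (dist2 (fun t w => X t w - sp_process (H k) t w)%R <= (e ^+ 2)%:E) /\
    'N[P]_(2%:E)[EFin \o (I \- sp_integral (H k))%R] <= e%:E.
  have d0 k : 0 <= dist2 (fun t w => X t w - sp_process (H k) t w)%R.
    by apply: integral_ge0 => w _; apply: integral_ge0 => t _; rewrite lee_fin sqr_ge0.
  have n1 := near_le _ _ e20 cH d0.
  have n2 := near_le _ _ e0 cI (fun k => Lnorm_ge0 _ _ _).
  exact: (filter_ex (filterI n1 n2)).
exists (H k); split=> //; rewrite norm2_le ?(ltW e0)//.
exact: (jmeasB mX (jmeas_sp _)).
Qed.

Let LB r (Y Z : Omega S -> R) : (1 <= r)%R -> measurable_fun setT Y -> measurable_fun setT Z ->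
  forall V, measurable_fun setT V ->
  'N[P]_(r%:E)[EFin \o (Y \- V)%R] <= 'N[P]_(r%:E)[EFin \o (Y \- Z)%R] + 'N[P]_(r%:E)[EFin \o (Z \- V)%R].
Proof.
move=> r1 mY mZ V mV.
apply: le_trans (LnormD _ r1 (measurable_funB mY mZ) (measurable_funB mZ mV)).
rewrite le_eqVlt; apply/orP; left; apply/eqP; apply: eq_Lnorm => z.
by rewrite /= addrA subrK.
Qed.

Lemma LnormB_sym r (Y Z : Omega S -> R) :
  'N[P]_(r%:E)[EFin \o (Y \- Z)%R] = 'N[P]_(r%:E)[EFin \o (Z \- Y)%R].
Proof.
rewrite -[LHS]LnormN; apply: eq_Lnorm => z; by rewrite /= opprB.
Qed.

(** With [ito_dist_ge] this is the Ito isometry: both sides are approximated by simple processes,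
    for which it is exact, up to an arbitrary slack e. This half yields uniqueness, the other one
    the lower bounds. *)
Lemma ito_dist_le X X' I I' : is_ito_integral T X I -> is_ito_integral T X' I' ->
  jmeas X -> jmeas X' ->
  'N[P]_(2%:E)[EFin \o (I \- I')%R] <=
  (Num.sqrt kappa)%:E * norm2 (fun t w => X t w - X' t w)%R.
Proof.
move=> iI iI' mX mX'.
have k0 : (0 < Num.sqrt kappa :> R)%R by rewrite sqrtr_gt0 kappa_gt0.
apply/lee_addgt0Pr => e e0.
(* Two integrals and two processes are replaced, each at cost d, the processes with weight sqrt
   kappa: in total 2 d (1 + sqrt kappa) = e. *)
pose d : R := (e / (2 * (1 + Num.sqrt kappa)))%R.
have d0 : (0 < d)%R by rewrite divr_gt0// mulr_gt0// addr_gt0.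
have [H [h1 h2]] := is_ito_approx iI mX d0.
have [H' [h1' h2']] := is_ito_approx iI' mX' d0.
have mI := iI.1; have mI' := iI'.1.
have mS := measurable_sp_integral H; have mS' := measurable_sp_integral H'.
have mH := jmeas_sp H; have mH' := jmeas_sp H'.
have r1 : (1 <= 2 :> R)%R by rewrite ler1n.
apply: (le_trans (LB r1 mI mS mI')).
apply: (le_trans (leeD h2 (LB r1 mS mS' mI'))).
rewrite sp_isometry_norm (LnormB_sym _ (sp_integral H')).
apply: (@le_trans _ _ (d%:E + ((Num.sqrt kappa)%:E *
   (d%:E + (norm2 (fun t w => X t w - X' t w)%R + d%:E)) + d%:E))).
  apply: leeD => //; apply: leeD => //; apply: lee_wpmul2l; first by rewrite lee_fin ltW.
  apply: (le_trans (norm2B_tri mH mX mH')); apply: leeD; first by rewrite norm2B_sym.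
  by apply: (le_trans (norm2B_tri mX mX' mH')); exact: leeD.
have := norm2_ge0 (fun t w => X t w - X' t w)%R.
move: (norm2 _) => [x|_|]//; last first.
  by rewrite gt0_muley ?lte_fin// addye// leey.
rewrite lee_fin => x0; rewrite -!EFinD lee_fin.
have : (2 * d * (1 + Num.sqrt kappa) = e)%R by rewrite /d; field; rewrite gt_eqF// addr_gt0.
move: (Num.sqrt kappa) => k; nra.
Qed.

Lemma ito_dist_ge X X' I I' : is_ito_integral T X I -> is_ito_integral T X' I' ->
  jmeas X -> jmeas X' ->
  (Num.sqrt kappa)%:E * norm2 (fun t w => X t w - X' t w)%R <=
  'N[P]_(2%:E)[EFin \o (I \- I')%R].
Proof.
move=> iI iI' mX mX'.
have k0 : (0 < Num.sqrt kappa :> R)%R by rewrite sqrtr_gt0 kappa_gt0.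
apply/lee_addgt0Pr => e e0.
pose d : R := (e / (2 * (1 + Num.sqrt kappa)))%R.
have d0 : (0 < d)%R by rewrite divr_gt0// mulr_gt0// addr_gt0.
have [H [h1 h2]] := is_ito_approx iI mX d0.
have [H' [h1' h2']] := is_ito_approx iI' mX' d0.
have mI := iI.1; have mI' := iI'.1.
have mS := measurable_sp_integral H; have mS' := measurable_sp_integral H'.
have mH := jmeas_sp H; have mH' := jmeas_sp H'.
have r1 : (1 <= 2 :> R)%R by rewrite ler1n.
have kd : 0 <= (Num.sqrt kappa)%:E :> \bar R by rewrite lee_fin ltW.
apply: (@le_trans _ _ ((Num.sqrt kappa)%:E * (d%:E +
    (norm2 (fun t w => sp_process H t w - sp_process H' t w)%R + d%:E)))).
  apply: lee_wpmul2l => //.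
  apply: (le_trans (norm2B_tri mX mH mX')); apply: leeD => //.
  apply: (le_trans (norm2B_tri mH mH' mX')); apply: leeD => //.
  by rewrite norm2B_sym.
rewrite !ge0_muleDr ?lee_fin ?(ltW d0) ?adde_ge0 ?lee_fin ?norm2_ge0 ?(ltW d0)//.
rewrite -sp_isometry_norm.
apply: (@le_trans _ _ ((Num.sqrt kappa)%:E * d%:E + (d%:E +
   ('N[P]_(2%:E)[EFin \o (I \- I')%R] + d%:E) + (Num.sqrt kappa)%:E * d%:E))).
  apply: leeD => //; apply: leeD => //.
  apply: (le_trans (LB r1 mS mI mS')); apply: leeD; first by rewrite LnormB_sym.
  by apply: (le_trans (LB r1 mI mI' mS')); exact: leeD.
have := Lnorm_ge0 P 2%:E (EFin \o (I \- I')%R).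
move: ('N[P]_(2%:E)[_]) => [x|_|]//.
  rewrite lee_fin => x0; rewrite -!EFinD lee_fin.
  have : (2 * d * (1 + Num.sqrt kappa) = e)%R by rewrite /d; field; rewrite gt_eqF// addr_gt0.
  move: (Num.sqrt kappa) => k; nra.
Qed.

(** [ito_integral] is an arbitrary choice among the versions, so a rate proved for a constructed
    limit reaches it only through almost sure uniqueness. *)
Lemma ito_unique X I I' : is_ito_integral T X I -> is_ito_integral T X I' ->
  jmeas X -> {ae P, forall w, I w = I' w}.
Proof.
move=> iI iI' mX; have := ito_dist_le iI iI' mX mX.
have -> : norm2 (fun t w => X t w - X t w)%R = 0.
  rewrite /norm2 (_ : EFin \o _ = cst 0) ?Lnorm0//.
  by apply/funext => z /=; rewrite subrr mul0r.
rewrite mule0 => N0.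
have /eqP {}N0 : 'N[P]_(2%:E)[EFin \o (I \- I')%R] == 0 by rewrite eq_le N0 Lnorm_ge0.
have mD : measurable_fun setT (EFin \o (I \- I')%R).
  by apply/measurable_EFinP; apply: measurable_funB; [exact: iI.1|exact: iI'.1].
have p2 : 0 < 2%:E :> \bar R by rewrite lte_fin.
have := Lnorm_eq0_eq0 mD p2 N0.
by apply: filterS => w /(_ Logic.I) /= [] /eqP; rewrite subr_eq0 => /eqP.
Qed.

End ito_distance.

(** * The quadrature along refined grids *)

Section quadrature_rate.
Context {R : realType} (S : setting R) (T : R).
Notation P := (Pr S).
Notation W := (wiener S).
Notation mu := (@lebesgue_measure R).
Hypothesis T_gt0 : 0 < T.

Definition grid (n i : nat) : R := i%:R * T / n%:R.

Lemma grid_incr n i : (0 < n)%N -> grid n i < grid n i.+1.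
Proof. by move=> n0; rewrite /grid ltr_pM2r ?invr_gt0 ?ltr0n// ltr_pM2r// ltr_nat. Qed.

Lemma grid0 n : grid n 0 = 0. Proof. by rewrite /grid !mul0r. Qed.

Lemma gridn n : (0 < n)%N -> grid n n = T.
Proof. by move=> n0; rewrite /grid mulrAC mulfV ?mul1r// pnatr_eq0 -lt0n. Qed.

Lemma grid_ge0 n i : 0 <= grid n i.
Proof. by rewrite /grid divr_ge0// mulr_ge0// ltW. Qed.

Lemma grid_in n i : (0 < n)%N -> (i <= n)%N -> 0 <= grid n i <= T.
Proof.
move=> n0 ni; rewrite grid_ge0/= -[leRHS](gridn n0) /grid.
by rewrite ler_pM2r ?invr_gt0 ?ltr0n// ler_pM2r// ler_nat.
Qed.

Lemma gridM n k i : (0 < k)%N -> grid (n * k) (i * k) = grid n i.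
Proof.
move=> k0; rewrite /grid !natrM invfM.
have k0' : k%:R != 0 :> R by rewrite pnatr_eq0 -lt0n.
rewrite -!mulrA; congr (_ * _); rewrite mulrCA; congr (_ * _).
by rewrite mulrCA mulfV// mulr1.
Qed.

Lemma grid_step n i : grid n i.+1 - grid n i = T / n%:R.
Proof. by rewrite /grid -mulrBl -mulrBl -natrB// subSnn mul1r. Qed.

(** The quotient j %/ k is the index of the coarse cell that contains the fine node j. *)
Lemma grid_divn n k j : (0 < k)%N -> (0 < n)%N ->
  grid n (j %/ k) <= grid (n * k) j <= grid n (j %/ k) + T / n%:R.
Proof.
move=> k0 n0; rewrite -(@gridM n k (j %/ k))//.
have nk0 : 0 < (n * k)%:R :> R by rewrite ltr0n muln_gt0 n0.
have -> : T / n%:R = k%:R * T / (n * k)%:R.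
  by rewrite natrM; field; rewrite !pnatr_eq0 -!lt0n n0 k0.
rewrite /grid -mulrDl -mulrDl -natrD !ler_pM2r ?invr_gt0// !ler_nat.
rewrite leq_divM/= {1}(divn_eq j k) leq_add2l ltnW// ltn_mod//.
Qed.

(** A coarse increment is the sum of k fine ones, along which the integrand keeps its coarse value;
    this puts a coarse quadrature on the fine grid. *)
Lemma abel_refine n k (f g G : nat -> R) : (0 < k)%N ->
  (forall i, G (i * k)%N = g i) ->
  \sum_(i < n) f i * (g i.+1 - g i) = \sum_(j < n * k) f (j %/ k)%N * (G j.+1 - G j).
Proof.
move=> k0 Gg; elim: n => [|n IH]; first by rewrite mul0n !big_ord0.
rewrite big_ord_recr/= IH -!(big_mkord xpredT (fun j => f (j %/ k)%N * (G j.+1 - G j))).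
rewrite [RHS](@big_cat_nat _ _ _ (n * k))//=; last by rewrite leq_mul2r leqnSn orbT.
congr (_ + _).
have le : (n * k <= n.+1 * k)%N by rewrite leq_mul2r leqnSn orbT.
rewrite -!Gg -(telescope_sumr G le) mulr_sumr.
apply: eq_big_nat => j /andP[j1 j2]; congr (f _ * _); apply/esym/eqP.
by rewrite eqn_leq -ltnS ltn_divLR// j2/= leq_divRL.
Qed.

Definition quad n (X V : R -> Omega S -> R) (w : Omega S) : R :=
  riemann_maruyama T n (X ^~ w) (V ^~ w).

Lemma quadE n X : quad n X W = mart (grid n) (fun i => X (grid n i)) n.
Proof. by []. Qed.

Section integrand.
Variables (rho r q L : R) (X : R -> Omega S -> R).
Hypotheses (rho_gt0 : 0 < rho) (r_ge2 : 2 <= r) (r_lt_q : r < q) (L_ge0 : 0 <= L).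
Hypothesis XF : integrands rho r q L T X.

Let r0 : 0 < r. Proof. exact: lt_le_trans r_ge2. Qed.
Let r1 : 1 <= r. Proof. by apply: le_trans r_ge2; rewrite ler1n. Qed.
Let q0 : 0 < q. Proof. exact: lt_trans r_lt_q. Qed.

Lemma integrand_adapted t : 0 <= t <= T -> adapted_at t (X t).
Proof.
move=> tT; have [/(_ t tT) mX _ _] := XF; have /andP[t0 _] := tT.
have mD : measurable (`[0, t] `*` setT : set (R * g_sigma_algebraType (filt S t))).
  exact: measurableX.
have sub : (pair t : g_sigma_algebraType (filt S t) -> _) @` setT `<=` `[0, t] `*` setT.
  by move=> _ [w _ <-]; split => //=; rewrite in_itv/= t0 lexx.
exact: (measurable_comp mD sub mX (pair1_measurable t)).
Qed.

Lemma measurable_integrand t : 0 <= t <= T -> measurable_fun setT (X t).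
Proof.
by move=> tT; have /andP[t0 _] := tT; exact: adapted_measurable t0 (integrand_adapted tT).
Qed.

Lemma integrand_jmeas : jmeas T X.
Proof. by have [pX _ _] := XF; apply: jmeas_progressive => //; exact: ltW. Qed.

Lemma integrand_norm t : 0 <= t <= T -> ('N[P]_(q%:E)[EFin \o X t] <= L%:E)%E.
Proof.
move=> tT; have [_ XL _] := XF; apply: le_trans XL; apply: le_Lnorm => // w /=.
apply: le_trans (lee_abs _); apply: ereal_sup_ubound; by exists t => //=; rewrite in_itv.
Qed.

Lemma integrand_hoelder t z : 0 <= t <= T -> 0 <= z <= T ->
  ('N[P]_(r%:E)[EFin \o (X t \- X z)%R] <= (L * `|t - z| `^ rho)%:E)%E.
Proof. by have [_ _] := XF; exact. Qed.

Definition mart_const p : R := (expR (bdg_const p T * T) * (bdg_const p T * T)) `^ p^-1.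

Lemma mart_const_ge0 p : 0 <= mart_const p. Proof. exact: powR_ge0. Qed.

Lemma measurable_quad n : (0 < n)%N -> measurable_fun setT (quad n X W).
Proof.
move=> n0; rewrite quadE; apply: (@measurable_mart _ _ (grid n) n) => //.
- by rewrite grid0.
- by move=> i _; exact: grid_incr.
- by move=> i ni; apply: integrand_adapted; apply: grid_in => //; exact: ltnW.
Qed.

(** The difference is a transform of X(fine node) - X(coarse node to its left). This is adapted at
    the fine node and, by the Hoelder condition, small in terms of the coarse step alone, whatever
    k. *)
Lemma quad_refine n k : (0 < n)%N -> (0 < k)%N ->
  ('N[P]_(r%:E)[EFin \o (quad (n * k) X W \- quad n X W)%R] <=
   (mart_const r * (L * (T / n%:R) `^ rho))%:E)%E.
Proof.
move=> n0 k0; have nk0 : (0 < n * k)%N by rewrite muln_gt0 n0.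
pose e j w := X (grid (n * k) j) w - X (grid n (j %/ k)) w.
have -> : (quad (n * k) X W \- quad n X W) = mart (grid (n * k)) e (n * k).
  apply/funext => w; rewrite /= /quad /riemann_maruyama.
  rewrite (@abel_refine n k (fun i => X (grid n i) w) (fun i => W (grid n i) w)
    (fun j => W (grid (n * k) j) w))//; last by move=> i; rewrite gridM.
  by rewrite -sumrB; apply: eq_bigr => j _; rewrite -mulrBl.
have j_in j : (j < n * k)%N -> (j %/ k < n)%N by move=> jn; rewrite ltn_divLR.
apply: mart_norm => //.
- by rewrite grid0.
- by move=> i _; exact: grid_incr.
- by rewrite gridn.
- move=> j jn; apply: measurable_funB.
    by apply: integrand_adapted; apply: grid_in => //; exact: ltnW.
  have /andP[le _] := grid_divn j k0 n0.
  apply: (adapted_le _ le); first exact: grid_ge0.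
  by apply: integrand_adapted; apply: grid_in => //; exact/ltnW/j_in.
- by rewrite mulr_ge0// powR_ge0.
- move=> j jn.
  have g1 : 0 <= grid (n * k) j <= T by apply: grid_in => //; exact: ltnW.
  have g2 : 0 <= grid n (j %/ k) <= T by apply: grid_in => //; exact/ltnW/j_in.
  apply: (le_trans (integrand_hoelder g1 g2)); rewrite lee_fin ler_wpM2l//.
  have /andP[le1 le2] := grid_divn j k0 n0.
  rewrite ge0_ler_powR ?nnegrE ?(ltW rho_gt0)// ?divr_ge0 ?(ltW T_gt0)//.
  by rewrite ger0_norm ?subr_ge0// lerBlDl.
Qed.

(* Simple processes are bounded, the values of X need not be. *)
Definition trunc (B x : R) : R := if `|x| <= B then x else 0.

Lemma measurable_trunc B : measurable_fun setT (trunc B).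
Proof.
apply: measurable_fun_ifT => //.
by apply: measurable_fun_ler => //; exact: normr_measurable.
Qed.

(** Where |Y| > B, the square |Y|^2 is at most B^(-(q - 2)) |Y|^q, and q > 2. The threshold B
    depends on Y only through L, hence serves all grid points at once. *)
Lemma trunc_norm b : 0 < b -> exists2 B, 0 <= B & forall Y : Omega S -> R,
  measurable_fun setT Y -> ('N[P]_(q%:E)[EFin \o Y] <= L%:E)%E ->
  ('N[P]_(2%:E)[EFin \o (fun w => Y w - trunc B (Y w))%R] <= b%:E)%E.
Proof.
move=> b0; have q2 : 0 < q - 2 by rewrite subr_gt0 (le_lt_trans r_ge2).
(* Since B^(q - 2) = a, the tail is at most L^q / a <= b^2; the summand 1 keeps a positive when L =
   0. *)
pose a := L `^ q / b `^ 2 + 1.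
have b2 : 0 < b `^ 2 by rewrite powR_gt0.
have a0 : 0 < a by rewrite ltr_wpDl// divr_ge0// ?powR_ge0.
pose B := a `^ (q - 2)^-1.
have B0 : 0 < B by rewrite powR_gt0.
exists B; first exact: ltW.
move=> Y mY YL; rewrite Lnorm_moment ?(ltW b0)//.
have mq : measurable_fun setT (fun w => (`|Y w| `^ q)%:E) by exact: measurable_momentP.
apply: (@le_trans _ _ (\int[P]_w ((B `^ (- (q - 2)))%:E * (`|Y w| `^ q)%:E))%E).
  apply: ge0_le_integralT => w; first by rewrite lee_fin powR_ge0.
  rewrite -EFinM lee_fin /trunc; have [_|BY] := leP `|Y w| B.
    by rewrite subrr normr0 powR0// mulr_ge0// powR_ge0.
  have Y0 : 0 < `|Y w| by rewrite (lt_trans B0).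
  have -> : `|Y w| `^ q = `|Y w| `^ (q - 2) * `|Y w| `^ 2.
    by rewrite -powRD ?subrK// (gt_eqF Y0) implybT.
  rewrite subr0 mulrA ler_peMl ?powR_ge0//.
  by rewrite powRN mulrC ler_pdivlMr ?powR_gt0// mul1r ge0_ler_powR ?nnegrE ?(ltW q2) ?(ltW B0) ?(ltW BY)//.
rewrite ge0_integralZl//; last by rewrite lee_fin powR_ge0.
move: YL; rewrite Lnorm_moment// => YL.
apply: (@le_trans _ _ ((B `^ (- (q - 2)))%:E * (L `^ q)%:E)%E).
  by rewrite lee_wpmul2l// lee_fin powR_ge0.
rewrite -EFinM lee_fin powRN mulrC ler_pdivrMr ?powR_gt0//.
rewrite /B -powRrM mulVf ?gt_eqF// powRr1 ?(ltW a0)//.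
by rewrite /a mulrDr mulr1 mulrC divfK ?gt_eqF// lerDl ltW.
Qed.

Section truncated_process.
Variables (m : nat) (B : R).
Hypotheses (m_gt0 : (0 < m)%N) (B_ge0 : 0 <= B).

Let val i w := trunc B (X (grid m i) w).

Lemma trunc_val_meas i : (i < m)%N ->
  measurable_fun setT (val i : g_sigma_algebraType (filt S (grid m i)) -> R).
Proof.
move=> im; apply: (measurableT_comp (measurable_trunc B)).
by apply: integrand_adapted; apply: grid_in => //; exact: ltnW.
Qed.

Lemma trunc_val_bounded i : (i < m)%N -> exists M : R, forall w, `|val i w| <= M.
Proof.
by move=> _; exists B => w; rewrite /val /trunc; case: ifPn => // _; rewrite normr0.
Qed.

Definition trunc_process : simple_process S T :=
  @SimpleProcess R S T m (grid m) val (grid0 m) (gridn m_gt0)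
    (fun i _ => grid_incr i m_gt0) trunc_val_meas trunc_val_bounded.

End truncated_process.

Lemma cell_ex (t : nat -> R) n x : t 0%N < x -> x <= t n ->
  exists2 k, (k < n)%N & t k < x <= t k.+1.
Proof.
move=> t0; elim: n => [|n IH] xn; first by move: (lt_le_trans t0 xn); rewrite ltxx.
have [/IH[k kn kx]|nx] := leP x (t n); first by exists k => //; exact: leqW.
by exists n => //; rewrite nx.
Qed.

Lemma sp_process_cell (H : simple_process S T) i t w : (i < sp_size H)%N ->
  sp_time H i < t <= sp_time H i.+1 -> sp_process H t w = sp_val H i w.
Proof.
move=> iH /andP[it ti]; rewrite /sp_process (bigD1 (Ordinal iH))//= [X in _ + X]big1.
  by rewrite addr0 indicE mem_set ?mulr1//= in_itv/= it.
move=> j ji; rewrite indicE memNset ?mulr0//= in_itv/= => /andP[jt tj].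
have ts := @sp_time_incr _ _ _ H.
have h1 : (i < j.+1)%N.
  by rewrite -(incr_lt ts (ltnW iH) (ltn_ord j)) (lt_le_trans it).
have h2 : (j < i.+1)%N.
  by rewrite -(incr_lt ts (ltnW (ltn_ord j)) iH) (lt_le_trans jt).
by move/eqP : ji; apply; apply/val_inj/eqP; rewrite /= eqn_leq -ltnS h2 -ltnS h1.
Qed.

Let L2B (Y Z V : Omega S -> R) p : 1 <= p -> measurable_fun setT Y -> measurable_fun setT Z ->
  measurable_fun setT V ->
  ('N[P]_(p%:E)[EFin \o (Y \- V)%R] <=
   'N[P]_(p%:E)[EFin \o (Y \- Z)%R] + 'N[P]_(p%:E)[EFin \o (Z \- V)%R])%E.
Proof.
move=> p1 mY mZ mV.
apply: le_trans (LnormD _ p1 (measurable_funB mY mZ) (measurable_funB mZ mV)).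
rewrite le_eqVlt; apply/orP; left; apply/eqP; apply: eq_Lnorm => z.
by rewrite /= addrA subrK.
Qed.

Lemma trunc_process_integral m B b (m0 : (0 < m)%N) (B0 : 0 <= B) : 0 <= b ->
  (forall i, (i < m)%N -> ('N[P]_(2%:E)[EFin \o (fun w => X (grid m i) w - trunc B (X (grid m i) w))%R] <= b%:E)%E) ->
  ('N[P]_(2%:E)[EFin \o (quad m X W \- sp_integral (trunc_process m0 B0))%R] <=
  (mart_const 2 * b)%:E)%E.
Proof.
move=> b0 hb.
have -> : quad m X W \- sp_integral (trunc_process m0 B0) =
    mart (grid m) (fun i w => X (grid m i) w - trunc B (X (grid m i) w)) m.
  apply/funext => w; rewrite /= /quad /riemann_maruyama /sp_integral -sumrB.
  by apply: eq_bigr => i _; rewrite -mulrBl.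
apply: mart_norm => //.
- by rewrite grid0.
- by move=> i _; exact: grid_incr.
- by rewrite gridn.
- move=> i im; have a := @integrand_adapted (grid m i) (grid_in m0 (ltnW im)).
  by apply: measurable_funB; [exact: a|exact: (measurableT_comp (measurable_trunc B) a)].
Qed.

Lemma trunc_process_dist m B b (m0 : (0 < m)%N) (B0 : 0 <= B) : 0 <= b ->
  (forall i, (i < m)%N -> ('N[P]_(2%:E)[EFin \o (fun w => X (grid m i) w - trunc B (X (grid m i) w))%R] <= b%:E)%E) ->
  (dist2 T (fun t w => X t w - sp_process (trunc_process m0 B0) t w)%R <=
   (T * (L * (T / m%:R) `^ rho + b) ^+ 2)%:E)%E.
Proof.
move=> b0 hb.
set H := trunc_process m0 B0.
have T0 := ltW T_gt0.
rewrite dist2_swap; last exact: jmeasB integrand_jmeas (jmeas_sp H).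
set c := L * _ + b.
have c0 : 0 <= c by rewrite addr_ge0// mulr_ge0// powR_ge0.
have bound t : t \in `]0, T] ->
    (\int[P]_w ((X t w - sp_process H t w) ^+ 2)%:E <= (c ^+ 2)%:E)%E.
  rewrite in_itv/= => /andP[t0 tT].
  have t01 : 0 <= t <= T by rewrite (ltW t0).
  have [i im /andP[it ti]] : exists2 i, (i < m)%N & grid m i < t <= grid m i.+1.
    by apply: cell_ex; rewrite ?grid0// gridn.
  have gi := grid_in m0 (ltnW im).
  under eq_integral => w _ do rewrite (@sp_process_cell H i t w im) ?it ?ti//=.
  have -> : (\int[P]_w ((X t w - trunc B (X (grid m i) w)) ^+ 2)%:E =
      \int[P]_w (`|X t w - trunc B (X (grid m i) w)| `^ 2)%:E)%E.
    by apply: eq_integral => w _; rewrite powR_mulrn// real_normK ?num_real.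
  have -> : c ^+ 2 = c `^ 2 by rewrite powR_mulrn.
  rewrite -Lnorm_moment//.
  have mXt := measurable_integrand t01; have mXi := measurable_integrand gi.
  have mtr : measurable_fun setT (fun w => trunc B (X (grid m i) w)).
    exact: (measurableT_comp (measurable_trunc B) mXi).
  apply: (le_trans (@L2B _ _ _ 2 _ mXt mXi mtr)); first by rewrite ler1n.
  rewrite [leRHS]EFinD; apply: leeD; last exact: hb.
  apply: (le_trans (@Lnorm_exponent_le _ _ _ P 2 r _ _ r_ge2 (measurable_funB mXt mXi))) => //.
  apply: (le_trans (integrand_hoelder t01 gi)); rewrite lee_fin ler_wpM2l//.
  rewrite ge0_ler_powR ?nnegrE ?(ltW rho_gt0)// ?divr_ge0//.
  by rewrite ger0_norm ?subr_ge0 ?(ltW it)// -(grid_step m i) lerB.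
(* No left-open cell contains the time 0, so the simple process vanishes there and only a crude
   finite bound holds; being a single time, it contributes nothing to the integral. *)
have bound0 : (\int[P]_w ((X 0 w - sp_process H 0 w) ^+ 2)%:E <= (L ^+ 2)%:E)%E.
  have e0 w : sp_process H 0 w = 0.
    rewrite /sp_process big1// => i _; rewrite indicE memNset ?mulr0//= in_itv/=.
    by rewrite ltNge grid_ge0.
  have -> : (\int[P]_w ((X 0 w - sp_process H 0 w) ^+ 2)%:E =
      \int[P]_w (`|X 0 w| `^ 2)%:E)%E.
    by apply: eq_integral => w _; rewrite e0 subr0 powR_mulrn// real_normK ?num_real.
  have -> : L ^+ 2 = L `^ 2 by rewrite powR_mulrn.
  rewrite -Lnorm_moment//.
  have t0 : 0 <= (0 : R) <= T by rewrite lexx.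
  apply: le_trans (integrand_norm t0).
  apply: Lnorm_exponent_le => //; last exact: measurable_integrand.
  exact: ltW (le_lt_trans r_ge2 r_lt_q).
rewrite integral_mkcond.
apply: (@le_trans _ _ (\int[mu]_t ((c ^+ 2)%:E * (\1_`[0%R, T] t)%:E + (L ^+ 2)%:E * (\1_[set 0%R] t)%:E))%E).
  apply: ge0_le_integralT => t.
    rewrite patchE; case: ifPn => // _; apply: integral_ge0 => w _.
    by rewrite lee_fin sqr_ge0.
  rewrite patchE; case: ifPn => tT; last first.
    by rewrite adde_ge0// mule_ge0// lee_fin ?sqr_ge0.
  have [->|t0] := eqVneq t 0.
    rewrite (le_trans bound0)// [X in (_ <= _ + _ * X)%E](_ : _ = 1%E); last first.
      by rewrite indicE mem_set.
    by rewrite mule1 leeDr// mule_ge0// lee_fin ?sqr_ge0.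
  move: (tT); rewrite inE/= in_itv/= => /andP[t0' tT'].
  rewrite (le_trans (bound t _))//; first by rewrite in_itv/= lt_neqAle eq_sym t0 t0'.
  rewrite [X in (_ <= _ * X + _)%E](_ : _ = 1%E); last by rewrite indicE tT.
  by rewrite mule1 leeDl// mule_ge0// lee_fin ?sqr_ge0.
have mi (A : set R) : measurable A -> measurable_fun setT (fun t : R => (\1_A t)%:E : \bar R).
  by move=> mA; apply/measurable_EFinP; exact: measurable_indic.
have mZ (k : R) (A : set R) : measurable A -> measurable_fun setT (fun t : R => k%:E * (\1_A t)%:E : \bar R)%E.
  by move=> mA; apply: emeasurable_funM => //; exact: mi.
have i0 (A : set R) (t : R) : (0 <= (\1_A t)%:E :> \bar R)%E by rewrite lee_fin.
have k0 (k : R) (A : set R) (t : R) : (0 <= (k ^+ 2)%:E * (\1_A t)%:E :> \bar R)%E.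
  by rewrite mule_ge0// lee_fin sqr_ge0.
have mI : measurable (`[0%R, T] : set R) by exact: measurable_itv.
have m1 : measurable ([set 0%R] : set R) by exact: measurable_set1.
rewrite (ge0_integralD mu measurableT (fun t _ => k0 c _ t) (mZ _ _ mI) (fun t _ => k0 L _ t) (mZ _ _ m1)).
rewrite (ge0_integralZl mu measurableT (mi _ mI) (fun t _ => i0 _ t)) ?lee_fin ?sqr_ge0//.
rewrite (ge0_integralZl mu measurableT (mi _ m1) (fun t _ => i0 _ t)) ?lee_fin ?sqr_ge0//.
rewrite !integral_indic//= !setIT lebesgue_measure_set1 mule0 adde0.
by rewrite lebesgue_measure_itv/= lte_fin T_gt0 oppr0 addr0 -EFinM mulrC.
Qed.

Lemma cvge0_inv (u : nat -> \bar R) :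
  (forall k, (0 <= u k)%E /\ (u k <= (k.+1%:R^-1)%:E)%E) -> u @ \oo --> 0%E.
Proof.
move=> hu; apply: (@squeeze_cvge _ _ _ _ (cst 0%E) _ (fun k => (k.+1%:R^-1)%:E)).
- by apply: nearW => k; have [-> ->] := hu k.
- exact: cvg_cst.
- by apply: cvg_EFin; [exact: nearW|exact: cvg_harmonic].
Qed.

Lemma is_ito_of_approx (Z : Omega S -> R) : measurable_fun setT Z ->
  (forall e, 0 < e -> exists H : simple_process S T,
    (dist2 T (fun t w => X t w - sp_process H t w)%R <= e%:E)%E /\
    ('N[P]_(2%:E)[EFin \o (Z \- sp_integral H)%R] <= e%:E)%E) ->
  is_ito_integral T X Z.
Proof.
move=> mZ happ; split => //.
have k0 (k : nat) : 0 < k.+1%:R^-1 :> R by rewrite invr_gt0.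
exists (fun k => projT1 (cid (happ _ (k0 k)))); split.
  apply: cvge0_inv => k; have [h _] := projT2 (cid (happ _ (k0 k))); split; [|exact: h].
  by apply: integral_ge0 => w _; apply: integral_ge0 => t _; rewrite lee_fin sqr_ge0.
apply: cvge0_inv => k; have [_ h] := projT2 (cid (happ _ (k0 k))); split; last exact: h.
exact: Lnorm_ge0.
Qed.

(** The limit is taken along the grids with n 2^j steps, so that the n-step quadrature is the term j
    = 0 of the sequence. Truncated step processes on the same grids show that the limit is an Ito
    integral. *)
Lemma ito_exists n : (0 < n)%N -> exists2 I, is_ito_integral T X I &
  ('N[P]_(r%:E)[EFin \o (I \- quad n X W)%R] <=
   (mart_const r * (L * (T / n%:R) `^ rho))%:E)%E.
Proof.
move=> n0; set a := L * (T / n%:R) `^ rho.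
have a0 : 0 <= a by rewrite mulr_ge0// powR_ge0.
(* Halving the step multiplies the Hoelder bound by 2^(-rho), which makes the Cauchy bound
   geometric. *)
pose th : R := 2^-1 `^ rho.
have th0 : 0 <= th by exact: powR_ge0.
have th1 : th < 1.
  have := @gt0_ltr_powR R rho rho_gt0 2^-1 1; rewrite !nnegrE powR1; apply => //.
  by rewrite invf_lt1// ltr1n.
have n2 j : (0 < n * 2 ^ j)%N by rewrite muln_gt0 n0 expn_gt0.
have aj j : L * (T / (n * 2 ^ j)%:R) `^ rho = a * th ^+ j.
  rewrite /a /th -powR_mulrn// -powRrM (mulrC rho) powRrM powR_mulrn//.
  rewrite natrM natrX invfM exprVn mulrA powRM ?mulrA//.
  by rewrite divr_ge0// ltW.
pose Y j := quad (n * 2 ^ j) X W.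
have c0 : 0 <= mart_const r * a by rewrite mulr_ge0// mart_const_ge0.
have mY j : measurable_fun setT (Y j) by exact: measurable_quad.
have cauchy j k : (j <= k)%N ->
    ('N[P]_(r%:E)[EFin \o (Y k \- Y j)%R] <= (mart_const r * a * th ^+ j)%:E)%E.
  move=> jk; have -> : Y k = quad (n * 2 ^ j * 2 ^ (k - j)) X W.
    by rewrite /Y -mulnA -expnD subnKC.
  by rewrite -mulrA -aj quad_refine// expn_gt0.
have [Z mZ hZ] := Lnorm_complete r1 c0 th0 th1 mY cauchy.
exists Z; last first.
  by have := hZ 0%N; rewrite expr0 mulr1 /Y expn0 muln1.
apply: is_ito_of_approx => // e e0.
(* Discretization and truncation will each cost d. The first entry makes T (2d)^2 <= e for the
   processes, the second makes (C_r + C_2) d <= e for the integrals. *)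
pose d := Num.min (Num.sqrt (e / (4 * T))) (e / (mart_const r + mart_const 2 + 1)).
have mc : 0 < mart_const r + mart_const 2 + 1.
  by rewrite ltr_wpDl// addr_ge0// mart_const_ge0.
have d0 : 0 < d by rewrite lt_min sqrtr_gt0 !divr_gt0// mulr_gt0.
have dT : T * (d + d) ^+ 2 <= e.
  have : d ^+ 2 <= e / (4 * T).
    rewrite -[leRHS]sqr_sqrtr; last by rewrite divr_ge0 ?(ltW e0)// mulr_ge0// ltW.
    by rewrite lerXn2r ?nnegrE ?sqrtr_ge0 ?(ltW d0)// ge_min lexx.
  rewrite ler_pdivlMr ?mulr_gt0//; apply: le_trans.
  by rewrite le_eqVlt; apply/orP; left; apply/eqP; ring.
have dC : (mart_const r + mart_const 2) * d <= e.
  have : d <= e / (mart_const r + mart_const 2 + 1) by rewrite ge_min lexx orbT.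
  by rewrite ler_pdivlMr//; apply: le_trans; rewrite mulrDr mulr1 mulrC lerDl ltW.
have [j hj] : exists j, a * th ^+ j <= d.
  have : geometric a th @ \oo --> 0 by apply: cvg_geometric; rewrite ger0_norm.
  move=> /cvgrPdist_le /(_ d d0) h; have [j hj] := filter_ex h.
  exists j; move: hj; rewrite /= sub0r normrN ger0_norm//.
  by rewrite mulr_ge0// exprn_ge0.
have [B B0 hB] := trunc_norm d0.
have hb i : (i < n * 2 ^ j)%N ->
    ('N[P]_(2%:E)[EFin \o (fun w => X (grid (n * 2 ^ j) i) w - trunc B (X (grid (n * 2 ^ j) i) w))%R] <= d%:E)%E.
  move=> ij; have g : 0 <= grid (n * 2 ^ j) i <= T by apply: grid_in => //; exact: ltnW.
  by apply: hB; [exact: measurable_integrand|exact: integrand_norm].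
exists (trunc_process (n2 j) B0); split.
  apply: (le_trans (trunc_process_dist (n2 j) B0 (ltW d0) hb)); rewrite lee_fin.
  apply: le_trans dT; rewrite ler_wpM2l ?(ltW T_gt0)// lerXn2r ?nnegrE ?addr_ge0 ?(ltW d0)//.
    by rewrite mulr_ge0// powR_ge0.
  by rewrite lerD2r aj.
have mS := measurable_sp_integral (trunc_process (n2 j) B0).
apply: (le_trans (@L2B _ _ _ 2 _ mZ (mY j) mS)); first by rewrite ler1n.
apply: (@le_trans _ _ ((mart_const r * d)%:E + (mart_const 2 * d)%:E)%E); last first.
  by rewrite -EFinD lee_fin -mulrDl.
apply: leeD; last exact: (trunc_process_integral (n2 j) B0 (ltW d0) hb).
apply: (le_trans (@Lnorm_exponent_le _ _ _ P 2 r _ _ r_ge2 (measurable_funB mZ (mY j)))) => //.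
by apply: (le_trans (hZ j)); rewrite lee_fin -mulrA ler_wpM2l// mart_const_ge0.
Qed.

Lemma ito_integralP : is_ito_integral T X (ito_integral T X).
Proof.
have [I hI _] := ito_exists (ltn0Sn 0).
by apply: xgetPex; exists I.
Qed.

Lemma ito_quad_rate n : (0 < n)%N ->
  ('N[P]_(r%:E)[EFin \o (ito_integral T X \- quad n X W)%R] <=
   (mart_const r * (L * (T / n%:R) `^ rho))%:E)%E.
Proof.
move=> n0; have [I hI hN] := ito_exists n0.
have mI := hI.1; have mI' := ito_integralP.1.
rewrite (@Lnorm_ae_eq _ _ _ P r _ (I \- quad n X W))//.
- by apply: measurable_funB => //; exact: measurable_quad.
- by apply: measurable_funB => //; exact: measurable_quad.
- apply: filterS (ito_unique ito_integralP hI integrand_jmeas) => w /= -> //.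
Qed.

End integrand.
End quadrature_rate.

(** * Disturbed Wiener paths *)

Section disturbance_expansion.
Context {R : realType}.
Implicit Types (s T a b x y t : R) (p : R -> R -> R).

(** A majorant of 1 + |y|^s for |y| <= z that increases with z. The exponent s + 1 instead of s is
    at least 1, so that Minkowski's inequality applies to its moments for every s >= 0, and the
    convention at s = 0 needs no case of its own later. *)
Definition growth s (z : R) : R := 2 * (1 + z) `^ (s + 1).

Lemma growth_ge0 s z : 0 <= growth s z.
Proof. by rewrite mulr_ge0// powR_ge0. Qed.

Lemma growth_le s y z : 0 <= s -> `|y| <= z -> 1 + abspow s y <= growth s z.
Proof.
move=> s0 yz; have z0 : 0 <= z := le_trans (normr_ge0 _) yz.
have z1 : 1 <= 1 + z by rewrite lerDl.
have s1 : 0 <= s + 1 by rewrite addr_ge0.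
have h1 : 1 <= (1 + z) `^ (s + 1) by have := ler_powR z1 s1; rewrite powRr0.
rewrite /growth mulr2n mulrDl mul1r lerD// /abspow; case: ifPn => _.
  exact: powR_ge0.
apply: (@le_trans _ _ ((1 + z) `^ s)); last by rewrite ler_powR// lerDl.
by rewrite ge0_ler_powR ?nnegrE// ?addr_ge0// (le_trans yz)// lerDr.
Qed.

Lemma is_derive_within T (f : R -> R) t (l : R) : 0 < t < T ->
  (fun u => (f u - f t) / (u - t)) @ within `[0, T] t^' --> l -> is_derive t 1 f l.
Proof.
move=> /andP[t0 tT] /cvgrPdist_lt h.
have c : h^-1 *: ((f \o shift t) (h *: (1 : R)) - f t) @[h --> 0^'] --> l.
  apply/cvgrPdist_lt => e e0.
  have := h _ e0; rewrite /within/= /dnbhs/within/= => /nbhs_ballP[d /= d0 hd].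
  have m0 : 0 < Num.min d (Num.min t (T - t)) by rewrite !lt_min d0 t0 subr_gt0.
  apply/nbhs_ballP; exists (Num.min d (Num.min t (T - t))) => //= k.
  rewrite /ball/= sub0r normrN !lt_min => /and3P[kd kt kT] k0.
  have := hd (k + t); rewrite /ball/= opprD addrA addrAC subrr add0r normrN => /(_ kd).
  rewrite -[X in _ != X]add0r (inj_eq (addIr _)) => /(_ k0).
  rewrite in_itv/= addrK /GRing.scale/= mulr1 [X in `|_ - X|]mulrC; apply.
  move: kt kT; rewrite !ltr_norml; lra.
exact: DeriveDef (cvgP _ c) (cvg_lim _ c).
Qed.

Lemma mvt_between (f df : R -> R) x y : (forall z : R, is_derive z 1 f (df z)) ->
  exists2 c, `|c - x| <= `|y - x| & f y - f x = df c * (y - x).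
Proof.
move=> fd; have cf (i : interval R) : {within [set` i], continuous f}.
  by apply: derivable_within_continuous => z _; exact: ex_derive.
have [xy|yx|->] := ltgtP x y; last by exists y => //; rewrite !subrr mulr0.
  have [c + ->] := MVT xy (fun z _ => fd z) (cf _); rewrite in_itv/= => /andP[xc cy].
  by exists c => //; rewrite !gtr0_norm ?subr_gt0// lerB// ltW.
have [c + e] := MVT yx (fun z _ => fd z) (cf _); rewrite in_itv/= => /andP[yc cx].
exists c; first by rewrite !ltr0_norm ?subr_lt0// lerN2 lerB// ltW.
by rewrite -opprB e -mulrN opprB.
Qed.

Section expansion.
Variables (s T : R) (p pt py pyy : R -> R -> R).
Hypotheses (s0 : 0 <= s) (pC : C12_with T p pt py pyy).
Hypothesis pB : forall t y : R, 0 <= t <= T ->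
  [/\ `|pt t y| <= 1 + abspow s y, `|py t y| <= 1 + abspow s y &
      `|pyy t y| <= 1 + abspow s y].

Lemma disturbance_time a b y : 0 <= a -> a <= b -> b <= T ->
  `|p b y - p a y| <= (b - a) * growth s `|y|.
Proof.
move=> a0 ab bT; have [pd _ _ pc] := pC.
have d t : t \in `]a, b[ -> is_derive t 1 (p^~ y) (pt t y).
  rewrite in_itv/= => /andP[at_ tb]; apply: (@is_derive_within T).
    by rewrite (le_lt_trans a0 at_)/= (lt_le_trans tb bT).
  by apply: pd; rewrite (le_trans a0 (ltW at_)) (le_trans (ltW tb) bT).
have c : {within `[a, b], continuous (p^~ y)}.
  apply/subspace_continuousP => t /=; rewrite in_itv/= => /andP[at_ tb].
  have cp : {within `[0, T] `*` setT, continuous (fun z : R * R => p z.1 z.2)}.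
    exact: (pc _ (Or41 _ _ _ erefl)).
  have tT : (`[0, T] `*` setT) (t, y).
    by split => //=; rewrite in_itv/= (le_trans a0 at_) (le_trans tb bT).
  move/subspace_continuousP : cp => /(_ _ tT) cp.
  move=> V /cp[[A B] [/= nA nB] AB]; apply: filterS nA => u /= Au.
  rewrite in_itv/= => /andP[au ub]; apply: (AB (u, y)).
    by split => //=; exact: nbhs_singleton.
  by split => //=; rewrite in_itv/= (le_trans a0 au) (le_trans ub bT).
have [u + ->] := MVT_segment ab d c; rewrite in_itv/= => /andP[au ub].
rewrite normrM mulrC (ger0_norm (_ : 0 <= b - a)) ?subr_ge0//.
rewrite ler_wpM2l ?subr_ge0//.
have uT : 0 <= u <= T by rewrite (le_trans a0 au) (le_trans ub bT).
by have [h _ _] := pB y uT; rewrite (le_trans h)// growth_le.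
Qed.

(** The mean value theorem, applied to p and then to [py], replaces Taylor's formula; the factor 1/2
    is given up. *)
Lemma disturbance_space a x y : 0 <= a <= T ->
  `|p a y - p a x - py a x * (y - x)| <= (y - x) ^+ 2 * growth s (`|x| + `|y - x|).
Proof.
move=> aT; have [_ d1 d2 _] := pC.
have [c1 c1x ->] := mvt_between x y (fun z => d1 a z aT).
rewrite -mulrBl; have [c2 c2x ->] := mvt_between x c1 (fun z => d2 a z aT).
rewrite -mulrA normrM mulrC; apply: ler_pM => //.
  rewrite normrM -[leRHS]real_normK ?num_real// expr2.
  by rewrite ler_wpM2r.
have [_ _ h] := pB c2 aT; rewrite (le_trans h)// growth_le//.
rewrite -[X in `|X|](subrK x) addrC (le_trans (ler_normD _ _))// lerD2l.
exact: le_trans c2x c1x.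
Qed.

(** Passing through p(a, y), with time moved at the new point y and space moved at the old time a,
    leaves the derivative at (a, x). With x = W(a) this coefficient is adapted, as a martingale
    transform requires. *)
Lemma disturbance_expansion a b x y : 0 <= a -> a <= b -> b <= T ->
  `|p b y - p a x - py a x * (y - x)| <=
  (b - a + (y - x) ^+ 2) * growth s (`|x| + `|y - x|).
Proof.
move=> a0 ab bT.
have -> : p b y - p a x - py a x * (y - x) =
    (p b y - p a y) + (p a y - p a x - py a x * (y - x)) by ring.
rewrite (le_trans (ler_normD _ _))// mulrDl lerD//; last first.
  by apply: disturbance_space; rewrite a0 (le_trans ab bT).
rewrite (le_trans (disturbance_time y a0 ab bT))// ler_wpM2l ?subr_ge0//.
rewrite ler_wpM2l// ge0_ler_powR ?nnegrE ?addr_ge0//.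
by rewrite lerD2l -[X in `|X| <= _](subrK x) addrC (ler_normD _ _).
Qed.

Lemma disturbance_dy_le a x z : 0 <= a <= T -> `|x| <= z -> `|py a x| <= growth s z.
Proof. by move=> aT xz; have [_ h _] := pB x aT; rewrite (le_trans h)// growth_le. Qed.

Lemma measurable_disturbance a : 0 <= a <= T -> measurable_fun setT (p a).
Proof.
move=> aT; have [_ d1 _ _] := pC; apply: continuous_measurable_fun => z.
by apply: differentiable_continuous; apply/derivable1_diffP; have [] := d1 a z aT.
Qed.

Lemma measurable_disturbance_dy a : 0 <= a <= T -> measurable_fun setT (py a).
Proof.
move=> aT; have [_ _ d2 _] := pC; apply: continuous_measurable_fun => z.
by apply: differentiable_continuous; apply/derivable1_diffP; have [] := d2 a z aT.
Qed.

End expansion.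
End disturbance_expansion.

(** * Moments of Wiener increments and of the growth factor *)

Section wiener_moments.
Context {R : realType} (S : setting R).
Notation P := (Pr S).
Notation W := (wiener S).
Implicit Types (p s t u T : R).

Definition gauss_norm p : R := fine (gauss_moment p) `^ p^-1.

Lemma gauss_norm_ge0 p : 0 <= gauss_norm p. Proof. exact: powR_ge0. Qed.

Lemma wiener_incr_norm u t p : 0 <= u -> u < t -> 0 < p ->
  ('N[P]_(p%:E)[EFin \o (fun w => W t w - W u w)%R] <=
   (gauss_norm p * Num.sqrt (t - u))%:E)%E.
Proof.
move=> u0 ut p0; have h0 : 0 < t - u by rewrite subr_gt0.
have s0 : 0 < Num.sqrt (t - u) by rewrite sqrtr_gt0.
rewrite Lnorm_moment//; last by rewrite mulr_ge0 ?gauss_norm_ge0// ltW.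
have m0 : (0 <= fine (gauss_moment p) :> R)%R by rewrite fine_ge0// gauss_moment_ge0.
have mh : measurable_fun setT
    (fun z : g_sigma_algebraType (filt S u) * R => (`|z.2| `^ p)%:E).
  apply/measurable_EFinP; apply: (measurableT_comp (measurable_abspow p)).
  exact: measurable_snd.
rewrite (@increment_law _ _ u t (fun z => (`|z.2| `^ p)%:E) u0 ut mh); last first.
  by move=> z; rewrite lee_fin powR_ge0.
under eq_integral do rewrite /= normal_prob_moment//.
rewrite -[gauss_moment p]fineK ?gauss_moment_fin// ?(ltW p0)// -EFinM.
set c := (_ * _)%:E; have -> : (\int[P]_w c = c)%E.
  by rewrite -[RHS]mule1 -(probability_setT P); exact: (integral_cst P measurableT c).
rewrite lee_fin /gauss_norm.
by rewrite powRM ?powR_ge0 ?(ltW s0)// -powRrM mulVf ?gt_eqF// powRr1// mulrC.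
Qed.

Lemma Lnorm_normr d (Om : measurableType d) (Q : probability Om R) p (Y : Om -> R) :
  ('N[Q]_(p%:E)[EFin \o (fun w => `|Y w|)%R] = 'N[Q]_(p%:E)[EFin \o Y])%E.
Proof. by rewrite -[RHS]Lnorm_abse. Qed.

Lemma wiener_norm t T p : 0 <= t -> t <= T -> 0 < p ->
  ('N[P]_(p%:E)[EFin \o W t] <= (gauss_norm p * Num.sqrt T)%:E)%E.
Proof.
move=> t0 tT p0; have [_ W0 _ _ _] := wienerP S.
have T0 := le_trans t0 tT.
have mWt : measurable_fun setT (W t) := measurable_wiener t0.
have [t00|tn0] := eqVneq t 0.
  rewrite (@Lnorm_ae_eq _ _ _ P p _ (cst 0)) ?Lnorm_cstP//.
    by rewrite normr0 lee_fin mulr_ge0 ?gauss_norm_ge0// sqrtr_ge0.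
  by apply: filterS W0 => w; rewrite t00.
have tp : 0 < t by rewrite lt_neqAle eq_sym tn0.
rewrite (@Lnorm_ae_eq _ _ _ P p _ (fun w => W t w - W 0 w))//.
- apply: (le_trans (wiener_incr_norm (lexx 0) tp p0)).
  by rewrite subr0 lee_fin ler_wpM2l ?gauss_norm_ge0// ler_wsqrtr.
- exact: measurable_wiener_incr.
- by apply: filterS W0 => w ->; rewrite subr0.
Qed.

(** The p-norm of [growth] is a power of a norm of exponent p (s + 1), which Minkowski splits into
    1, the value W(u) and the increment; the last two are bounded alike, whence the inner factor
    2. *)
Definition growth_const s p T : R := 2 * (1 + 2 * (gauss_norm (p * (s + 1)) * Num.sqrt T)) `^ (s + 1).

Lemma growth_const_ge0 s p T : 0 <= growth_const s p T.
Proof. by rewrite mulr_ge0// powR_ge0. Qed.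

Lemma measurable_growth s (Y : Omega S -> R) : measurable_fun setT Y ->
  measurable_fun setT (fun w => growth s (Y w)).
Proof.
move=> mY; apply: measurable_funM => //; apply: (measurableT_comp (measurable_powR _)).
exact: measurable_funD.
Qed.

Lemma growth_norm s p u t T : 0 <= s -> 1 <= p -> 0 <= u -> u < t -> t <= T ->
  ('N[P]_(p%:E)[EFin \o (fun w => growth s (`|W u w| + `|W t w - W u w|))%R] <=
   (growth_const s p T)%:E)%E.
Proof.
move=> s0 p1 u0 ut tT; have t0 := le_trans u0 (ltW ut).
have p0 : 0 < p by exact: lt_le_trans p1.
have s1 : 1 <= s + 1 by rewrite lerDr.
have s10 : 0 < s + 1 by rewrite (lt_le_trans _ s1).
have ps1 : 1 <= p * (s + 1) by rewrite -[leLHS]mulr1 ler_pM.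
have ps0 : 0 < p * (s + 1) by rewrite mulr_gt0.
have mW : measurable_fun setT (W u) := measurable_wiener u0.
have mD : measurable_fun setT (fun w => W t w - W u w) := measurable_wiener_incr u0 t0.
have mWn : measurable_fun setT (fun w => `|W u w|).
  by apply: measurableT_comp; [exact: normr_measurable|].
have mDn : measurable_fun setT (fun w => `|W t w - W u w|).
  by apply: measurableT_comp; [exact: normr_measurable|].
have mS := measurable_funD mWn mDn.
have m1 : measurable_fun setT (fun w => 1 + (`|W u w| + `|W t w - W u w|)).
  exact: measurable_funD.
have -> : (fun w => growth s (`|W u w| + `|W t w - W u w|)) =
    (fun w => 2 * `|1 + (`|W u w| + `|W t w - W u w|)| `^ (s + 1)).
  apply/funext => w; rewrite /growth [in RHS](ger0_norm (_ : 0 <= 1 + _))//.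
rewrite Lnorm_cst_mul//; last first.
  apply: (measurableT_comp (measurable_powR _)).
  by apply: measurableT_comp; [exact: normr_measurable|].
rewrite Lnorm_pow// ger0_norm// /growth_const [leRHS]EFinM.
apply: lee_wpmul2l; first by rewrite lee_fin.
rewrite -poweR_EFin; apply: gt0_ler_poweR; rewrite ?(ltW s10)//.
- by rewrite in_itv/= leey Lnorm_ge0.
- by rewrite in_itv/= leey andbT lee_fin addr_ge0// !mulr_ge0 ?gauss_norm_ge0 ?sqrtr_ge0.
have m1c : measurable_fun setT (cst 1 : Omega S -> R) by exact: measurable_cst.
apply: (le_trans (LnormD P ps1 m1c mS)).
rewrite Lnorm_cstP// normr1 EFinD leeD2l//.
apply: (le_trans (LnormD P ps1 mWn mDn)); rewrite !Lnorm_normr mulr2n mulrDl mul1r EFinD.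
apply: leeD; first exact: (wiener_norm u0 (le_trans (ltW ut) tT) ps0).
apply: (le_trans (wiener_incr_norm u0 ut ps0)); rewrite lee_fin ler_wpM2l ?gauss_norm_ge0//.
by rewrite ler_wsqrtr// lerBlDr (le_trans tT)// lerDl.
Qed.

Lemma incr_sqr_norm p u t : 1 <= p -> 0 <= u -> u < t ->
  ('N[P]_(p%:E)[EFin \o (fun w => (t - u) + (W t w - W u w) ^+ 2)%R] <=
   ((t - u) * (1 + gauss_norm (p * 2) ^+ 2))%:E)%E.
Proof.
move=> p1 u0 ut; have t0 := le_trans u0 (ltW ut).
have p0 : 0 < p by exact: lt_le_trans p1.
have h0 : 0 < t - u by rewrite subr_gt0.
have mD : measurable_fun setT (fun w => W t w - W u w) := measurable_wiener_incr u0 t0.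
have mc : measurable_fun setT (cst (t - u) : Omega S -> R) by exact: measurable_cst.
apply: (le_trans (LnormD P p1 mc (measurable_funX 2 mD))).
rewrite Lnorm_cstP// gtr0_norm// mulrDr mulr1 [leRHS]EFinD; apply: leeD => //.
have -> : (fun w => (W t w - W u w) ^+ 2) = (fun w => `|W t w - W u w| `^ 2).
  by apply/funext => w; rewrite powR_mulrn// real_normK ?num_real.
rewrite Lnorm_pow//; have := wiener_incr_norm u0 ut (mulr_gt0 p0 (ltr0Sn R 1)).
move=> h; apply: (@le_trans _ _ (((gauss_norm (p * 2) * Num.sqrt (t - u))%:E) `^ 2)%E).
  rewrite gt0_ler_poweR//; first by rewrite in_itv/= leey Lnorm_ge0.
  by rewrite in_itv/= leey andbT lee_fin mulr_ge0 ?gauss_norm_ge0 ?sqrtr_ge0.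
rewrite poweR_EFin lee_fin powR_mulrn ?mulr_ge0 ?gauss_norm_ge0 ?sqrtr_ge0//.
by rewrite exprMn sqr_sqrtr ?(ltW h0)// mulrC.
Qed.

End wiener_moments.

(** * Effect of the noise on the quadrature *)

Section noise.
Context {R : realType}.
Variables (T rho r q s L : R).
Hypotheses (T_gt0 : 0 < T) (r_ge2 : 2 <= r) (r_lt_q : r < q).
Hypotheses (s_ge0 : 0 <= s) (L_ge0 : 0 <= L).

(** The exponent p' with 1/q + 1/p' = 1/r, positive and finite because q > r: X is measured in L^q
    and the factors coming from W in L^p'. *)
Definition dual_exponent : R := (r^-1 - q^-1)^-1.

Let p' := dual_exponent.
Let CG := growth_const s (p' * 2) T.

(** The exponent p' is doubled once to separate the factor h + dW^2 from the growth factor, and once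
    more because the increment is squared. *)
Definition remainder_const : R := 1 + gauss_norm (p' * 2 * 2) ^+ 2.

(* The three terms bound the noise in X, the martingale part of the noise in W and its
   second-order remainder. *)
Definition noise_const : R :=
  mart_const T r * (1 + L) + mart_const T r * ((1 + 2 * L) * CG) +
  T * ((1 + 2 * L) * (remainder_const * CG)).

Let r0 : 0 < r. Proof. exact: lt_le_trans r_ge2. Qed.
Let r1 : 1 <= r. Proof. by apply: le_trans r_ge2; rewrite ler1n. Qed.
Let q0 : 0 < q. Proof. exact: lt_trans r_lt_q. Qed.
Let q1 : 1 <= q. Proof. exact: le_trans (ltW r_lt_q). Qed.
Let CG0 : 0 <= CG. Proof. exact: growth_const_ge0. Qed.
Let CQ0 : 0 <= remainder_const. Proof. by rewrite addr_ge0// sqr_ge0. Qed.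
Let L10 : 0 <= 1 + 2 * L. Proof. by rewrite addr_ge0// mulr_ge0. Qed.

Let p'V : p'^-1 = r^-1 - q^-1. Proof. by rewrite /p' /dual_exponent invrK. Qed.

Let p'0 : 0 < p'.
Proof. by rewrite -invr_gt0 p'V subr_gt0 ltf_pV2. Qed.

Let p'1 : 1 <= p'.
Proof.
rewrite -(invrK p') p'V invr_ge1 ?unitfE; last 2 first.
- by rewrite gt_eqF// subr_gt0 ltf_pV2.
- by rewrite subr_gt0 ltf_pV2.
have : r^-1 <= 1 by rewrite invf_le1.
have : 0 < q^-1 by rewrite invr_gt0.
lra.
Qed.

Let conj_exp : q^-1 + p'^-1 = r^-1.
Proof. by rewrite p'V addrC subrK. Qed.

Let p2' : 1 <= p' * 2.
Proof. by rewrite (le_trans p'1)// ler_peMr ?(ltW p'0)// ler1n. Qed.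

Lemma noise_const_ge0 : 0 <= noise_const.
Proof.
have m0 : 0 <= mart_const T r by exact: mart_const_ge0.
have T0 := ltW T_gt0.
apply: addr_ge0; first apply: addr_ge0.
- by apply: mulr_ge0 => //; exact: addr_ge0.
- by apply: mulr_ge0 => //; exact: mulr_ge0.
- by apply: mulr_ge0 => //; apply: mulr_ge0 => //; exact: mulr_ge0.
Qed.

Variable S : setting R.
Notation P := (Pr S).
Notation W := (wiener S).
Variable X : R -> Omega S -> R.
Hypothesis XF : integrands rho r q L T X.
Variables (n : nat) (delta : R) (X' W' : R -> Omega S -> R).
Hypotheses (n_gt0 : (0 < n)%N) (delta01 : 0 <= delta <= 1).
Hypotheses (X'P : noisy_integrands T X delta X') (W'P : noisy_wieners s T delta W').

(** The bound is free of n: two of the three error terms are martingale transforms, and the third is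
    a sum of n terms of size T/n each. Measurability of the disturbed quadrature comes along because
    Minkowski's inequality needs it later. *)
Lemma quad_noise :
  measurable_fun setT (quad T n X' W') /\
  ('N[P]_(r%:E)[EFin \o (quad T n X' W' \- quad T n X W)%R] <=
   (delta * noise_const)%:E)%E.
Proof.
have T0 := ltW T_gt0; have /andP[d0 d1] := delta01.
have [p [mp pB] X'E] := X'P; have [pW [pt [py [pyy [pC pWB]]]] W'E] := W'P.
pose g := grid T n.
have g_in i : (i <= n)%N -> 0 <= g i <= T by exact: grid_in.
have g_lt i : g i < g i.+1 by exact: grid_incr.
have g_ge0 i : 0 <= g i by exact: grid_ge0.
have mpt t : 0 <= t <= T -> measurable_fun setT (p t).
  move=> tT.
  have sub : (pair t : R -> R * R) @` setT `<=` `[0, T] `*` setT.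
    by move=> _ [w _ <-]; split.
  have mD : measurable (`[0, T] `*` setT : set (R * R)) by exact: measurableX.
  exact: (measurable_comp mD sub mp (pair1_measurable t)).
have mX i : (i <= n)%N -> measurable_fun setT (X (g i)).
  by move=> ni; exact: (measurable_integrand XF (g_in i ni)).
have aX i : (i <= n)%N -> adapted_at (g i) (X (g i)).
  by move=> ni; exact: (integrand_adapted XF (g_in i ni)).
have NX i : (i <= n)%N -> ('N[P]_(q%:E)[EFin \o X (g i)] <= L%:E)%E.
  by move=> ni; exact: (integrand_norm r_ge2 r_lt_q XF (g_in i ni)).
pose e1 i w := p (g i) (X (g i) w).
have ae1 i : (i <= n)%N -> adapted_at (g i) (e1 i).
  by move=> ni; exact: (measurableT_comp (mpt _ (g_in i ni)) (aX i ni)).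
have me1 i : (i <= n)%N -> measurable_fun setT (e1 i).
  by move=> ni; exact: adapted_measurable (g_ge0 i) (ae1 i ni).
have Ne1 i : (i <= n)%N -> ('N[P]_(q%:E)[EFin \o e1 i] <= (1 + L)%:E)%E.
  move=> ni; have mn : measurable_fun setT (fun w => `|X (g i) w|).
    by apply: measurableT_comp; [exact: normr_measurable|exact: mX].
  have m1 : measurable_fun setT (cst 1 : Omega S -> R) by exact: measurable_cst.
  apply: (@le_trans _ _ ('N[P]_(q%:E)[EFin \o (fun w => cst 1 w + `|X (g i) w|)%R])%E).
    apply: le_LnormEFin => // w; rewrite [leRHS]ger0_norm ?addr_ge0//.
    exact: pB (g_in i ni).
  apply: (le_trans (LnormD P q1 m1 mn)).
  rewrite Lnorm_cstP// normr1 Lnorm_normr EFinD; apply: leeD => //; exact: NX.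
pose x' i w := X (g i) w + delta * e1 i w.
have ax' i : (i <= n)%N -> adapted_at (g i) (x' i).
  move=> ni; apply: measurable_funD; first exact: aX.
  by apply: measurable_funM; [exact: measurable_cst|exact: ae1].
have mx' i : (i <= n)%N -> measurable_fun setT (x' i).
  by move=> ni; exact: adapted_measurable (g_ge0 i) (ax' i ni).
(* As delta <= 1, the disturbed integrand has norm at most L + (1 + L). *)
have Nx' i : (i <= n)%N -> ('N[P]_(q%:E)[EFin \o x' i] <= (1 + 2 * L)%:E)%E.
  move=> ni.
  have md : measurable_fun setT (fun w => delta * e1 i w).
    by apply: measurable_funM; [exact: measurable_cst|exact: me1].
  apply: (le_trans (LnormD P q1 (mX i ni) md)).
  rewrite (Lnorm_cst_mul P delta q0 (me1 i ni)).
  apply: (@le_trans _ _ (L%:E + (1 + L)%:E)%E).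
    apply: leeD; first exact: NX.
    apply: (@le_trans _ _ (1%:E * 'N[P]_(q%:E)[EFin \o e1 i])%E).
      by apply: lee_wpmul2r; [exact: Lnorm_ge0|rewrite lee_fin ger0_norm].
    by rewrite mul1e; exact: Ne1.
  by rewrite -EFinD lee_fin; lra.
pose D i w := W (g i.+1) w - W (g i) w.
have mD i : measurable_fun setT (D i) by exact: measurable_wiener_incr.
pose G i w := growth s (`|W (g i) w| + `|D i w|).
have mG i : measurable_fun setT (G i).
  apply: measurable_growth; apply: measurable_funD.
    by apply: measurableT_comp; [exact: normr_measurable|exact: measurable_wiener].
  by apply: measurableT_comp; [exact: normr_measurable|exact: mD].
have g_leT i : (i < n)%N -> g i.+1 <= T by move=> ni; have /andP[] := g_in i.+1 ni.
have NG i : (i < n)%N -> ('N[P]_((p' * 2)%:E)[EFin \o G i] <= CG%:E)%E.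
  by move=> ni; exact: (growth_norm S s_ge0 p2' (g_ge0 i) (g_lt i) (g_leT i ni)).
pose e2 i w := x' i w * py (g i) (W (g i) w).
have mpy i : (i <= n)%N -> adapted_at (g i) (fun w => py (g i) (W (g i) w)).
  move=> ni; exact: (measurableT_comp (measurable_disturbance_dy pC (g_in i ni)) (wiener_adapted (g_ge0 i))).
have ae2 i : (i <= n)%N -> adapted_at (g i) (e2 i).
  by move=> ni; apply: measurable_funM; [exact: ax'|exact: mpy].
have Ne2 i : (i < n)%N -> ('N[P]_(r%:E)[EFin \o e2 i] <= ((1 + 2 * L) * CG)%:E)%E.
  move=> ni; have ni' := ltnW ni.
  have mpy' := adapted_measurable (g_ge0 i) (mpy i ni').
  apply: (le_trans (Lnorm_mul P r0 q0 p'0 conj_exp (mx' i ni') mpy')).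
  rewrite [leRHS]EFinM; apply: lee_pmul; rewrite ?Lnorm_ge0//; first exact: Nx'.
  apply: (le_trans _ (NG i ni)).
  apply: (@le_trans _ _ ('N[P]_(p'%:E)[EFin \o G i])%E).
    apply: le_LnormEFin => // w; rewrite [leRHS]ger0_norm ?growth_ge0//.
    apply: (disturbance_dy_le s_ge0 pWB (g_in i ni')); by rewrite lerDl.
  apply: Lnorm_exponent_le => //; by rewrite ler_peMr ?(ltW p'0)// ler1n.
pose rem i w := pW (g i.+1) (W (g i.+1) w) - pW (g i) (W (g i) w) - py (g i) (W (g i) w) * D i w.
have mrem i : (i < n)%N -> measurable_fun setT (rem i).
  move=> ni; have ni' := ltnW ni.
  apply: measurable_funB; first apply: measurable_funB.
  - exact: (measurableT_comp (measurable_disturbance pC (g_in i.+1 ni)) (measurable_wiener (g_ge0 _))).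
  - exact: (measurableT_comp (measurable_disturbance pC (g_in i ni')) (measurable_wiener (g_ge0 _))).
  - apply: measurable_funM; last exact: mD.
    exact: adapted_measurable (g_ge0 i) (mpy i ni').
have Nrem i : (i < n)%N ->
    ('N[P]_(p'%:E)[EFin \o rem i] <= (T / n%:R * (remainder_const * CG))%:E)%E.
  move=> ni; have ni' := ltnW ni.
  pose Q w := (g i.+1 - g i) + D i w ^+ 2.
  have mQ : measurable_fun setT Q.
    by apply: measurable_funD; [exact: measurable_cst|exact: measurable_funX].
  apply: (@le_trans _ _ ('N[P]_(p'%:E)[EFin \o (fun w => Q w * G i w)%R])%E).
    apply: le_LnormEFin => // w; rewrite [leRHS]ger0_norm; last first.
      by rewrite mulr_ge0 ?growth_ge0// addr_ge0 ?sqr_ge0// subr_ge0 ltW.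
    exact: (disturbance_expansion s_ge0 pC pWB _ _ (g_ge0 i) (ltW (g_lt i)) (g_leT i ni)).
  have p20 : 0 < p' * 2 by rewrite mulr_gt0.
  have cj : (p' * 2)^-1 + (p' * 2)^-1 = p'^-1 by field; rewrite gt_eqF.
  apply: (le_trans (Lnorm_mul P p'0 p20 p20 cj mQ (mG i))).
  rewrite mulrA [leRHS]EFinM; apply: lee_pmul; rewrite ?Lnorm_ge0//; last exact: NG.
  apply: (le_trans (incr_sqr_norm S p2' (g_ge0 i) (g_lt i))).
  by rewrite /g grid_step.
pose A1 := mart g e1 n; pose A2 := mart g e2 n.
pose A3 w := \sum_(i < n) (x' i w * rem i w).
have mA1 : measurable_fun setT A1.
  apply: (@measurable_mart _ _ g n e1) => //.
  by move=> i ni; exact: ae1 (ltnW ni).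
have mA2 : measurable_fun setT A2.
  apply: (@measurable_mart _ _ g n e2) => //.
  by move=> i ni; exact: ae2 (ltnW ni).
have mxr i : (i < n)%N -> measurable_fun setT (fun w => x' i w * rem i w).
  by move=> ni; apply: measurable_funM; [exact: mx' (ltnW ni)|exact: mrem].
have mA3 : measurable_fun setT A3.
  by apply: measurable_sum => i; exact: mxr.
(* An exact identity: the disturbed value [x'] multiplies the noise in W, so the product of the two
   noises is contained in [A2] and [A3], and no term in delta^2 appears. *)
have quad_eq : quad T n X' W' = (fun w => quad T n X W w + delta * (A1 w + A2 w + A3 w)).
  apply/funext => w; rewrite /quad /riemann_maruyama /A1 /A2 /A3 /mart -!big_split/= mulr_sumr -big_split/=.
  apply: eq_bigr => i _; have ni := ltn_ord i; have ni' := ltnW ni.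
  rewrite (X'E _ w (g_in i ni')) (W'E _ w (g_in i.+1 ni)) (W'E _ w (g_in i ni')).
  by rewrite -/(g i) -/(g i.+1) /e2 /rem /x' /e1 /D; ring.
have mA := measurable_funD (measurable_funD mA1 mA2) mA3.
have mdA : measurable_fun setT (fun w => delta * (A1 w + A2 w + A3 w)).
  by apply: measurable_funM => //; exact: measurable_cst.
have mquad := measurable_quad T_gt0 XF n_gt0.
split; first by rewrite quad_eq; exact: measurable_funD.
have -> : (quad T n X' W' \- quad T n X W)%R = (fun w => delta * (A1 w + A2 w + A3 w)).
  by apply/funext => w; rewrite quad_eq /= addrAC subrr add0r.
rewrite (Lnorm_cst_mul P delta r0 mA) ger0_norm// [leRHS]EFinM.
apply: lee_wpmul2l; first by rewrite lee_fin.
apply: (le_trans (LnormD P r1 (measurable_funD mA1 mA2) mA3)).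
rewrite /noise_const [leRHS]EFinD; apply: leeD.
  apply: (le_trans (LnormD P r1 mA1 mA2)); rewrite [leRHS]EFinD; apply: leeD.
    apply: mart_norm => //.
    - by rewrite /g gridn.
    - by move=> i ni; exact: ae1 (ltnW ni).
    - exact: addr_ge0.
    - move=> i ni; have ni' := ltnW ni; apply: le_trans (Ne1 i ni').
      exact: (Lnorm_exponent_le P r0 (ltW r_lt_q) (me1 i ni')).
  apply: mart_norm => //.
  - by rewrite /g gridn.
  - by move=> i ni; exact: ae2 (ltnW ni).
  - exact: mulr_ge0.
have Nxr i : (i < n)%N -> ('N[P]_(r%:E)[EFin \o (fun w => x' i w * rem i w)%R] <=
    ((1 + 2 * L) * (T / n%:R * (remainder_const * CG)))%:E)%E.
  move=> ni; have ni' := ltnW ni.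
  apply: (le_trans (Lnorm_mul P r0 q0 p'0 conj_exp (mx' i ni') (mrem i ni))).
  by rewrite [leRHS]EFinM; apply: lee_pmul; rewrite ?Lnorm_ge0//; [exact: Nx'|exact: Nrem].
apply: (le_trans (Lnorm_sum_le r1 mxr Nxr)); rewrite lee_fin le_eqVlt; apply/orP; left.
by apply/eqP; field; rewrite pnatr_eq0 -lt0n.
Qed.

End noise.

(** * Lower bounds *)

Section lower_bound.
Context {R : realType}.
Variables (rho r q s L T : R).
Hypotheses (rho_gt0 : 0 < rho) (rho_le1 : rho <= 1) (r_ge2 : 2 <= r) (r_lt_q : r < q).
Hypotheses (s_ge0 : 0 <= s) (L_gt0 : 0 < L) (T_gt0 : 0 < T).
Notation mu := (@lebesgue_measure R).

Let r0 : 0 < r. Proof. exact: lt_le_trans r_ge2. Qed.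
Let r1 : 1 <= r. Proof. by apply: le_trans r_ge2; rewrite ler1n. Qed.
Let q0 : 0 < q. Proof. exact: lt_trans r_lt_q. Qed.
Let T_ge0 : 0 <= T := ltW T_gt0.
Let L_ge0 : 0 <= L := ltW L_gt0.

Lemma K1_cst c : `|c| <= 1 -> K1 T (fun _ _ => c).
Proof.
move=> c1; split; first exact: measurable_cst.
by move=> t y _; rewrite (le_trans c1)// lerDl.
Qed.

Lemma K2_0 : K2 s T (fun _ _ => 0).
Proof.
exists (fun _ _ => 0), (fun _ _ => 0), (fun _ _ => 0); split; last first.
  move=> t y _; rewrite normr0; have : 0 <= 1 + abspow s y; last by [].
  by rewrite addr_ge0// /abspow; case: ifP => // _; exact: powR_ge0.
split.
- move=> t y _; under eq_fun do rewrite subrr mul0r; exact: cvg_cst.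
- by move=> t y _; exact: is_derive_cst.
- by move=> t y _; exact: is_derive_cst.
- by move=> f [] ->; apply: continuous_subspaceT => z; exact: cvg_cst.
Qed.

Lemma noisy_wieners_self (S : setting R) delta : noisy_wieners s T delta (wiener S).
Proof. by exists (fun _ _ => 0); [exact: K2_0|move=> t w _; rewrite mulr0 addr0]. Qed.

Lemma deterministic_integrand (S : setting R) (f : R -> R) : measurable_fun setT f ->
  (forall t, 0 <= t <= T -> `|f t| <= L) ->
  (forall t z, 0 <= t <= T -> 0 <= z <= T -> `|f t - f z| <= L * `|t - z| `^ rho) ->
  integrands rho r q L T (fun t (_ : Omega S) => f t).
Proof.
move=> mf fL fh; split.
- move=> t _; apply: (measurable_funS measurableT) => //.
  exact: (measurableT_comp mf measurable_fst).
- apply: (@le_trans _ _ ('N[Pr S]_(q%:E)[EFin \o cst L])%E); last first.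
    by rewrite Lnorm_cstP// ger0_norm.
  apply: le_Lnorm => // w; rewrite /= (ger0_norm L_ge0) gee0_abs.
    by apply: ge_ereal_sup => y [t /=]; rewrite in_itv/= => tT <-; rewrite lee_fin fL.
  apply: (@le_trans _ _ (`|f 0|)%:E); first by rewrite lee_fin.
  by apply: ereal_sup_ubound; exists 0 => //=; rewrite in_itv/= lexx.
- move=> t z tT zT; rewrite /rnorm.
  rewrite (_ : (fun _ => f t) \- (fun _ => f z) = cst (f t - f z))//.
  by rewrite Lnorm_cstP// lee_fin fh.
Qed.

Section fooling.
Variables (S : setting R) (a : algorithm T) (delta delta2 : R).
Variables (X1 X2 X1' X2' : R -> Omega S -> R).
Notation P := (Pr S).
Hypotheses (F1 : integrands rho r q L T X1) (F2 : integrands rho r q L T X2).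
Hypotheses (N1 : noisy_integrands T X1 delta X1') (N2 : noisy_integrands T X2 delta X2').
Hypothesis same_info : forall j w, X1' (xpt a j) w = X2' (xpt a j) w.
Hypothesis mX1' : forall j, measurable_fun setT (X1' (xpt a j)).

(** The Wiener path is left undisturbed, which is allowed at every delta2, so the cases delta2 = 0
    and delta2 = delta are covered together. The output A is the same for both integrands and
    cancels in the difference of the errors; r >= 2 lets the L^2 norm of the isometry be bounded by
    the L^r norm. *)
Lemma fooling_lower_bound :
  ((Num.sqrt kappa)%:E * norm2 T (fun t w => X1 t w - X2 t w)%R <=
  2%:E * error rho r q s L T S (run a) delta delta2)%E.
Proof.
pose A w := run a (X1' ^~ w) (wiener S ^~ w).
have AE w : run a (X2' ^~ w) (wiener S ^~ w) = A w.
  rewrite /A /run; congr (phi a _); apply/val_inj => /=; congr (_ ++ _).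
  by apply: eq_map => j; rewrite same_info.
pose info w : (i1 a + i2 a).-tuple R :=
  [tuple of [tuple X1' (xpt a j) w | j < i1 a] ++ [tuple wiener S (wpt a j) w | j < i2 a]].
have minfo : measurable_fun setT info.
  apply/measurable_fun_tnthP => i.
  have [j ij|j ij] := split_ordP i.
    rewrite (_ : _ \o _ = X1' (xpt a j)); first exact: mX1'.
    by apply/funext => w; rewrite /info/= ij tnth_lshift tnth_mktuple.
  rewrite (_ : _ \o _ = wiener S (wpt a j)).
    by apply: measurable_wiener; have /andP[] := wpt_in j.
  by apply/funext => w; rewrite /info/= ij tnth_rshift tnth_mktuple.
have mA : measurable_fun setT A := measurableT_comp (@phi_meas _ _ a) minfo.
have i1 := ito_integralP T_gt0 rho_gt0 r_ge2 r_lt_q L_ge0 F1.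
have i2 := ito_integralP T_gt0 rho_gt0 r_ge2 r_lt_q L_ge0 F2.
apply: (le_trans (ito_dist_ge i1 i2 (integrand_jmeas T_gt0 F1) (integrand_jmeas T_gt0 F2))).
have m1 := i1.1; have m2 := i2.1.
apply: (le_trans (Lnorm_exponent_le P _ r_ge2 (measurable_funB m1 m2))) => //.
set e := error _ _ _ _ _ _ _ _ _ _.
have e1 : ('N[P]_(r%:E)[EFin \o (fun w => ito_integral T X1 w - A w)%R] <= e)%E.
  apply: ereal_sup_ubound; exists X1, X1', (wiener S); split => //.
  exact: noisy_wieners_self.
have e2 : ('N[P]_(r%:E)[EFin \o (fun w => ito_integral T X2 w - A w)%R] <= e)%E.
  apply: ereal_sup_ubound; exists X2, X2', (wiener S); split => //.
    exact: noisy_wieners_self.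
  by congr rnorm; apply/funext => w; rewrite AE.
have -> : (2%:E * e = e + e)%E by rewrite mule_natl mule2n.
apply: (le_trans _ (leeD e1 e2)).
apply: (le_trans _ (LnormB P r1 (measurable_funB m1 mA) (measurable_funB m2 mA))).
rewrite le_eqVlt; apply/orP; left; apply/eqP; apply: eq_Lnorm => w.
rewrite /=; congr (_%:E).
by rewrite opprB addrA subrK.
Qed.

End fooling.

Lemma norm2_ge (S : setting R) (f : R -> Omega S -> R) (c : R) : jmeas T f -> 0 <= c ->
  ((c ^+ 2)%:E <= dist2 T f)%E -> (c%:E <= norm2 T f)%E.
Proof.
move=> mf c0; rewrite dist2E//; have := norm2_ge0 T f.
move: (norm2 T f) => [x|_ _|]//; last by rewrite leey.
rewrite !lee_fin => x0 h; rewrite -(ler_pXn2r (ltn0Sn 1)) ?nnegrE//.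
by rewrite -(powR_mulrn 2 x0).
Qed.

Lemma dist2_deterministic (S : setting R) (f : R -> R) :
  dist2 T (fun t (_ : Omega S) => f t) = (\int[mu]_(t in `[0%R, T]) ((f t) ^+ 2)%:E)%E.
Proof.
rewrite /dist2; set I := (\int[mu]_(t in _) _)%E.
by rewrite -[RHS]mule1 -(probability_setT (Pr S)); exact: (integral_cst (Pr S) measurableT I).
Qed.

Lemma lower_bound_noise (S : setting R) (a : algorithm T) (delta delta2 : R) :
  0 <= delta -> delta <= L ->
  ((Num.sqrt kappa * Num.sqrt T * delta)%:E <=
   error rho r q s L T S (run a) delta delta2)%E.
Proof.
move=> d0 dL.
have cF c : `|c| <= L -> integrands rho r q L T (fun _ (_ : Omega S) => c).
  move=> cL; apply: deterministic_integrand => //.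
  by move=> t z _ _; rewrite subrr normr0 mulr_ge0// powR_ge0.
have F1 := cF delta; have F2 := cF (- delta).
rewrite ger0_norm// in F1; rewrite normrN ger0_norm// in F2.
have {}F1 := F1 dL; have {}F2 := F2 dL.
have N1 : noisy_integrands T (fun _ (_ : Omega S) => delta) delta (fun _ _ => 0).
  exists (fun _ _ => -1); first by apply: K1_cst; rewrite normrN normr1.
  by move=> t w _; rewrite mulrN1 subrr.
have N2 : noisy_integrands T (fun _ (_ : Omega S) => - delta) delta (fun _ _ => 0).
  exists (fun _ _ => 1); first by apply: K1_cst; rewrite normr1.
  by move=> t w _; rewrite mulr1 addNr.
have := @fooling_lower_bound S a delta delta2 _ _ _ _ F1 F2 N1 N2 (fun _ _ => erefl)
  (fun _ => measurable_cst _).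
have jm : jmeas T (fun _ (_ : Omega S) => delta - - delta).
  exact: jmeasB (integrand_jmeas T_gt0 F1) (integrand_jmeas T_gt0 F2).
have : ((2 * (Num.sqrt T * delta))%:E <= norm2 T (fun _ (_ : Omega S) => delta - - delta)%R)%E.
  apply: norm2_ge => //; first by rewrite mulr_ge0// mulr_ge0// sqrtr_ge0.
  have muT : mu `[0%R, T]%classic = T%:E.
    by rewrite lebesgue_measure_itv/= lte_fin T_gt0 oppr0 adde0.
  have -> : dist2 T (fun _ (_ : Omega S) => delta - - delta)%R =
      (((delta - - delta) ^+ 2)%:E * T%:E)%E.
    rewrite dist2_deterministic -muT.
    exact: (integral_cst mu (measurable_itv `[0%R, T]) ((delta - - delta) ^+ 2)%:E).
  rewrite -EFinM lee_fin.
  rewrite le_eqVlt; apply/orP; left; apply/eqP.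
  by rewrite exprMn exprMn sqr_sqrtr//; ring.
have k0 : (0 <= (Num.sqrt kappa)%:E :> \bar R)%E by rewrite lee_fin sqrtr_ge0.
move=> /(lee_wpmul2l k0) h1 h2; have := le_trans h1 h2.
rewrite -EFinM; move: (error _ _ _ _ _ _ _ _ _ _) => [x||].
- rewrite -EFinM !lee_fin => h; rewrite -(ler_pM2l (ltr0Sn R 1)) (le_trans _ h)//.
  by rewrite le_eqVlt; apply/orP; left; apply/eqP; ring.
- by rewrite leey.
- by rewrite gt0_muleNy// ?lte_fin// leeNy_eq.
Qed.

(** A ratio z / (x + y) in [0, 1] is at most its power of exponent rho <= 1; for z = x and z = y the
    ratios add up to 1. *)
Lemma powR_subadditive (x y : R) : 0 <= x -> 0 <= y -> (x + y) `^ rho <= x `^ rho + y `^ rho.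
Proof.
move=> x0 y0; have [xy0|xy0] := eqVneq (x + y) 0.
  by rewrite xy0 powR0 ?gt_eqF// addr_ge0// powR_ge0.
have xy : 0 < x + y by rewrite lt_neqAle eq_sym xy0 addr_ge0.
have h z : 0 <= z -> z <= x + y -> z / (x + y) * (x + y) `^ rho <= z `^ rho.
  move=> z0 zxy; have [->|zn0] := eqVneq z 0; first by rewrite !mul0r powR_ge0.
  have zp : 0 < z by rewrite lt_neqAle eq_sym zn0.
  have -> : z `^ rho = (z / (x + y)) `^ rho * (x + y) `^ rho.
    have zq : 0 <= z / (x + y) by rewrite divr_ge0// ltW.
    by rewrite -(powRM _ zq (ltW xy)) divfK.
  rewrite ler_wpM2r ?powR_ge0// ger1_powR// divr_gt0//=.
  by rewrite ler_pdivrMr// mul1r.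
have hx := h x x0; rewrite lerDl in hx; have hy := h y y0; rewrite lerDr in hy.
apply: (le_trans _ (lerD (hx y0) (hy x0))).
by rewrite -mulrDl -mulrDl mulfV// mul1r.
Qed.

Lemma powR_holder (x y : R) : 0 <= x -> 0 <= y -> `|x `^ rho - y `^ rho| <= `|x - y| `^ rho.
Proof.
wlog xy : x y / y <= x.
  move=> h x0 y0; have [yx|/ltW xy] := leP y x; first exact: h.
  by rewrite distrC (distrC x); exact: h.
move=> x0 y0; rewrite ger0_norm; last first.
  by rewrite subr_ge0 ge0_ler_powR ?nnegrE// ltW.
rewrite ger0_norm ?subr_ge0// lerBlDr -{1}(subrK y x).
by rewrite powR_subadditive// subr_ge0.
Qed.

(** * Distance to the nodes *)

Section bump.
Variables (m : nat) (x : 'I_m -> R).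

Definition dist_nodes t : R := \big[Num.min/T]_(j < m) `|t - x j|.

Lemma dist_nodes_ge0 t : 0 <= dist_nodes t.
Proof. by apply: (big_ind (fun z => 0 <= z)) => // u v u0 v0; rewrite le_min u0. Qed.

Lemma dist_nodes_leT t : dist_nodes t <= T.
Proof. exact: bigmin_le_id. Qed.

Lemma dist_nodes_le t j : dist_nodes t <= `|t - x j|.
Proof. exact: bigmin_le. Qed.

Lemma dist_nodes0 j : dist_nodes (x j) = 0.
Proof.
apply/eqP; rewrite eq_le dist_nodes_ge0 andbT (le_trans (dist_nodes_le _ j))//.
by rewrite subrr normr0.
Qed.

Lemma dist_nodes_lip t z : `|dist_nodes t - dist_nodes z| <= `|t - z|.
Proof.
have h u v : dist_nodes u <= dist_nodes v + `|u - v|.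
  rewrite -lerBlDr; apply: le_bigmin => [|j _].
    by rewrite lerBlDr (le_trans (dist_nodes_leT u))// lerDl.
  rewrite lerBlDr (le_trans (dist_nodes_le u j))// [leRHS]addrC.
  exact: ler_distD.
rewrite ler_norml; have := h t z; have := h z t; rewrite (distrC z); lra.
Qed.

Lemma measurable_dist_nodes : measurable_fun setT dist_nodes.
Proof.
apply: continuous_measurable_fun => t; apply/cvgrPdist_lt => e e0.
near=> z; rewrite (le_lt_trans (dist_nodes_lip _ _))//.
Unshelve. all: by end_near. Qed.

(** The intervals of radius eta about the nodes have total length at most T/2, and off them the
    distance is at least eta. *)
Lemma dist_nodes_integral (eta : R) : 0 < eta -> eta <= T -> m%:R * (2 * eta) <= T / 2 ->
  ((eta `^ (rho * 2) * (T / 2))%:E <=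
   \int[mu]_(t in `[0%R, T]) ((dist_nodes t `^ rho) ^+ 2)%:E)%E.
Proof.
move=> eta0 etaT hm; set I := (\int[mu]_(t in _) _)%E.
set K := eta `^ (rho * 2).
have K0 : 0 <= K by exact: powR_ge0.
pose B j : set R := `]x j - eta, x j + eta[%classic.
have mB j : measurable (B j) by exact: measurable_itv.
have mI : measurable (`[0%R, T] : set R) by exact: measurable_itv.
have mi (A : set R) : measurable A -> measurable_fun setT (fun t : R => (\1_A t)%:E : \bar R).
  by move=> mA; apply/measurable_EFinP; exact: measurable_indic.
have mf : measurable_fun setT (fun t => ((dist_nodes t `^ rho) ^+ 2)%:E : \bar R).
  apply/measurable_EFinP; apply: measurable_funX.
  exact: (measurableT_comp (measurable_powR rho) measurable_dist_nodes).
(* Adding K on each interval [B j] to the integrand gives a function that is at least K on all of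
   [0, T]; integrating it avoids measuring the complement of a union. *)
have key : ((K * T)%:E <= I + (\sum_(j < m) (K * (2 * eta)))%:E)%E.
  pose F t := (((dist_nodes t `^ rho) ^+ 2)%:E * (\1_`[0%R, T] t)%:E : \bar R)%E.
  pose Gj t := (\sum_(j < m) (K%:E * (\1_(B j) t)%:E) : \bar R)%E.
  have F0 t : (0 <= F t)%E by rewrite mule_ge0// lee_fin ?sqr_ge0.
  have G0 t : (0 <= Gj t)%E by apply: sume_ge0 => j _; rewrite mule_ge0// lee_fin.
  have mF : measurable_fun setT F by apply: emeasurable_funM => //; exact: mi.
  have mK j : measurable_fun setT (fun t : R => K%:E * (\1_(B j) t)%:E : \bar R)%E.
    by apply: emeasurable_funM => //; exact: mi.
  have mG : measurable_fun setT Gj by apply: emeasurable_sum => j; exact: mK.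
  have IE : I = (\int[mu]_t F t)%E.
    rewrite /I integral_mkcond; apply: eq_integral => t _.
    rewrite /F patchE indicE; case: ifPn => _; first by rewrite mule1.
    by rewrite mule0.
  have GE : ((\sum_(j < m) (K * (2 * eta)))%:E = \int[mu]_t Gj t)%E.
    rewrite ge0_integral_sum//; last by move=> j t _; rewrite mule_ge0// lee_fin.
    rewrite -sumEFin; apply: eq_bigr => j _.
    rewrite (ge0_integralZl mu measurableT (mi _ (mB j)))//.
    rewrite integral_indic//=; last exact: mB.
    rewrite ?setIT /B lebesgue_measure_itv/= lte_fin.
    rewrite ltrD2l gt0_cp// -EFinB -EFinM; congr (_%:E); congr (_ * _); ring.
  have TE : ((K * T)%:E = \int[mu]_t (K%:E * (\1_`[0%R, T] t)%:E))%E.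
    rewrite (ge0_integralZl mu measurableT (mi _ mI))//.
    rewrite integral_indic//= ?setIT lebesgue_measure_itv/= lte_fin T_gt0.
    by rewrite oppr0 adde0 -EFinM.
  rewrite IE GE TE -(ge0_integralD mu measurableT (fun t _ => F0 t) mF (fun t _ => G0 t) mG).
  apply: ge0_le_integralT => t; first by rewrite mule_ge0// lee_fin.
  rewrite /F indicE; have [tT|tT] := boolP (t \in _); last first.
    by rewrite !mule0 add0e.
  rewrite !mule1; have [dt|dt] := leP eta (dist_nodes t).
    rewrite (le_trans _ (leeDl _ (G0 t)))// lee_fin /K powRrM powR_mulrn ?powR_ge0//.
    rewrite lerXn2r ?nnegrE ?powR_ge0// ge0_ler_powR ?nnegrE ?dist_nodes_ge0 ?(ltW rho_gt0) ?(ltW eta0)//.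
  have [j jt] : exists j, `|t - x j| < eta.
    have : [exists j, `|t - x j| < eta].
      apply: contraT; rewrite negb_exists => /forallP h; move: dt; rewrite ltNge => /negP[].
      by apply: le_bigmin => [//|j _]; rewrite leNgt h.
    by case/existsP => j; exists j.
  rewrite (le_trans _ (leeDr _ _))//; last by rewrite lee_fin sqr_ge0.
  rewrite /Gj (bigD1 j)//= (le_trans _ (leeDl _ _))//; last first.
    by apply: sume_ge0 => i _; rewrite mule_ge0// lee_fin.
  rewrite indicE mem_set ?mule1// /B/= in_itv/=.
  by move: jt; rewrite ltr_norml; lra.
have : (0 <= I)%E by apply: integral_ge0 => t _; rewrite lee_fin sqr_ge0.
clearbody I; case: I key => [i|_ _|]//; last by rewrite leey.
move=> +; rewrite -EFinD !lee_fin sumr_const card_ord -mulr_natl => h i0.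
have : K * (m%:R * (2 * eta)) <= K * (T / 2) by rewrite ler_wpM2l.
lra.
Qed.

End bump.

Lemma lower_bound_rate (S : setting R) (a : algorithm T) n (delta delta2 : R) :
  (0 < n)%N -> (i1 a <= n)%N ->
  ((Num.sqrt kappa * (L / (1 + T `^ rho)) * (T / 4) `^ rho * Num.sqrt (T / 2) *
     n%:R `^ (- rho))%:E <=
   error rho r q s L T S (run a) delta delta2)%E.
Proof.
(* This c meets both constraints of the class: c <= L for the Hoelder constant and c T^rho <= L for
   the supremum. *)
move=> n0 an; set c := L / (1 + T `^ rho).
have D0 : 0 < 1 + T `^ rho by rewrite ltr_pwDl// powR_ge0.
have c0 : 0 <= c by rewrite divr_ge0// ltW.
have cL : c <= L by rewrite ler_pdivrMr// ler_peMr// lerDl powR_ge0.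
have cTL : c * T `^ rho <= L.
  by rewrite mulrAC ler_pdivrMr// ler_wpM2l// lerDr.
pose d := dist_nodes (xpt a).
pose f t := c * d t `^ rho.
have mf : measurable_fun setT f.
  apply: measurable_funM => //.
  exact: (measurableT_comp (measurable_powR rho) (measurable_dist_nodes (xpt a))).
have f0 t : 0 <= f t by rewrite mulr_ge0// powR_ge0.
have fF (sg : R) : `|sg| = 1 -> integrands rho r q L T (fun t (_ : Omega S) => sg * f t).
  move=> sg1; apply: deterministic_integrand.
  - exact: measurable_funM.
  - move=> t _; rewrite normrM sg1 mul1r ger0_norm// (le_trans _ cTL)// ler_wpM2l//.
    by rewrite ge0_ler_powR ?nnegrE ?(ltW rho_gt0)// ?dist_nodes_ge0 ?dist_nodes_leT.
  - move=> t z _ _; rewrite -mulrBr normrM sg1 mul1r -mulrBr normrM ger0_norm//.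
    apply: ler_pM => //; apply: (le_trans (powR_holder _ _)); rewrite ?dist_nodes_ge0//.
    by rewrite ge0_ler_powR ?nnegrE ?(ltW rho_gt0)// dist_nodes_lip.
have F1 := fF 1 (normr1 R); have F2 := fF (-1) (etrans (normrN 1) (normr1 R)).
have self (X : R -> Omega S -> R) : noisy_integrands T X delta X.
  by exists (fun _ _ => 0); [apply: K1_cst; rewrite normr0|move=> t w _; rewrite mulr0 addr0].
have same j (w : Omega S) : 1 * f (xpt a j) = -1 * f (xpt a j).
  by rewrite /f /d dist_nodes0 powR0 ?gt_eqF// !mulr0.
have := @fooling_lower_bound S a delta delta2 _ _ _ _ F1 F2 (self _) (self _) same
  (fun _ => measurable_cst _).
have jm : jmeas T (fun t (_ : Omega S) => 1 * f t - -1 * f t).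
  exact: jmeasB (integrand_jmeas T_gt0 F1) (integrand_jmeas T_gt0 F2).
(* At most n nodes with intervals of length 2 eta cover at most n * 2 eta = T/2. *)
pose eta := T / 4 / n%:R.
have nR : 0 < n%:R :> R by rewrite ltr0n.
have eta0 : 0 < eta by rewrite !divr_gt0.
have etaT : eta <= T.
  rewrite /eta -mulrA ler_piMr// -invfM invf_le1 ?mulr_gt0//.
  by rewrite -natrM ler1n muln_gt0 n0.
have am : (i1 a)%:R * (2 * eta) <= T / 2.
  apply: (@le_trans _ _ (n%:R * (2 * eta))).
    by rewrite ler_wpM2r ?mulr_ge0 ?(ltW eta0)// ler_nat.
  by rewrite le_eqVlt; apply/orP; left; apply/eqP; rewrite /eta; field; rewrite gt_eqF.
have : ((2 * (c * eta `^ rho * Num.sqrt (T / 2)))%:E <= norm2 T (fun t (_ : Omega S) => 1 * f t - -1 * f t)%R)%E.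
  apply: norm2_ge => //.
    apply: mulr_ge0 => //; apply: mulr_ge0; last exact: sqrtr_ge0.
    by apply: mulr_ge0 => //; exact: powR_ge0.
  rewrite dist2_deterministic.
  have -> : (\int[mu]_(t in `[0%R, T]) ((1 * f t - -1 * f t) ^+ 2)%:E =
     \int[mu]_(t in `[0%R, T]) ((4 * c ^+ 2)%:E * ((d t `^ rho) ^+ 2)%:E))%E.
    by apply: eq_integral => t _; rewrite -EFinM; congr (_%:E); rewrite /f; ring.
  have mh : measurable_fun `[0%R, T]%classic (fun t => ((d t `^ rho) ^+ 2)%:E : \bar R).
    apply: measurable_funTS; apply/measurable_EFinP; apply: measurable_funX.
    exact: (measurableT_comp (measurable_powR rho) (measurable_dist_nodes (xpt a))).
  have c4 : (0 <= (4 * c ^+ 2)%:E)%E by rewrite lee_fin mulr_ge0// sqr_ge0.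
  rewrite (ge0_integralZl mu (measurable_itv _) mh) => [|t _|//]; last first.
    by rewrite lee_fin sqr_ge0.
  apply: (@le_trans _ _ ((4 * c ^+ 2)%:E * (eta `^ (rho * 2) * (T / 2))%:E)%E).
    rewrite -EFinM lee_fin le_eqVlt; apply/orP; left; apply/eqP.
    rewrite powRrM powR_mulrn ?powR_ge0// !exprMn sqr_sqrtr; last by rewrite divr_ge0.
    ring.
  apply: lee_wpmul2l; first by rewrite lee_fin mulr_ge0// sqr_ge0.
  exact: (dist_nodes_integral (xpt a) eta0 etaT am).
have k0 : (0 <= (Num.sqrt kappa)%:E :> \bar R)%E by rewrite lee_fin sqrtr_ge0.
move=> /(lee_wpmul2l k0) h1 h2; have := le_trans h1 h2.
have etaE : eta `^ rho = (T / 4) `^ rho * n%:R `^ (- rho).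
  by rewrite /eta powRM ?divr_ge0 ?invr_ge0// -(powR_inv1 (ltW nR)) -powRrM mulN1r.
rewrite -EFinM etaE; move: (error _ _ _ _ _ _ _ _ _ _) => [z||].
- rewrite -EFinM !lee_fin => h; rewrite -(ler_pM2l (ltr0Sn R 1)) (le_trans _ h)//.
  by rewrite le_eqVlt; apply/orP; left; apply/eqP; ring.
- by rewrite leey.
- by rewrite gt0_muleNy// ?lte_fin// leeNy_eq.
Qed.

End lower_bound.

(** * Rates *)

Section rates.
Context {R : realType}.
Variables (rho r q s L T : R).
Hypotheses (rho_gt0 : 0 < rho) (r_ge2 : 2 <= r) (r_lt_q : r < q).
Hypotheses (s_ge0 : 0 <= s) (L_ge0 : 0 <= L) (T_gt0 : 0 < T).

Definition rate (n : nat) (delta : R) : R := n%:R `^ (- rho) + delta.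

(** Converts between the number of cells of the quadrature and its information cost, which differ by
    a bounded factor. *)
Lemma powRN_scale (m n k : nat) : (0 < m)%N -> (0 < n)%N -> (n <= k * m)%N ->
  m%:R `^ (- rho) <= k%:R `^ rho * n%:R `^ (- rho) :> R.
Proof.
move=> m0 n0 nkm; have mR : 0 < m%:R :> R by rewrite ltr0n.
have nR : 0 < n%:R :> R by rewrite ltr0n.
rewrite !powRN ler_pdivlMr ?powR_gt0// mulrC ler_pdivrMr ?powR_gt0//.
rewrite -powRM// ge0_ler_powR ?nnegrE ?mulr_ge0 ?(ltW rho_gt0)//.
by rewrite -natrM ler_nat.
Qed.

(** The zero disturbance belongs to [K2], so the exact Wiener path is admissible at every noise
    level; upper bounds need only be proved with noise in W. *)
Lemma error_le_disturbed (S : setting R) A delta delta2 :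
  (error rho r q s L T S A delta 0 <= error rho r q s L T S A delta delta2)%E.
Proof.
apply: ge_ereal_sup => e [X [X' [W' [XF X'P [p [pt [py [pyy _]]] W'E] ->]]]].
apply: ereal_sup_ubound; exists X, X', W'; split => //.
exists (fun _ _ => 0); first exact: K2_0.
by move=> t w tT; rewrite W'E// mul0r mulr0.
Qed.

Definition upper_const : R := mart_const T r * L * T `^ rho + noise_const T r q s L + 1.

Lemma upper_const_gt0 : 0 < upper_const.
Proof.
rewrite ltr_wpDl// addr_ge0 ?noise_const_ge0//.
by apply: mulr_ge0; [apply: mulr_ge0 => //; exact: mart_const_ge0|exact: powR_ge0].
Qed.

Lemma riemann_maruyama_error (S : setting R) n delta : (0 < n)%N -> 0 <= delta <= 1 ->
  (error rho r q s L T S (riemann_maruyama T n) delta delta <=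
   (upper_const * rate n delta)%:E)%E.
Proof.
move=> n0 /[dup] d01 /andP[d0 _].
apply: ge_ereal_sup => e [X [X' [W' [XF X'P W'P ->]]]].
have [mq' hq'] := quad_noise T_gt0 r_ge2 r_lt_q s_ge0 L_ge0 XF n0 d01 X'P W'P.
have hq := ito_quad_rate T_gt0 rho_gt0 r_ge2 r_lt_q L_ge0 XF n0.
have mI := (ito_integralP T_gt0 rho_gt0 r_ge2 r_lt_q L_ge0 XF).1.
have mq := measurable_quad T_gt0 XF n0.
have r1 : 1 <= r by apply: le_trans r_ge2; rewrite ler1n.
apply: (@le_trans _ _ ('N[Pr S]_(r%:E)[EFin \o (ito_integral T X \- quad T n X (wiener S))%R]
   + 'N[Pr S]_(r%:E)[EFin \o (quad T n X' W' \- quad T n X (wiener S))%R])%E).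
  apply: (le_trans _ (LnormB (Pr S) r1 (measurable_funB mI mq) (measurable_funB mq' mq))).
  rewrite le_eqVlt; apply/orP; left; apply/eqP; apply: eq_Lnorm => w.
  by rewrite /= opprB addrA subrK.
apply: (le_trans (leeD hq hq')); rewrite -EFinD lee_fin.
have nR : 0 < n%:R :> R by rewrite ltr0n.
have Tn : (T / n%:R) `^ rho = T `^ rho * n%:R `^ (- rho).
  by rewrite powRM ?(ltW T_gt0) ?invr_ge0 ?(ltW nR)// -(powR_inv1 (ltW nR)) -powRrM mulN1r.
rewrite Tn /rate /upper_const; set x := n%:R `^ _; have x0 : 0 <= x by exact: powR_ge0.
have a0 : 0 <= mart_const T r * L * T `^ rho.
  by apply: mulr_ge0; [apply: mulr_ge0 => //; exact: mart_const_ge0|exact: powR_ge0].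
have b0 := noise_const_ge0 r q s T_gt0 L_ge0.
rewrite !mulrA; move: (_ * _ * _) (noise_const _ _ _ _ _) a0 b0 => a b a0 b0.
have := mulr_ge0 a0 d0; have := mulr_ge0 b0 x0; nra.
Qed.

(** With m cells the quadrature uses 2m + 1 evaluations, so m = n.-1./2 is the largest number
    affordable with n. *)
Lemma minimal_error_upper (S : setting R) n delta delta2 : (3 <= n)%N ->
  (minimal_error rho r q s L T S n delta delta2 <=
   error rho r q s L T S (riemann_maruyama T n.-1./2) delta delta2)%E.
Proof.
move=> n3; apply: ereal_inf_lbound; exists (riemann_maruyama T n.-1./2) => //.
have m0 : (0 < n.-1./2)%N by clear -n3; lia.
have [a ale ->] := riemann_maruyama_Phi T_gt0 m0.
by exists a => //; apply: leq_trans ale _; clear -n3; lia.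
Qed.

Lemma bigO_riemann_maruyama :
  bigO_unif (fun S n delta => error rho r q s L T S (riemann_maruyama T n) delta delta) rate.
Proof.
exists upper_const, 1, 1%N; split=> // [|S n delta n0 d01]; first exact: upper_const_gt0.
exact: riemann_maruyama_error.
Qed.

Lemma bigO_minimal_error :
  bigO_unif (fun S n delta => minimal_error rho r q s L T S n delta delta) rate.
Proof.
have f0 : 0 < 1 + 4%:R `^ rho :> R by rewrite ltr_pwDl// powR_ge0.
exists (upper_const * (1 + 4%:R `^ rho)), 1, 3%N.
split=> // [|S n delta n3 d01]; first by rewrite mulr_gt0// upper_const_gt0.
have m0 : (0 < n.-1./2)%N by clear -n3; lia.
apply: (le_trans (minimal_error_upper S delta delta n3)).
apply: (le_trans (riemann_maruyama_error S m0 d01)); rewrite lee_fin -mulrA.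
rewrite (ler_pM2l upper_const_gt0).
(* The factor 4 covers both the cost of two evaluations per cell and the rounding; equality holds at
   n = 4. *)
have n4 : (n <= 4 * n.-1./2)%N by clear -n3; lia.
have := powRN_scale m0 (leq_trans (isT : 0 < 3)%N n3) n4.
have /andP[d0 _] := d01; have := powR_ge0 (n%:R : R) (- rho).
have := powR_ge0 (4%:R : R) rho; rewrite /rate.
move: (n.-1./2%:R `^ _) => y; move: (n%:R `^ _) => x; move: (_ `^ _) => k k0 x0 h.
have := mulr_ge0 k0 d0; nra.
Qed.

Lemma bigO_unif_le (e e' : setting R -> nat -> R -> \bar R) g :
  (forall S n delta, (e S n delta <= e' S n delta)%E) -> bigO_unif e' g -> bigO_unif e g.
Proof.
move=> ee' [C [d [n0 [C0 d0 n00 h]]]]; exists C, d, n0; split=> // S n delta hn hd.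
exact: le_trans (ee' _ _ _) (h _ _ _ hn hd).
Qed.

Lemma minimal_error_le_disturbed (S : setting R) n delta delta2 :
  (minimal_error rho r q s L T S n delta 0 <=
   minimal_error rho r q s L T S n delta delta2)%E.
Proof.
apply: le_ereal_inf_tmp => _ [A PA <-]; apply: le_trans (error_le_disturbed S A delta delta2).
by apply: ereal_inf_lbound; exists A.
Qed.

(** The bound holds for each single algorithm, so it serves the infimum defining the minimal error
    and, at cost 2n + 1, the quadrature itself. *)
Lemma error_lower_bound : rho <= 1 -> 0 < L -> exists2 c : R, 0 < c &
  forall S A n delta delta2, Phi T n A -> 0 <= delta <= L ->
    ((c * rate n delta)%:E <= error rho r q s L T S A delta delta2)%E.
Proof.
move=> rho_le1 L_gt0.
set k1 := Num.sqrt kappa * (L / (1 + T `^ rho)) * (T / 4) `^ rho * Num.sqrt (T / 2) : R.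
set k2 := Num.sqrt kappa * Num.sqrt T : R.
have sk : 0 < Num.sqrt kappa :> R by rewrite sqrtr_gt0 kappa_gt0.
have k2_gt0 : 0 < k2 by rewrite mulr_gt0// sqrtr_gt0.
have k1_gt0 : 0 < k1.
  apply: mulr_gt0; last by rewrite sqrtr_gt0 divr_gt0.
  apply: mulr_gt0; last by rewrite powR_gt0// divr_gt0.
  by apply: mulr_gt0 => //; rewrite divr_gt0// ltr_pwDl// powR_ge0.
(* The error dominates each of k1 n^(-rho) and k2 delta separately, hence half of their sum. *)
exists (Num.min k1 k2 / 2); first by rewrite divr_gt0// lt_min k1_gt0.
move=> S A n delta delta2 [a an ->] /andP[d0 dL].
have an1 : (i1 a <= n)%N by apply: leq_trans an; exact: leq_addr.
have n0 : (0 < n)%N by apply: leq_trans an1; exact: i1_gt0.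
have := lower_bound_noise s rho_gt0 r_ge2 r_lt_q L_gt0 T_gt0 S a delta2 d0 dL.
have := lower_bound_rate s rho_gt0 rho_le1 r_ge2 r_lt_q L_gt0 T_gt0 S delta delta2 n0 an1.
rewrite -/k1 -/k2; move: (error _ _ _ _ _ _ _ _ _ _) => [e||].
- rewrite !lee_fin /rate; have := powR_ge0 (n%:R : R) (- rho).
  move: (n%:R `^ _) => x x0 h1 h2.
  have g1 : Num.min k1 k2 <= k1 by rewrite ge_min lexx.
  have g2 : Num.min k1 k2 <= k2 by rewrite ge_min lexx orbT.
  move: (Num.min _ _) g1 g2 => c g1 g2.
  have := ler_wpM2r x0 g1; have := ler_wpM2r d0 g2; lra.
- by move=> *; rewrite leey.
- by rewrite leeNy_eq.
Qed.

Lemma bigOmega_minimal_error (delta2 : R -> R) : rho <= 1 -> 0 < L ->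
  bigOmega_unif (fun S n delta => minimal_error rho r q s L T S n delta (delta2 delta)) rate.
Proof.
move=> rho_le1 L_gt0; have [c c0 h] := error_lower_bound rho_le1 L_gt0.
exists c, L, 1%N; split=> // S n delta _ dL.
by apply: le_ereal_inf_tmp => _ [A PA <-]; exact: h.
Qed.

Lemma bigOmega_riemann_maruyama (delta2 : R -> R) : rho <= 1 -> 0 < L ->
  bigOmega_unif
    (fun S n delta => error rho r q s L T S (riemann_maruyama T n) delta (delta2 delta)) rate.
Proof.
move=> rho_le1 L_gt0; have [c c0 h] := error_lower_bound rho_le1 L_gt0.
have f0 : 0 < 1 + 3%:R `^ rho :> R by rewrite ltr_pwDl// powR_ge0.
exists (c / (1 + 3%:R `^ rho)), L, 1%N; split=> //; first by rewrite divr_gt0.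
move=> S n delta n0 dL; have /andP[d0 _] := dL.
apply: le_trans (h S _ _ _ (delta2 delta) (riemann_maruyama_Phi T_gt0 n0) dL).
rewrite lee_fin -mulrA (ler_pM2l c0) mulrC ler_pdivrMr//.
(* The quadrature with n cells belongs to the class of cost 2n + 1 <= 3n, which changes the rate by
   a factor 3^rho at most. *)
have n3 : (n + n.+1 <= 3 * n)%N by clear -n0; lia.
have := powRN_scale n0 (ltn_addl n (ltn0Sn n)) n3.
have := powR_ge0 ((n + n.+1)%:R : R) (- rho); have := powR_ge0 (3%:R : R) rho; rewrite /rate.
move: ((n + n.+1)%:R `^ _) => y; move: (n%:R `^ _) => x; move: (_ `^ _) => k k0 y0 hx.
have := mulr_ge0 k0 d0; nra.
Qed.

End rates.

(** For L = 0 each X(t) vanishes almost surely: the zero algorithm is exact and so is the quadrature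
    at delta = 0, which rules out a lower bound of order n^(-rho) + delta. Hence the two cases. *)
Theorem theorem2 (R : realType) (rho r q s L T : R)
    (rho_gt0 : 0 < rho) (rho_le1 : rho <= 1) (r_ge2 : 2 <= r) (r_lt_q : r < q)
    (s_ge0 : 0 <= s) (L_ge0 : 0 <= L) (T_gt0 : 0 < T) :
  let rate (n : nat) (delta : R) : R := n%:R `^ (- rho) + delta in
  let e_min_0 S n delta := minimal_error rho r q s L T S n delta 0 in
  let e_min_1 S n delta := minimal_error rho r q s L T S n delta delta in
  let e_RM_0 S n delta :=
    error rho r q s L T S (riemann_maruyama T n) delta 0 in
  let e_RM_1 S n delta :=
    error rho r q s L T S (riemann_maruyama T n) delta delta in
  (0 < L -> [/\ Theta_unif e_min_0 rate, Theta_unif e_min_1 rate,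
                Theta_unif e_RM_0 rate & Theta_unif e_RM_1 rate]) /\
  (L = 0 -> [/\ bigO_unif e_min_0 rate, bigO_unif e_min_1 rate,
                bigO_unif e_RM_0 rate & bigO_unif e_RM_1 rate]).
Proof.
move=> rate' e_min_0 e_min_1 e_RM_0 e_RM_1.
have OM1 : bigO_unif e_min_1 rate' by exact: bigO_minimal_error.
have OR1 : bigO_unif e_RM_1 rate' by exact: bigO_riemann_maruyama.
have OM0 : bigO_unif e_min_0 rate'.
  by apply: bigO_unif_le OM1 => S n delta; exact: minimal_error_le_disturbed.
have OR0 : bigO_unif e_RM_0 rate'.
  by apply: bigO_unif_le OR1 => S n delta; exact: error_le_disturbed.
split=> // L_gt0; split; split=> //.
- exact: (bigOmega_minimal_error s rho_gt0 r_ge2 r_lt_q T_gt0 (fun=> 0) rho_le1 L_gt0).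
- exact: (bigOmega_minimal_error s rho_gt0 r_ge2 r_lt_q T_gt0 id rho_le1 L_gt0).
- exact: (bigOmega_riemann_maruyama s rho_gt0 r_ge2 r_lt_q T_gt0 (fun=> 0) rho_le1 L_gt0).
- exact: (bigOmega_riemann_maruyama s rho_gt0 r_ge2 r_lt_q T_gt0 id rho_le1 L_gt0).
Qed.
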